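(* Let $d\ge2$ be an integer, let $\alpha\in\mathbb T^\infty$ be such that $\{n\alpha\}_{n\in\mathbb Z}$ is dense in $\mathbb T^\infty$, and let $\{y_t\}_{t\in\mathbb R}$ be an ergodic continuous one-parameter subgroup of $\mathbb T^\infty$ such that for each $n\ge1$ the map $\mathbb R\ni t\mapsto\big((y_t)_1,\ldots,(y_t)_n\big)\in\mathbb T^n$ is of class $C^1$. For each $j\in\{2,\ldots,d\}$, let $\phi_{j-1}\in C\big((\mathbb T^\infty)^{j-1};\mathbb T^\infty\big)$ be of the form $\phi_{j-1}=\xi_{j-1}+\eta_{j-1}$, where: (i) $\xi_{j-1}\in C\big((\mathbb T^\infty)^{j-1};\mathbb T^\infty\big)$ is a group homomorphism such that, for each $\chi\in\widehat{\mathbb T^\infty}\setminus\{1\}$, the character $\mathbb T^\infty\ni x_{j-1}\mapsto(\chi\circ\xi_{j-1})(0,\ldots,0,x_{j-1})\in\mathbb S^1$ is nontrivial (here $x_{j-1}$ is placed in the last of the $j-1$ slots); (ii) $\eta_{j-1}\in C\big((\mathbb T^\infty)^{j-1};\mathbb T^\infty\big)$ and there exists $\widetilde\eta_{j-1}=(\widetilde\eta_{j-1,k})_{k\ge1}\in C\big((\mathbb T^\infty)^{j-1};\mathbb R^\infty\big)$ such that $\eta_{j-1}(x)=\widetilde\eta_{j-1}(x)\ (\mathrm{mod}\ \mathbb Z^\infty)$ for each $x\in(\mathbb T^\infty)^{j-1}$, and such that for each $k\ge1$ the map $\mathbb R\ni t\mapsto\widetilde\eta_{j-1,k}\circ F_{j-1,t}\in\mathscr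 B(\mathcal H_{j-1})$ (with values in multiplication operators) is strongly of class $C^1$. Let $T_d:(\mathbb T^\infty)^d\to(\mathbb T^\infty)^d$ be given by $$T_d(x_1,\ldots,x_d):=\big(x_1+\alpha,\,x_2+\phi_1(x_1),\ldots,x_d+\phi_{d-1}(x_1,\ldots,x_{d-1})\big),$$ and let $W_d:\mathcal H_d\to\mathcal H_d$, $W_d\varphi:=\varphi\circ T_d$, be its Koopman operator. Then $W_d$ is strongly mixing in $\mathcal H_d\ominus\mathcal H_1$, and $T_d$ is uniquely ergodic with respect to $\mu_d$.
   Context: $\mathbb T^\infty\simeq\mathbb R^\infty/\mathbb Z^\infty$ is the infinite-dimensional torus (countable product of copies of $\mathbb T=\mathbb R/\mathbb Z$, with product topology), with elements $x=\{(x)_k\}_{k=1}^\infty$; $\mathbb R^\infty$ is the countable product of copies of $\mathbb R$ with product topology; $\widehat{\mathbb T^\infty}$ is the dual group (continuous characters) of $\mathbb T^\infty$, with trivial character $1$; $\mathbb S^1=\{z\in\mathbb C:|z|=1\}$. For $n\ge1$, $\mu_n$ is the normalised Haar measure on $(\mathbb T^\infty)^n$ and $\mathcal H_n:=L^2\big((\mathbb T^\infty)^n,\mu_n\big)$. For $m\le n$, $\mathcal H_m$ is identified with the closed subspace of $\mathcal H_n$ of functions depending only on the first $m$ variables $x_1,\dots,x_m\in\mathbb T^\infty$; $\ominus$ denotes orthogonal complement. $\mathscr B(\mathcal H)$ is the set of bounded linear operators on $\mathcal H$. A continuous one-parameter subgroup $\{y_t\}_{t\in\mathbb R}$ of $\mathbb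 T^\infty$ is ergodic if the translation flow $x\mapsto x+y_t$ on $\mathbb T^\infty$ is ergodic with respect to $\mu_1$. The associated flow on $(\mathbb T^\infty)^{j-1}$ is $$F_{j-1,t}(x_1,\ldots,x_{j-1}):=(x_1,\ldots,x_{j-2},x_{j-1}+y_t),\quad t\in\mathbb R.$$ A bounded measurable function on $(\mathbb T^\infty)^{j-1}$ is identified with the corresponding multiplication operator in $\mathcal H_{j-1}$. A map $t\mapsto S(t)\in\mathscr B(\mathcal H)$ is strongly of class $C^1$ if $t\mapsto S(t)\varphi\in\mathcal H$ is of class $C^1$ for every $\varphi\in\mathcal H$. $W_d$ leaves $\mathcal H_d\ominus\mathcal H_1$ invariant; it is strongly mixing in $\mathcal H_d\ominus\mathcal H_1$ if $\lim_{N\to\infty}\langle\varphi,W_d^N\psi\rangle=0$ for all $\varphi,\psi\in\mathcal H_d\ominus\mathcal H_1$. $T_d$ is uniquely ergodic with respect to $\mu_d$ if $\mu_d$ is the only $T_d$-invariant Borel probability measure on $(\mathbb T^\infty)^d$. *)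

(* Defs.v *)
From HB Require Import structures.
From mathcomp Require Import all_boot all_order all_algebra.
From mathcomp Require Import generic_quotient ring_quotient complex.
From mathcomp Require Import all_classical all_reals all_analysis.

Set Implicit Arguments.
Unset Strict Implicit.
Unset Printing Implicit Defensive.
Import Order.TTheory GRing.Theory Num.Theory.
Import numFieldNormedType.Exports.
Local Open Scope classical_set_scope.
Local Open Scope ring_scope.

(** * The torus R^oo / Z^oo and its finite powers *)

Definition is_int (R : realType) : R -> bool := fun x => x \is a Num.int.

Fact is_int_zmod_closed (R : realType) : zmod_closed (@is_int R).
Proof. by split; [exact: int_num0 | move=> x y; exact: rpredB]. Qed.

HB.instance Definition _ (R : realType) :=
  GRing.isZmodClosed.Build R (@is_int R) (@is_int_zmod_closed R).

Definition integers (R : realType) : zmodClosed R :=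
  GRing.ZmodClosed.clone R (@is_int R) _.

Definition circle (R : realType) : Type :=
  quotient_topology (Quotient.quot (integers R)).

HB.instance Definition _ (R : realType) := Quotient.on (circle R).
HB.instance Definition _ (R : realType) := PointedTopological.on (circle R).
(* The group structure is rebuilt rather than copied because the quotient
   group and the quotient topology come with distinct choice structures. *)
HB.instance Definition _ (R : realType) := @GRing.isZmodule.Build (circle R)
  _ _ _ (@Quotient.addqA R _) (@Quotient.addqC R _)
  (@Quotient.add0q R _) (@Quotient.addNq R _).

Definition modZ (R : realType) (r : R) : circle R := (\pi_(circle R) r)%qT.

Lemma modZD (R : realType) : {morph @modZ R : r s / r + s}.
Proof. by move=> r s; rewrite /modZ; exact: Quotient.pi_add. Qed.

Definition torus (R : realType) : Type := {ptws nat -> circle R}.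

HB.instance Definition _ (R : realType) := Topological.on (torus R).
HB.instance Definition _ (R : realType) :=
  isPointed.Build (torus R) (fun=> point).
HB.instance Definition _ (R : realType) :=
  GRing.Zmodule.copy (torus R) (nat -> circle R).

(* The points (x_1, ..., x_n) of the n-th power; x_(i+1) is [x i], i : 'I_n. *)
Definition torus_pow (R : realType) (n : nat) : Type :=
  {ptws 'I_n -> torus R}.

HB.instance Definition _ (R : realType) (n : nat) :=
  Topological.on (torus_pow R n).
HB.instance Definition _ (R : realType) (n : nat) :=
  isPointed.Build (torus_pow R n) (fun=> point).
HB.instance Definition _ (R : realType) (n : nat) :=
  GRing.Zmodule.copy (torus_pow R n) ('I_n -> torus R).

Definition Borel (X : ptopologicalType) := g_sigma_algebraType (@open X).

(* A translation-invariant Borel probability measure is the normalised Haar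
   measure (unique; regularity is automatic on a compact metrisable group). *)
Definition translation_invariant (R : realType) (n : nat)
    (mu : probability (Borel (torus_pow R n)) R) : Prop :=
  forall (a : torus_pow R n) (A : set (Borel (torus_pow R n))),
    measurable A -> mu ((fun x : torus_pow R n => x + a) @^-1` A) = mu A.

(* S^1 is the set of complex numbers of modulus 1. *)
Definition is_character (R : realType) (chi : torus R -> R[i]) : Prop :=
  [/\ continuous (chi : torus R -> R[i]^o),
      forall x, `|chi x| = 1 &
      forall x y, chi (x + y) = chi x * chi y].

(** * Complex L^2 spaces *)

(* Elements are represented by measurable functions instead of classes modulo
   almost everywhere equality. *)

Section L2.
Context (R : realType) (d : measure_display) (X : measurableType d).
Variable mu : probability X R.

Definition L2 : set (X -> R[i]) :=
  [set f | (fun x => complex.Re (f x)) \in Lfun mu 2%:E /\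
           (fun x => complex.Im (f x)) \in Lfun mu 2%:E].

Definition L2norm (f : X -> R[i]) : \bar R :=
  Lnorm mu 2%:E (fun x => (complex.Re `|f x|)%:E).

Definition complex_integral (f : X -> R[i]) : R[i] :=
  Complex (\int[mu]_x complex.Re (f x))%R (\int[mu]_x complex.Im (f x))%R.

Definition L2inner (f g : X -> R[i]) : R[i] :=
  complex_integral (fun x => (f x)^* * g x).

(* Limits are taken for the L^2 norm and Du is the derivative of u. *)
Definition L2_C1 (u : R -> X -> R[i]) : Prop :=
  (forall t, L2 (u t)) /\
  exists Du : R -> X -> R[i],
    [/\ forall t, L2 (Du t),
        forall t, L2norm (fun x =>
            (h^-1)%:C%C * (u (t + h) x - u t x) - Du t x) @[h --> 0^'] --> 0%E &
        forall t, L2norm (fun x => Du s x - Du t x) @[s --> t] --> 0%E].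

(* Here a : R -> X -> R stands for a family of operators of multiplication by
   real functions. *)
Definition strongly_C1 (a : R -> X -> R) : Prop :=
  forall f, L2 f -> L2_C1 (fun t x => (a t x)%:C%C * f x).

Definition koopman (T : X -> X) (f : X -> R[i]) : X -> R[i] := f \o T.

Definition strongly_mixing_in (K : set (X -> R[i])) (T : X -> X) : Prop :=
  forall f g, K f -> K g ->
    (L2inner f (iter N (koopman T) g) : R[i]^o) @[N --> \oo] --> (0 : R[i]^o).

Definition invariant (T : X -> X) : Prop :=
  forall A, measurable A -> mu (T @^-1` A) = mu A.

Definition ergodic_flow (F : R -> X -> X) : Prop :=
  forall A, measurable A ->
    (forall t, mu ((F t @^-1` A) `+` A) = 0%E) -> mu A = 0%E \/ mu A = 1%E.

End L2.

Definition uniquely_ergodic (R : realType) (d : measure_display)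
    (X : measurableType d) (mu : probability X R) (T : X -> X) : Prop :=
  invariant mu T /\
  forall nu : probability X R, invariant nu T ->
    forall A, measurable A -> nu A = mu A.

(* H_m inside H_n *)
Definition L2_first (R : realType) (n : nat)
    (mu : probability (Borel (torus_pow R n)) R) (m : nat) :
    set (torus_pow R n -> R[i]) :=
  [set f | L2 mu f /\ forall x y : torus_pow R n,
             (forall i : 'I_n, (i < m)%N -> x i = y i) -> f x = f y].

(* H_n \ominus H_m *)
Definition L2_ominus (R : realType) (n : nat)
    (mu : probability (Borel (torus_pow R n)) R) (m : nat) :
    set (torus_pow R n -> R[i]) :=
  [set f | L2 mu f /\ forall g, L2_first mu m g -> L2inner mu g f = 0].

(** * Flows and skew products *)

Definition C1 (R : realType) (g : R -> R) : Prop :=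
  (forall t, derivable g t 1) /\ continuous (derive1 g).

(* A map into the manifold R^n / Z^n is of class C^1 when it lifts, locally, to
   a map of class C^1 into R^n. *)
Definition circle_pow_C1 (R : realType) (n : nat) (f : R -> 'I_n -> circle R) :
    Prop :=
  forall t0 : R, exists2 g : R -> 'I_n -> R,
    (forall i, C1 (g ^~ i)) &
    \forall t \near t0, forall i, f t i = modZ (g t i).

Definition one_parameter_subgroup (R : realType) (y : R -> torus R) : Prop :=
  continuous y /\ forall s t, y (s + t) = y s + y t.

(* x |-> x + a, the first power of the torus being identified with the torus *)
Definition translation (R : realType) (a : torus R) (x : torus_pow R 1) :
    torus_pow R 1 := fun i => x i + a.

(* (x_1, ..., x_m) |-> (x_1, ..., x_(m-1), x_m + y_t) *)
Definition last_flow (R : realType) (m : nat) (y : R -> torus R) (t : R)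
    (x : torus_pow R m) : torus_pow R m :=
  fun i => if i.+1 == m then x i + y t else x i.

(* (0, ..., 0, x) *)
Definition last_slot (R : realType) (m : nat) (x : torus R) : torus_pow R m :=
  fun i => if i.+1 == m then x else 0.
Arguments last_slot {R} m x _.

Definition first_coords (R : realType) (n m : nat) (le_mn : (m <= n)%N)
    (x : torus_pow R n) : torus_pow R m := fun i => x (widen_ord le_mn i).

(* For i > 0 the variable x_(i+1) is shifted by phi_i (x_1, ..., x_i). *)
Definition skew_product (R : realType) (d : nat) (alpha : torus R)
    (phi : forall m, torus_pow R m -> torus R) (x : torus_pow R d) :
    torus_pow R d :=
  fun i => x i + (if (i : nat) == 0%N then alpha
                  else phi i (first_coords (ltnW (ltn_ord i)) x)).

(* Main.v *)
(** Everything is tested on characters.  Let [c] be a character of (T^oo)^d whose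
    last nontrivial coordinate [m] is not the first one, and let [e] be any
    character.  In the integral of e(x) c(T^N x), translate coordinate [m - 1] of
    [x] by y_(s/N), which preserves the Haar measure.  Since T commutes with this
    flow on the first [m] coordinates, the integrand is multiplied by the constant
    c_m(xi_m(0, ..., 0, y_s)) and by two error factors.  One tends to 1 by
    continuity of the flow; the other is exp(2 pi i .) of s times a Birkhoff
    average of difference quotients of the lift of eta_m.  These quotients are
    Cauchy in L^2 and have mean zero, hence the average tends to 0 in L^2 as soon
    as the mean ergodic theorem holds on the first [m] coordinates.  Ergodicity of
    the flow provides [s] with c_m(xi_m(0, ..., 0, y_s)) different from 1, so the
    integral tends to 0.  This decay of correlations gives in turn the mean
    ergodic theorem for characters with last coordinate [m], and the induction
    proceeds.

    For unique ergodicity, the modulus of the Birkhoff averages of [c] depends only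
    on the coordinates before [m], on which an invariant measure is Haar by
    induction; its mean square therefore tends to 0, and it bounds the integral of
    [c], which is thus 0.  A probability measure is determined by its integrals of
    characters, because the sets whose indicator is a limit in the mean of
    trigonometric polynomials form a sigma-algebra containing the open sets.

    Phases stay in the circle group and only the real function c1 = cos(2 pi .) is
    integrated: the real and imaginary parts of a multiple of a character are
    multiples of functions x |-> c1 (pchar c x + b). *)
Require Import Defs.
From mathcomp Require Import all_boot all_order all_algebra.
From mathcomp Require Import generic_quotient ring_quotient complex.
From mathcomp Require Import all_classical all_reals all_analysis.
From mathcomp Require Import measurable_realfun.
From mathcomp Require Import ring lra.
Import Order.TTheory GRing.Theory Num.Theory.
Import numFieldNormedType.Exports.
Local Open Scope classical_set_scope.
Local Open Scope ring_scope.
Set Implicit Arguments.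
Unset Strict Implicit.
Unset Printing Implicit Defensive.

(** * The circle *)

Lemma ptws_cvgP (I : eqType) (T : topologicalType)
    (F : set_system {ptws I -> T}) (f : {ptws I -> T}) : Filter F ->
  F --> f <-> forall i, (fun g : {ptws I -> T} => g i) @ F --> f i.
Proof.
move=> FF; split=> [Ff i|Ff].
  apply: cvg_trans (@proj_continuous I (fun=> T) i f).
  exact: cvg_app.
apply/cvg_sup => i U.
have /= -> := @nbhsE (initial_topology (fun g : I -> T => g i)) f.
case=> B [[C oC <-] fB] /filterS; apply; apply: (Ff i C).
exact: open_nbhs_nbhs.
Qed.

Lemma ptws_proj_continuous (I : eqType) (T : topologicalType) (i : I) :
  continuous (fun g : {ptws I -> T} => g i).
Proof. by move=> f; exact: (@proj_continuous I (fun=> T) i f). Qed.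

Lemma ptws_continuousP (S : topologicalType) (I : eqType) (T : topologicalType)
    (h : S -> {ptws I -> T}) :
  continuous h <-> forall i, continuous (fun x => h x i).
Proof.
split=> [ch i x|ch x]; first by move/(_ x)/ptws_cvgP : ch => /(_ i).
by apply/ptws_cvgP => i; exact: ch.
Qed.

Section circle.
Variable R : realType.
Implicit Types (z w : circle R) (r s : R).

Lemma modZ_eqP r s : modZ r = modZ s <-> exists n : int, r - s = n%:~R.
Proof.
have e := @Quotient.idealrBE R (integers R) r s; split=> [rs|[n rs]].
  by apply/intrP; rewrite -[_ \is a _]/(_ \in integers R) e; apply/eqP.
by apply/(@eqP (Quotient.quot (integers R))); rewrite -e; apply/intrP; exists n.
Qed.

Lemma repr_modZ r : exists n : int, repr (modZ r) = r + n%:~R.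
Proof.
have /modZ_eqP[n rn] : modZ (repr (modZ r)) = modZ r by rewrite /modZ reprK.
by exists n; rewrite -rn addrC subrK.
Qed.

Lemma modZ_surj z : exists r, z = modZ r.
Proof. by exists (repr z); rewrite /modZ reprK. Qed.

Lemma modZ0 : modZ 0 = 0 :> circle R.
Proof. by apply: (@addrI _ (modZ 0)); rewrite -modZD !addr0. Qed.

Lemma modZN : {morph @modZ R : r / - r}.
Proof. by move=> r; apply: (@addrI _ (modZ r)); rewrite -modZD !subrr modZ0. Qed.

Lemma cos2pi_int (n : int) r : cos (2 * pi * (r + n%:~R)) = cos (2 * pi * r).
Proof.
have cosn (k : nat) s : cos (2 * pi * (s + k%:R)) = cos (2 * pi * s).
  elim: k s => [|k IH] s; first by rewrite addr0.
  by rewrite -[k.+1%:R]natr1 addrA mulrDr mulr1 mulr_natl cosD2pi -mulr_natl.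
case: (intP n) => [|k|k]; first by rewrite addr0.
  by rewrite cosn.
by rewrite -(cosn k.+1 (r + _)) -addrA mulrNz addNr addr0.
Qed.

Lemma sin2pi_int (n : int) r : sin (2 * pi * (r + n%:~R)) = sin (2 * pi * r).
Proof.
have e s : sin (2 * pi * s) = cos (2 * pi * (s - 1 / 4)).
  rewrite -cosBpihalf; congr cos; lra.
by rewrite !e -[in RHS](cos2pi_int n) addrAC.
Qed.

(** The choice of representative is immaterial: by [cos2pi_int] and [sin2pi_int] every
    representative gives the same value, whence [c1_modZ] and [s1_modZ]. *)
Definition c1 z : R := cos (2 * pi * repr z).
Definition s1 z : R := sin (2 * pi * repr z).

Lemma c1_modZ r : c1 (modZ r) = cos (2 * pi * r).
Proof. by rewrite /c1; have [n ->] := repr_modZ r; rewrite cos2pi_int. Qed.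

Lemma s1_modZ r : s1 (modZ r) = sin (2 * pi * r).
Proof. by rewrite /s1; have [n ->] := repr_modZ r; rewrite sin2pi_int. Qed.

Lemma c10 : c1 0 = 1.
Proof. by rewrite -modZ0 c1_modZ mulr0 cos0. Qed.

Lemma s10 : s1 0 = 0.
Proof. by rewrite -modZ0 s1_modZ mulr0 sin0. Qed.

Lemma c1D z w : c1 (z + w) = c1 z * c1 w - s1 z * s1 w.
Proof.
have [[r ->] [s ->]] := (modZ_surj z, modZ_surj w).
by rewrite -modZD !c1_modZ !s1_modZ mulrDr cosD.
Qed.

Lemma s1D z w : s1 (z + w) = s1 z * c1 w + c1 z * s1 w.
Proof.
have [[r ->] [s ->]] := (modZ_surj z, modZ_surj w).
by rewrite -modZD !c1_modZ !s1_modZ mulrDr sinD.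
Qed.

Lemma c1N z : c1 (- z) = c1 z.
Proof.
by have [r ->] := modZ_surj z; rewrite -modZN !c1_modZ mulrN cosN.
Qed.

Lemma s1N z : s1 (- z) = - s1 z.
Proof.
by have [r ->] := modZ_surj z; rewrite -modZN !s1_modZ mulrN sinN.
Qed.

Lemma c1B z w : c1 (z - w) = c1 z * c1 w + s1 z * s1 w.
Proof. by rewrite c1D c1N s1N; ring. Qed.

Lemma c1s1 z : c1 z ^+ 2 + s1 z ^+ 2 = 1.
Proof. exact: cos2Dsin2. Qed.

Lemma normr_c1 z : `|c1 z| <= 1. Proof. exact: cos_max. Qed.

Lemma normr_s1 z : `|s1 z| <= 1. Proof. exact: sin_max. Qed.

(** A quarter turn converts cosines into sines, so statements about [c1] with an arbitrary phase
    also cover [s1]. *)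
Definition quarter : circle R := modZ (1 / 4).

Lemma s1E z : s1 z = c1 (z - quarter).
Proof.
have e : 2 * pi * (1 / 4) = pi / 2 :> R by lra.
by rewrite c1B c1_modZ s1_modZ e cos_pihalf sin_pihalf mulr0 mulr1 add0r.
Qed.

Lemma c1_quarter z w : c1 (z + (w - quarter)) = s1 (z + w).
Proof. by rewrite s1E addrA. Qed.

Lemma c1M z w : c1 z * c1 w = (c1 (z + w) + c1 (z - w)) / 2.
Proof. by rewrite c1B c1D; lra. Qed.

Lemma modZ_continuous : continuous (@modZ R).
Proof. exact: (@pi_continuous _ (Quotient.quot (integers R))). Qed.

Lemma c1_continuous : continuous c1.
Proof.
apply/(@quotient_continuous _ (Quotient.quot (integers R))) => r.
rewrite (_ : _ \o _ = fun s => cos (2 * pi * s)); last first.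
  by apply/funext => s; exact: c1_modZ.
apply: continuous_comp; last exact: continuous_cos.
by apply: cvgMr; exact: cvg_id.
Qed.

Lemma s1_continuous : continuous s1.
Proof.
apply/(@quotient_continuous _ (Quotient.quot (integers R))) => r.
rewrite (_ : _ \o _ = fun s => sin (2 * pi * s)); last first.
  by apply/funext => s; exact: s1_modZ.
apply: continuous_comp; last exact: continuous_sin.
by apply: cvgMr; exact: cvg_id.
Qed.

Lemma c1_modZ_norm r : c1 (modZ r) = cos (2 * pi * `|r|).
Proof.
rewrite c1_modZ -cos_norm normrM (ger0_norm (_ : 0 <= 2 * pi)) //.
by rewrite mulr_ge0 // pi_ge0.
Qed.

Lemma circle_reprP z : exists2 t, z = modZ t & `|t| <= 1 / 2.
Proof.
(* Subtracting the nearest integer brings the representative into [-1/2, 1/2]. *)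
have [r ->] := modZ_surj z; pose n := Num.floor (r + 1 / 2).
exists (r - n%:~R); first by apply/modZ_eqP; exists n; lra.
have := floor_itv (r + 1 / 2); rewrite -/n intrD ler_norml.
by move=> /andP[? ?]; apply/andP; split; lra.
Qed.

(** For the representative t with |t| at most 1/2, the angle 2 pi |t| lies in [0, pi], where cosine
    is injective. *)
Lemma c1_eq1 z : c1 z = 1 -> z = 0.
Proof.
have [t -> t_le] := circle_reprP z; have t_ge0 := normr_ge0 t.
have pi0 := pi_gt0 R.
rewrite c1_modZ_norm => cos1.
have : 2 * pi * `|t| = 0.
  by apply: cos_inj; rewrite ?cos0 // in_itv /=; apply/andP; split; nra.
move/eqP; rewrite mulf_eq0 mulf_eq0 pnatr_eq0 (gt_eqF pi0) /= normr_eq0.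
by move/eqP => ->; rewrite modZ0.
Qed.

(** The function 1 - [c1] (w - z) serves as a distance on the circle; its small values force w close
    to z because cosine is strictly decreasing on [0, pi]. *)
Lemma circle_nbhs z (U : set (circle R)) : nbhs z U ->
  exists2 e : R, 0 < e & forall w, 1 - c1 (w - z) < e -> U w.
Proof.
have [r ->{z}] := modZ_surj z => nU.
have /nbhs_ballP[d0 /= d0_gt0 d0U] := modZ_continuous nU.
(* The cap 1/2 keeps the angle 2 pi d inside [0, pi]. *)
pose d := Num.min d0 (1 / 2).
have d_gt0 : 0 < d by rewrite lt_min d0_gt0; lra.
have d_le : d <= 1 / 2 by rewrite ge_min lexx orbT.
have pi0 := pi_gt0 R.
have d_in : 2 * pi * d \in `[0, pi].
  by rewrite in_itv /=; apply/andP; split; nra.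
exists (1 - cos (2 * pi * d)).
  have : cos (2 * pi * d) < cos 0.
    by rewrite ltr_cos // ?mulr_gt0 // in_itv /= lexx pi_ge0.
  by rewrite cos0; lra.
move=> w; have [t ew t_le] := circle_reprP (w - modZ r).
have -> : w = modZ (r + t) by rewrite modZD -ew addrC subrK.
have -> : c1 (modZ (r + t) - modZ r) = cos (2 * pi * `|t|).
  by rewrite modZD addrAC subrr add0r c1_modZ_norm.
move=> lt1; apply: d0U; rewrite /ball /=.
have : cos (2 * pi * d) < cos (2 * pi * `|t|) by lra.
rewrite ltr_cos //; last first.
  by have t0 := normr_ge0 t; rewrite in_itv /=; apply/andP; split; nra.
rewrite ltr_pM2l ?mulr_gt0 // => td.
rewrite opprD addrA subrr add0r normrN (lt_le_trans td) //.
by rewrite ge_min lexx.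
Qed.

Lemma circle_cvgP (T : Type) (F : set_system T) (f : T -> circle R) z :
  Filter F -> f @ F --> z <-> (fun x => c1 (f x - z)) @ F --> (1 : R).
Proof.
move=> FF; split=> fz.
  have fc := cvg_comp _ _ fz (@c1_continuous z); have fs := cvg_comp _ _ fz (@s1_continuous z).
  rewrite -c10 -(subrr z) c1B (_ : (fun x => _) = fun x =>
    c1 (f x) * c1 z + s1 (f x) * s1 z); last by apply/funext => x; rewrite c1B.
  exact: cvgD (cvgM fc (cvg_cst _)) (cvgM fs (cvg_cst _)).
move=> U /circle_nbhs[e e0 eU].
have /cvgrPdist_lt/(_ e e0) := fz; apply: filterS => x /= xe.
by apply: eU; apply: le_lt_trans xe; exact: ler_norm.
Qed.

(** By [circle_cvgP] only [c1] of the difference to the limit matters, and the addition formulas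
    make it a polynomial in the cosines and sines of f, g and their limits. *)
Lemma circle_cvgD (T : Type) (F : set_system T) (f g : T -> circle R) z w :
  Filter F -> f @ F --> z -> g @ F --> w -> (fun x => f x + g x) @ F --> z + w.
Proof.
move=> FF fz gw; apply/circle_cvgP.
have fc := cvg_comp _ _ fz (@c1_continuous z); have fs := cvg_comp _ _ fz (@s1_continuous z).
have gc := cvg_comp _ _ gw (@c1_continuous w); have gs := cvg_comp _ _ gw (@s1_continuous w).
rewrite -c10 -(subrr (z + w)) c1B (c1D z w) (s1D z w).
rewrite (_ : (fun x => _) = fun x =>
    (c1 (f x) * c1 (g x) - s1 (f x) * s1 (g x)) * (c1 z * c1 w - s1 z * s1 w) +
    (s1 (f x) * c1 (g x) + c1 (f x) * s1 (g x)) * (s1 z * c1 w + c1 z * s1 w));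
  last by apply/funext => x; rewrite c1B (c1D (f _)) (s1D (f _)) c1D s1D.
apply: cvgD; apply: cvgM; try exact: cvg_cst.
  exact: cvgB (cvgM fc gc) (cvgM fs gs).
exact: cvgD (cvgM fs gc) (cvgM fc gs).
Qed.

Lemma circle_cvgN (T : Type) (F : set_system T) (f : T -> circle R) z :
  Filter F -> f @ F --> z -> (fun x => - f x) @ F --> - z.
Proof.
move=> FF /circle_cvgP fz; apply/circle_cvgP.
rewrite (_ : (fun x => _) = fun x => c1 (f x - z)) //.
by apply/funext => x; rewrite -opprD c1N.
Qed.

Lemma circle_compact : compact [set: circle R].
Proof.
have -> : [set: circle R] = @modZ R @` `[0, 1].
  apply/seteqP; split=> // z _; have [r ->] := modZ_surj z.
  exists (r - (Num.floor r)%:~R).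
    have := floor_itv r; rewrite intrD => /andP[? ?].
    by rewrite /= in_itv /=; apply/andP; split; lra.
  by apply/modZ_eqP; exists (- Num.floor r); rewrite mulrNz; lra.
apply: continuous_compact; last exact: segment_compact.
exact/continuous_subspaceT/modZ_continuous.
Qed.

Lemma cos_dist r s : `|cos r - cos s| <= `|r - s|.
Proof.
wlog sr : r s / s < r.
  move=> h; have [?|?|->] := ltgtP s r; first exact: h.
    by rewrite distrC (distrC r) h.
  by rewrite !subrr.
have dcos x : x \in `]s, r[ -> is_derive x 1 (cos : R -> R) (- sin x).
  by move=> _; exact: is_derive_cos.
have [|c _ ->] := MVT sr dcos.
  exact/continuous_subspaceT/continuous_cos.
by rewrite normrM normrN ler_piMl // sin_max.
Qed.

(** This Lipschitz bound converts smallness of a real increment of the lift into smallness of the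
    change of phase. *)
Lemma c1_shift z r : `|c1 (z + modZ r) - c1 z| <= 2 * pi * `|r|.
Proof.
have [s ->] := modZ_surj z; rewrite -modZD !c1_modZ.
apply: le_trans (cos_dist _ _) _.
rewrite -mulrBr addrAC subrr add0r normrM (ger0_norm (_ : 0 <= 2 * pi)) //.
by rewrite mulr_ge0 // pi_ge0.
Qed.

(** Cosine is a coboundary for any nontrivial rotation: with z = 2h, cos (u - h) - cos (u + h) = 2
    sin u sin h, and sin h is nonzero because z is. Consequently a mean insensitive to the rotation
    vanishes, and Birkhoff sums over a rotation telescope. *)
Lemma c1_increment z : z <> 0 ->
  exists k b, forall w, c1 w = k * (c1 (w + b) - c1 (w + b + z)).
Proof.
move=> z0; have [t et] := modZ_surj z; pose h := modZ (t / 2).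
have eh : z = h + h by rewrite et -modZD; congr modZ; lra.
have s1h : s1 h != 0.
  apply/eqP => sh; apply: z0; apply: c1_eq1.
  by have := c1s1 h; rewrite eh c1D sh !expr2 !mulr0 !addr0 subr0.
exists (2 * s1 h)^-1, (quarter - h) => w.
have -> : w + (quarter - h) + z = (w + quarter) + h.
  by rewrite eh addrA addrA subrK.
rewrite addrA c1B (c1D _ h).
have -> : c1 w = s1 (w + quarter) by rewrite s1E addrK.
by field.
Qed.

End circle.

(** * Means of bounded measurable functions *)

Section mean.
Context (R : realType) d (T : measurableType d).
Implicit Types (P : probability T R) (f g : T -> R).

(** Bounded measurable functions form an algebra, integrable for every probability at once; this
    keeps integrability side conditions light. *)
Definition bmf f := measurable_fun [set: T] f /\ exists M : R, forall x, `|f x| <= M.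

Definition mean P f : R := (\int[P]_x f x)%R.

Definition integ P f := P.-integrable [set: T] (EFin \o f).

Lemma bmf_cst (r : R) : bmf (fun=> r).
Proof. by split; [exact: measurable_cst|exists `|r|]. Qed.

Lemma bmfD f g : bmf f -> bmf g -> bmf (fun x => f x + g x).
Proof.
move=> [mf [M fM]] [mg [N gN]]; split; first exact: measurable_funD.
by exists (M + N) => x; rewrite (le_trans (ler_normD _ _)) // lerD.
Qed.

Lemma bmfM f g : bmf f -> bmf g -> bmf (fun x => f x * g x).
Proof.
move=> [mf [M fM]] [mg [N gN]]; split; first exact: measurable_funM.
by exists (M * N) => x; rewrite normrM ler_pM.
Qed.

Lemma bmfZ r f : bmf f -> bmf (fun x => r * f x).
Proof. by move=> bf; apply: bmfM => //; exact: bmf_cst. Qed.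

Lemma bmfN f : bmf f -> bmf (fun x => - f x).
Proof.
move=> /(bmfZ (-1)); rewrite (_ : (fun x => -1 * f x) = (fun x => - f x)) //.
by apply/funext => x; rewrite mulN1r.
Qed.

Lemma bmfB f g : bmf f -> bmf g -> bmf (fun x => f x - g x).
Proof. by move=> bf bg; apply: bmfD => //; exact: bmfN. Qed.

Lemma bmfX f n : bmf f -> bmf (fun x => f x ^+ n).
Proof.
move=> bf; elim: n => [|n IH]; first exact: bmf_cst.
rewrite (_ : (fun x => f x ^+ n.+1) = (fun x => f x * f x ^+ n)); first exact: bmfM.
by apply/funext => x; rewrite exprS.
Qed.

Lemma bmf_sum (I : Type) (s : seq I) (F : I -> T -> R) :
  (forall i, bmf (F i)) -> bmf (fun x => \sum_(i <- s) F i x).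
Proof.
move=> bF; elim: s => [|i s IH].
  rewrite (_ : (fun x => _) = fun=> 0); first exact: bmf_cst.
  by apply/funext => x; rewrite big_nil.
rewrite (_ : (fun x => _) = fun x => F i x + \sum_(i <- s) F i x).
  exact: bmfD.
by apply/funext => x; rewrite big_cons.
Qed.

Lemma bmf_indic (A : set T) : measurable A -> bmf (\1_A : T -> R).
Proof.
move=> mA; split; first exact: measurable_indic.
by exists 1 => x; rewrite indicE; case: (_ \in _); rewrite ?normr1 ?normr0.
Qed.

Lemma bmf_integ P f : bmf f -> integ P f.
Proof.
move=> [mf [M fM]]; apply: (@le_integrable _ _ _ P _ measurableT _ (EFin \o cst M)).
- exact/measurable_EFinP.
- move=> x _ /=; rewrite lee_fin (le_trans (fM x)) //; exact: ler_norm.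
- exact: finite_measure_integrable_cst.
Qed.

Lemma integD P f g : integ P f -> integ P g -> integ P (fun x => f x + g x).
Proof.
move=> If Ig; have := integrableD measurableT If Ig.
by rewrite /integ; under eq_fun do rewrite /= -EFinD.
Qed.

Lemma integZ P r f : integ P f -> integ P (fun x => r * f x).
Proof.
move=> If; have := integrableZl measurableT r If.
by rewrite /integ; under eq_fun do rewrite /= -EFinM.
Qed.

Lemma meanD P f g : integ P f -> integ P g ->
  mean P (fun x => f x + g x) = mean P f + mean P g.
Proof. exact: RintegralD. Qed.

Lemma meanB P f g : integ P f -> integ P g ->
  mean P (fun x => f x - g x) = mean P f - mean P g.
Proof. exact: RintegralB. Qed.

Lemma meanZ P r f : integ P f -> mean P (fun x => r * f x) = r * mean P f.
Proof. exact: RintegralZl. Qed.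

Lemma mean_cst P r : mean P (fun=> r) = r.
Proof. transitivity (r * fine (P setT)); first exact: Rintegral_cst.
by rewrite probability_setT mulr1. Qed.

Lemma mean_le P f g : integ P f -> integ P g -> (forall x, f x <= g x) ->
  mean P f <= mean P g.
Proof. by move=> If Ig fg; apply: le_Rintegral. Qed.

Lemma mean_ge0 P f : (forall x, 0 <= f x) -> 0 <= mean P f.
Proof. by move=> f0; apply: Rintegral_ge0. Qed.

Lemma normr_mean_le P f (M : R) : bmf f -> (forall x, `|f x| <= M) ->
  `|mean P f| <= M.
Proof.
move=> bf fM; have If := bmf_integ P bf.
have Ic (r : R) : integ P (fun=> r) by exact/bmf_integ/bmf_cst.
rewrite ler_norml -{1}(mean_cst P (- M)) -{2}(mean_cst P M).
by apply/andP; split; apply: mean_le => // x;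
  have := fM x; rewrite ler_norml => /andP[].
Qed.

Lemma mean_sum P (I : Type) (s : seq I) (F : I -> T -> R) :
  (forall i, bmf (F i)) ->
  mean P (fun x => \sum_(i <- s) F i x) = \sum_(i <- s) mean P (F i).
Proof.
move=> bF; elim: s => [|i s IH].
  by rewrite big_nil -[RHS](mean_cst P); congr mean; apply/funext => x; rewrite big_nil.
rewrite big_cons -IH -meanD; [|exact: bmf_integ|by apply: bmf_integ; exact: bmf_sum].
by congr mean; apply/funext => x; rewrite big_cons.
Qed.

Lemma mean_indic P A : measurable A -> mean P (\1_A) = fine (P A).
Proof.
move=> mA; rewrite /mean /Rintegral; congr fine.
by rewrite integral_indic // setIT.
Qed.

(** The variance is nonnegative. *)
Lemma sqr_mean_le P f : integ P f -> integ P (fun x => f x ^+ 2) ->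
  mean P f ^+ 2 <= mean P (fun x => f x ^+ 2).
Proof.
move=> If If2; set m := mean P f.
have : 0 <= mean P (fun x => (f x - m) ^+ 2).
  by apply: mean_ge0 => x; exact: sqr_ge0.
have -> : mean P (fun x => (f x - m) ^+ 2) =
    mean P (fun x => f x ^+ 2) + (- (2 * m) * m + m ^+ 2).
  transitivity (mean P (fun x => f x ^+ 2 + ((- (2 * m)) * f x + m ^+ 2))).
    by congr mean; apply/funext => x; ring.
  have Im : integ P (fun=> m ^+ 2) by exact/bmf_integ/bmf_cst.
  have IZ := integZ (- (2 * m)) If.
  by rewrite (meanD If2 (integD IZ Im)) (meanD IZ Im) (meanZ _ If) mean_cst.
by rewrite -/m; set a := mean _ _; rewrite !expr2 => ?; lra.
Qed.

Lemma dominated_mean P (f_ : nat -> T -> R) f g :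
  (forall n, measurable_fun [set: T] (f_ n)) -> measurable_fun [set: T] f ->
  integ P g -> (forall n x, `|f_ n x| <= g x) ->
  (forall x, f_ n x @[n --> \oo] --> f x) ->
  mean P (f_ n) @[n --> \oo] --> mean P f.
Proof.
move=> mf_ mf Ig f_g f_f.
have [] := @dominated_convergence _ _ _ P setT measurableT
  (fun n => EFin \o f_ n) (EFin \o f) (EFin \o g).
- by move=> n; exact/measurable_EFinP.
- exact/measurable_EFinP.
- apply: aeW => x _; exact: (cvg_comp _ _ (f_f x)).
- exact: Ig.
- by apply: aeW => x n _; rewrite /= lee_fin.
move=> If _ cv.
apply: (@fine_cvg _ _ _ _ (fun n => \int[P]_x (EFin \o f_ n) x)%E) => //.
by rewrite fineK //; exact: integrable_fin_num.
Qed.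

End mean.
Arguments bmf {R d T} f.

Lemma bmf_comp (R : realType) d d' (T : measurableType d) (T' : measurableType d')
    (h : T -> T') (f : T' -> R) :
  measurable_fun [set: T] h -> bmf f -> bmf (fun x => f (h x)).
Proof.
move=> mh [mf [M fM]]; split; last by exists M => x; exact: fM.
exact: (measurableT_comp mf mh).
Qed.

Lemma mean_pushforward (R : realType) d d' (T : measurableType d)
    (T' : measurableType d') (P : probability T R) (h : {mfun T >-> T'})
    (f : T' -> R) : bmf f -> mean (distribution P h) f = mean P (fun x => f (h x)).
Proof.
move=> bf; rewrite /mean /Rintegral integral_distribution //.
  by apply/measurable_EFinP; exact: bf.1.
by apply/(@bmf_integ _ _ _ P)/(@bmf_comp _ _ _ _ _ h) => //.
Qed.

(** * Borel measurability of continuous maps *)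

Section Borel.
Variable R : realType.

Lemma continuous_measurable_Borel (X Y : ptopologicalType) (f : X -> Y) :
  continuous f -> measurable_fun [set: Borel X] (f : Borel X -> Borel Y).
Proof.
move=> /continuousP cf.
apply: (@measurability _ _ (Borel X) (Borel Y) setT f (@open Y) erefl).
by move=> _ [B oB <-]; rewrite setTI; apply: sub_sigma_algebra; exact: cf.
Qed.

Lemma continuous_measurable_real (X : ptopologicalType) (f : X -> R) :
  continuous f -> measurable_fun [set: Borel X] (f : Borel X -> R).
Proof.
move=> /continuousP cf.
apply: (measurability _ (RGenOpens.measurableE R)) => _ [_ [a [b ->]] <-].
by rewrite setTI; apply: sub_sigma_algebra; apply: cf; exact: interval_open.
Qed.

Lemma continuous_bmf (X : ptopologicalType) (f : X -> R) :
  compact [set: X] -> continuous f -> @bmf R _ (Borel X) f.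
Proof.
move=> cX cf; split; first exact: continuous_measurable_real.
have /compact_bounded[M [_ fM]] : compact (f @` [set: X]).
  by apply: continuous_compact => //; exact/continuous_subspaceT.
exists (`|M| + 1) => x; apply: fM; last by exists x.
by rewrite ltr_pwDr // ler_norm.
Qed.
End Borel.

(** * Characters and trigonometric polynomials *)

Section torus.
Variable R : realType.

Lemma torus_cvgP (T : Type) (F : set_system T) (f : T -> torus R)
    (z : torus R) : Filter F ->
  f @ F --> z <-> forall k, (fun t => f t k) @ F --> z k.
Proof.
move=> FF; exact: (@ptws_cvgP nat (circle R) (f @ F) z).
Qed.

Lemma torus_pow_cvgP n (T : Type) (F : set_system T) (f : T -> torus_pow R n)
    (x : torus_pow R n) : Filter F -> f @ F --> x <-> forall i k, (fun t => f t i k) @ F --> x i k.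
Proof.
move=> FF; split=> [fx i|fx].
  have h : (fun t => f t i) @ F --> x i.
    exact: ((@ptws_cvgP 'I_n (torus R) (f @ F) x _).1 fx i).
  by apply/torus_cvgP.
apply/(@ptws_cvgP 'I_n (torus R) (f @ F) x) => i.
suff : (fun t => f t i) @ F --> x i by [].
by apply/torus_cvgP => k; exact: fx.
Qed.

Lemma torus_coord_continuous k : continuous (fun z : torus R => z k).
Proof. exact: (@ptws_proj_continuous nat (circle R)). Qed.

Lemma torus_pow_coord_continuous n (i : 'I_n) :
  continuous (fun x : torus_pow R n => x i).
Proof. exact: (@ptws_proj_continuous 'I_n (torus R)). Qed.

Lemma torus_pow_continuousP n (S : topologicalType) (f : S -> torus_pow R n) :
  continuous f <-> forall i, continuous (fun x => f x i).
Proof. exact: (@ptws_continuousP S 'I_n (torus R)). Qed.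

Lemma torus_compact : compact [set: torus R].
Proof.
have := @tychonoff nat (fun=> circle R) (fun=> setT) (fun=> @circle_compact R).
by rewrite (_ : [set f | _] = setT) //; apply/seteqP; split.
Qed.

Lemma torus_pow_compact n : compact [set: torus_pow R n].
Proof.
have := @tychonoff 'I_n (fun=> torus R) (fun=> setT) (fun=> torus_compact).
by rewrite (_ : [set f | _] = setT) //; apply/seteqP; split.
Qed.

Lemma torus_continuousD (S : topologicalType) (f g : S -> torus R) :
  continuous f -> continuous g -> continuous (fun x => f x + g x).
Proof.
move=> cf cg x; apply/torus_cvgP => k; apply: circle_cvgD.
  by have /torus_cvgP := cf x; exact.
by have /torus_cvgP := cg x; exact.
Qed.

Lemma torus_pow_continuousD n (a : torus_pow R n) :
  continuous (fun x : torus_pow R n => x + a).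
Proof.
apply/torus_pow_continuousP => i.
apply: (@torus_continuousD _ (fun x : torus_pow R n => x i) (fun=> a i)).
  exact: torus_pow_coord_continuous.
exact: (@cst_continuous (torus_pow R n) (torus R) (a i)).
Qed.

Lemma first_coords_continuous n m (le_mn : (m <= n)%N) :
  continuous (@first_coords R n m le_mn).
Proof.
by apply/torus_pow_continuousP => i; exact: torus_pow_coord_continuous.
Qed.

Definition slot n (i : 'I_n) (a : torus R) : torus_pow R n :=
  fun j => if j == i then a else 0.

(* A finite list of signed coordinates stands for a character of the torus,
   written additively with values in the circle. *)
Definition tchar (s : seq (nat * bool)) (z : torus R) : circle R :=
  \sum_(p <- s) (if p.2 then - z p.1 else z p.1).

Definition pchar n (c : 'I_n -> seq (nat * bool)) (x : torus_pow R n) :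
  circle R := \sum_i tchar (c i) (x i).

Definition opp_seq (s : seq (nat * bool)) := [seq (p.1, ~~ p.2) | p <- s].

Lemma tcharD s z w : tchar s (z + w) = tchar s z + tchar s w.
Proof.
rewrite /tchar -big_split; apply: eq_bigr => p _ /=.
by case: p.2; rewrite // -opprD.
Qed.

Lemma tchar0 s : tchar s 0 = 0.
Proof. by apply: (@addrI _ (tchar s 0)); rewrite -tcharD !addr0. Qed.

Lemma tchar_cat s t z : tchar (s ++ t) z = tchar s z + tchar t z.
Proof. exact: big_cat. Qed.

Lemma tchar_opp s z : tchar (opp_seq s) z = - tchar s z.
Proof.
rewrite /tchar big_map -sumrN; apply: eq_bigr => p _ /=.
by case: p.2; rewrite //= opprK.
Qed.

Lemma pcharD n (c : 'I_n -> _) x y : pchar c (x + y) = pchar c x + pchar c y.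
Proof. by rewrite /pchar -big_split; apply: eq_bigr => i _; exact: tcharD. Qed.

Lemma pchar_cat n (c e : 'I_n -> _) x :
  pchar (fun i => c i ++ e i) x = pchar c x + pchar e x.
Proof.
by rewrite /pchar -big_split; apply: eq_bigr => i _; exact: tchar_cat.
Qed.

Lemma pchar_opp n (c : 'I_n -> _) x :
  pchar (fun i => opp_seq (c i)) x = - pchar c x.
Proof.
by rewrite /pchar -sumrN; apply: eq_bigr => i _; exact: tchar_opp.
Qed.

Lemma pchar_nil n x : pchar (fun _ : 'I_n => [::]) x = 0.
Proof. by rewrite /pchar big1 // => i _; rewrite /tchar big_nil. Qed.

Lemma pchar_slot n (c : 'I_n -> _) i a : pchar c (slot i a) = tchar (c i) a.
Proof.
rewrite /pchar (bigD1 i) //= /slot eqxx big1 ?addr0 // => j /negPf ->.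
exact: tchar0.
Qed.

Lemma circle_continuous_sum (S : topologicalType) (I : Type) (s : seq I)
    (F : I -> S -> circle R) : (forall i, continuous (F i)) ->
  continuous (fun x => \sum_(i <- s) F i x).
Proof.
move=> cF; elim: s => [|i s IH].
  rewrite (_ : (fun x => _) = fun=> 0); first by move=> x; exact: cvg_cst.
  by apply/funext => x; rewrite big_nil.
rewrite (_ : (fun x => _) = fun x => F i x + \sum_(i <- s) F i x); last first.
  by apply/funext => x; rewrite big_cons.
by move=> x; apply: circle_cvgD; [exact: cF|exact: IH].
Qed.

Lemma tchar_continuous s : continuous (tchar s).
Proof.
apply: circle_continuous_sum => -[k b] z /=.
by case: b; [apply: circle_cvgN|]; exact: torus_coord_continuous.
Qed.

Lemma pchar_continuous n (c : 'I_n -> _) : continuous (pchar c).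
Proof.
apply: circle_continuous_sum => i x.
by apply: continuous_comp; [exact: torus_pow_coord_continuous|exact: tchar_continuous].
Qed.

Lemma circle_continuousD (S : topologicalType) (f g : S -> circle R) :
  continuous f -> continuous g -> continuous (fun x => f x + g x).
Proof. by move=> cf cg x; apply: circle_cvgD; [exact: cf|exact: cg]. Qed.

Lemma continuous_c1 (S : topologicalType) (f : S -> circle R) :
  continuous f -> continuous (fun x => c1 (f x)).
Proof.
by move=> cf x; exact: (cvg_comp _ _ (cf x) (@c1_continuous R (f x))).
Qed.

Lemma c1_pchar_continuous n (c : 'I_n -> seq (nat * bool)) (b : circle R) :
  continuous (fun x : torus_pow R n => c1 (pchar c x + b)).
Proof.
apply: (@continuous_c1 _ (fun x : torus_pow R n => pchar c x + b)).
apply: (@circle_continuousD _ (pchar c) (fun=> b)).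
  exact: pchar_continuous.
exact: (@cst_continuous (torus_pow R n) (circle R) b).
Qed.

(** Real trigonometric polynomials; an amplitude [r] and a phase [b] take the place of a complex
    coefficient. *)
Inductive trig n : (torus_pow R n -> R) -> Prop :=
| trig_char (r : R) c (b : circle R) : trig (fun x => r * c1 (pchar c x + b))
| trigD p q : trig p -> trig q -> trig (fun x => p x + q x).

Lemma trig_bmf n (p : torus_pow R n -> R) :
  trig p -> bmf (p : Borel (torus_pow R n) -> R).
Proof.
elim=> [r c b|{}p q _ bp _ bq]; last exact: bmfD.
apply: bmfZ; apply: continuous_bmf; first exact: torus_pow_compact.
exact: c1_pchar_continuous.
Qed.

Lemma trig_cst n r : @trig n (fun=> r).
Proof.
have := @trig_char n r (fun=> [::]) 0.
rewrite (_ : (fun x => _) = fun=> r) //.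
by apply/funext => x; rewrite pchar_nil addr0 c10 mulr1.
Qed.

(** The product-to-sum formula [c1M] makes trigonometric polynomials an algebra: the product of two
    characters contributes their sum and their difference, in additive notation. *)
Lemma trigM n (p q : torus_pow R n -> R) :
  trig p -> trig q -> trig (fun x => p x * q x).
Proof.
move=> tp; elim=> [s e b'|q1 q2 _ bp _ bq]; last first.
  rewrite (_ : (fun x => _) = fun x => p x * q1 x + p x * q2 x); first exact: trigD.
  by apply/funext => x; rewrite mulrDr.
elim: tp => [r c b|p1 p2 _ bp _ bq]; last first.
  rewrite (_ : (fun x => _) = fun x => p1 x * (s * c1 (pchar e x + b')) +
    p2 x * (s * c1 (pchar e x + b'))); first exact: trigD.
  by apply/funext => x; rewrite mulrDl.
rewrite (_ : (fun x => _) = fun x =>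
  (r * s / 2) * c1 (pchar (fun i => c i ++ e i) x + (b + b')) +
  (r * s / 2) * c1 (pchar (fun i => c i ++ opp_seq (e i)) x + (b - b'))).
  by apply: trigD; exact: trig_char.
apply/funext => x; rewrite !pchar_cat pchar_opp mulrACA c1M.
by rewrite opprD !(addrACA (pchar c x) b); field.
Qed.

End torus.

(** * Approximation in the mean by trigonometric polynomials *)

Section approximation.
Context (R : realType) (n : nat).
Notation X := (torus_pow R n).
Notation BX := (Borel X).
Variables P Q : probability BX R.
Implicit Types f g h : X -> R.

Definition sqdist (M : probability BX R) f g :=
  mean M (fun x : BX => (f x - g x) ^+ 2).

(** From (a + b)^2 <= 2 a^2 + 2 b^2. Working with squared distances avoids square roots at the price
    of the factor 2. *)
Lemma sqdist_triangle M f g h : @bmf R _ BX f -> @bmf R _ BX g ->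
  @bmf R _ BX h -> sqdist M f h <= 2 * sqdist M f g + 2 * sqdist M g h.
Proof.
move=> bf bg bh.
have b2 (u v : BX -> R) : bmf u -> bmf v -> bmf (fun x => (u x - v x) ^+ 2).
  by move=> bu bv; apply: bmfX; exact: bmfB.
have Iz (u v : BX -> R) : bmf u -> bmf v -> integ M (fun x => 2 * (u x - v x) ^+ 2).
  by move=> bu bv; apply/bmf_integ/bmfZ/b2.
rewrite /sqdist -!meanZ; try by apply/bmf_integ/b2.
rewrite -meanD; try exact: Iz.
apply: mean_le; first exact/bmf_integ/b2.
  by apply: integD; exact: Iz.
by move=> x; have := sqr_ge0 ((f x - g x) - (g x - h x)); rewrite !expr2; lra.
Qed.

Lemma sqdist_ge0 M f g : 0 <= sqdist M f g.
Proof. by apply: mean_ge0 => x; exact: sqr_ge0. Qed.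

(* Two measures are approximated at once: equality of their means on
   trigonometric polynomials then passes to all bounded measurable functions. *)
Definition approx f := @bmf R _ BX f /\ forall e : R, 0 < e ->
  exists p, [/\ trig p, sqdist P f p < e & sqdist Q f p < e].

Lemma approx_trig p : trig p -> approx p.
Proof.
move=> tp; split; first exact: trig_bmf.
move=> e e0; exists p; split => //; rewrite /sqdist.
  by rewrite (_ : (fun x => _) = cst 0) ?mean_cst //; apply/funext => x; rewrite subrr expr0n.
by rewrite (_ : (fun x => _) = cst 0) ?mean_cst //; apply/funext => x; rewrite subrr expr0n.
Qed.

Lemma approxD f g : approx f -> approx g -> approx (fun x => f x + g x).
Proof.
move=> [bf Af] [bg Ag]; split; first exact: bmfD.
(* The tolerance e / 4 absorbs the two factors 2 of [sqdist_triangle]. *)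
move=> e e0; have e4 : 0 < e / 4 by lra.
have [p [tp pP pQ]] := Af _ e4; have [q [tq qP qQ]] := Ag _ e4.
exists (fun x => p x + q x); split; first exact: trigD.
all: have bp := trig_bmf tp; have bq := trig_bmf tq.
all: suff H (M : probability BX R) : sqdist M f p < e / 4 ->
    sqdist M g q < e / 4 ->
    sqdist M (fun x => f x + g x) (fun x => p x + q x) < e by exact: H.
all: have := @sqdist_triangle M (fun x => f x + g x) (fun x => p x + g x)
    (fun x => p x + q x) (bmfD bf bg) (bmfD bp bg) (bmfD bp bq).
all: rewrite [X in 2 * X + _](_ : _ = sqdist M f p); last by
    congr mean; apply/funext => x; congr (_ ^+ 2); ring.
all: rewrite [X in _ + 2 * X](_ : _ = sqdist M g q); last by
    congr mean; apply/funext => x; congr (_ ^+ 2); ring.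
all: lra.
Qed.

Lemma sqdistM M f g h B : @bmf R _ BX f -> @bmf R _ BX g -> @bmf R _ BX h ->
  (forall x, `|f x| <= B) ->
  sqdist M (fun x => f x * g x) (fun x => f x * h x) <= B ^+ 2 * sqdist M g h.
Proof.
move=> bf bg bh fB; rewrite /sqdist -meanZ; last first.
  by apply/bmf_integ/bmfX/bmfB.
apply: mean_le.
- by apply/bmf_integ/bmfX/bmfB; exact: bmfM.
- by apply/bmf_integ/bmfZ/bmfX/bmfB.
- move=> x; rewrite -mulrBr exprMn ler_wpM2r ?sqr_ge0 //.
  by rewrite -real_normK ?num_real // lerXn2r ?nnegrE // (le_trans _ (fB x)).
Qed.

Lemma approxM f g : approx f -> approx g -> approx (fun x => f x * g x).
Proof.
move=> [bf Af] [bg Ag]; split; first exact: bmfM.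
(* The order of choices matters: q approximates g within a tolerance fixed by the bound F of f, and
   only then, q having a bound G of its own, p approximates f within a tolerance fixed by G. The
   added 1 keeps the denominators positive. *)
move=> e e0; have [F fF] := bf.2.
pose eF := e / (4 * (F ^+ 2 + 1)).
have F1 : 0 < F ^+ 2 + 1 by rewrite ltr_wpDl ?sqr_ge0.
have eF0 : 0 < eF by rewrite divr_gt0 // mulr_gt0.
have [q [tq qP qQ]] := Ag _ eF0.
have bq := trig_bmf tq; have [G qG] := bq.2.
pose eG := e / (4 * (G ^+ 2 + 1)).
have G1 : 0 < G ^+ 2 + 1 by rewrite ltr_wpDl ?sqr_ge0.
have eG0 : 0 < eG by rewrite divr_gt0 // mulr_gt0.
have [p [tp pP pQ]] := Af _ eG0; have bp := trig_bmf tp.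
exists (fun x => p x * q x); split; first exact: trigM.
all: suff H (M : probability BX R) : sqdist M g q < eF -> sqdist M f p < eG ->
    sqdist M (fun x => f x * g x) (fun x => p x * q x) < e by exact: H.
all: move=> gq fp.
all: have := @sqdist_triangle M (fun x => f x * g x) (fun x => f x * q x)
    (fun x => p x * q x) (bmfM bf bg) (bmfM bf bq) (bmfM bp bq).
all: have := sqdistM M bf bg bq fF.
all: have := sqdistM M bq bf bp qG.
all: rewrite [X in X <= _](_ : _ = sqdist M (fun x => f x * q x)
    (fun x => p x * q x)); last by
    congr mean; apply/funext => x; rewrite !(mulrC (q x)).
all: have -> : e = eF * (4 * (F ^+ 2 + 1)) by rewrite /eF divfK // gt_eqF // mulr_gt0.
all: have eFG : eF * (4 * (F ^+ 2 + 1)) = eG * (4 * (G ^+ 2 + 1))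
  by rewrite /eF /eG !divfK // gt_eqF // mulr_gt0.
all: have := sqr_ge0 F; have := sqr_ge0 G.
all: nra.
Qed.

Lemma approxZ r f : approx f -> approx (fun x => r * f x).
Proof. exact/approxM/approx_trig/trig_cst. Qed.

Lemma approx_cst r : approx (fun=> r).
Proof. exact/approx_trig/trig_cst. Qed.

Lemma approxB f g : approx f -> approx g -> approx (fun x => f x - g x).
Proof.
move=> Af Ag; rewrite (_ : (fun x => _) = fun x => f x + (-1) * g x).
  by apply: approxD => //; exact: approxZ.
by apply/funext => x; rewrite mulN1r.
Qed.

(** A bounded pointwise limit is a limit in mean square by dominated convergence, for [P] and for
    [Q]; a common index is then close for both. *)
Lemma approx_cvg (f_ : nat -> X -> R) f (B : R) : (forall k, approx (f_ k)) ->
  (forall k x, `|f_ k x| <= B) -> (forall x, f_ k x @[k --> \oo] --> f x) ->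
  approx f.
Proof.
move=> Af fB ff.
have mf : measurable_fun [set: BX] f.
  apply: (@measurable_fun_cvg _ BX R setT f_ f) => [k|x _]; last exact: ff.
  exact: (Af k).1.1.
have fxB x : `|f x| <= B.
  have cn : `|f_ k x| @[k --> \oo] --> `|f x| by apply: cvg_norm; exact: ff.
  rewrite -(cvg_lim (@Rhausdorff R) cn); apply: limr_le; last exact: nearW.
  by apply/cvg_ex; exists `|f x|.
have bf : @bmf R _ BX f by split => //; exists B.
have dist0 (M : probability BX R) : sqdist M (f_ k) f @[k --> \oo] --> (0 : R).
  rewrite -(mean_cst M 0); apply: (@dominated_mean _ _ BX M _ _ (fun=> (B + B) ^+ 2)).
  - by move=> k; apply: (bmfX 2 (bmfB (Af k).1 bf)).1.
  - exact: measurable_cst.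
  - exact/bmf_integ/bmf_cst.
  - move=> k x; rewrite ger0_norm ?sqr_ge0 // -real_normK ?num_real //.
    have B0 : 0 <= B by exact: le_trans (fxB x).
    rewrite lerXn2r ?nnegrE ?addr_ge0 // (le_trans (ler_normB _ _)) //.
    exact: lerD.
  - move=> x; rewrite [X in _ --> X](_ : _ = (f x - f x) ^+ 2); last first.
      by rewrite subrr expr0n.
    have h : f_ k x - f x @[k --> \oo] --> f x - f x.
      exact: cvgB (ff x) (cvg_cst (f x)).
    exact: (cvgM h h).
split => // e e0; have e4 : 0 < e / 4 by lra.
have /cvgrPdist_lt/(_ _ e4) dP := dist0 P.
have /cvgrPdist_lt/(_ _ e4) dQ := dist0 Q.
have [k [dPk dQk]] : exists k, sqdist P (f_ k) f < e / 4 /\ sqdist Q (f_ k) f < e / 4.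
  have [k _ dk] := filterI dP dQ; exists k.
  have [] := dk k (leqnn k); rewrite /= !sub0r !normrN.
  by rewrite !ger0_norm ?sqdist_ge0.
have [p [tp pP pQ]] := (Af k).2 _ e4; exists p; split => //.
all: suff H (M : probability BX R) : sqdist M (f_ k) f < e / 4 ->
    sqdist M (f_ k) p < e / 4 -> sqdist M f p < e by exact: H.
all: have := @sqdist_triangle M f (f_ k) p bf (Af k).1 (trig_bmf tp).
all: rewrite [X in _ <= 2 * X + _](_ : _ = sqdist M (f_ k) f); last by
  congr mean; apply/funext => x; rewrite -sqrrN opprB.
all: lra.
Qed.

(* Polynomials in t increasing to `|t| on [-1, 1]. *)
Fixpoint abs_iter k (t : R) : R :=
  if k is k'.+1 then abs_iter k' t + (t ^+ 2 - abs_iter k' t ^+ 2) / 2 else 0.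

(** With s = |t| and a the current iterate, the error s - a is multiplied by 1 - (s + a) / 2, which
    is at most 1 - s / 2. *)
Lemma abs_iter_bound k t : `|t| <= 1 ->
  0 <= abs_iter k t <= `|t| /\ `|t| - abs_iter k t <= (1 - `|t| / 2) ^+ k.
Proof.
move=> t1; have t0 := normr_ge0 t.
elim: k => [|k [/andP[a0 at1] IH]] /=.
  by rewrite lexx t0 subr0 expr0.
rewrite -(real_normK (num_real t)).
set a := abs_iter k t in a0 at1 IH *; set s := `|t| in t1 t0 at1 IH *.
split; first by rewrite !expr2; apply/andP; split; nra.
have -> : s - (a + (s ^+ 2 - a ^+ 2) / 2) = (1 - (s + a) / 2) * (s - a) by field.
by rewrite exprS; apply: ler_pM; lra.
Qed.

Lemma cvg_abs_iter t : `|t| <= 1 -> abs_iter k t @[k --> \oo] --> `|t|.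
Proof.
move=> t1; have [->|t0] := eqVneq t 0.
  rewrite normr0 (_ : (fun k => _) = fun=> 0); first exact: cvg_cst.
  apply/funext => k; have t01 : `|0 : R| <= 1 by rewrite normr0.
  have [] := @abs_iter_bound k 0 t01.
  by rewrite normr0 => /andP[a b] _; apply/eqP; rewrite eq_le a b.
have tgt0 : 0 < `|t| by rewrite normr_gt0.
apply/cvgrPdist_le => e e0.
have /cvgrPdist_le/(_ e e0) : (fun k => (1 - `|t| / 2) ^+ k) @ \oo --> (0 : R).
  by apply: cvg_expr; rewrite ger0_norm; lra.
apply: filterS => k; rewrite sub0r normrN => h.
have [/andP[a0 at1] d] := abs_iter_bound k t1.
by rewrite ger0_norm ?subr_ge0 // (le_trans d) // (le_trans (ler_norm _)).
Qed.

Lemma approx_abs f : approx f -> (forall x, `|f x| <= 1) ->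
  approx (fun x => `|f x|).
Proof.
move=> Af f1; apply: (@approx_cvg (fun k x => abs_iter k (f x)) _ 1).
- elim=> [|k IH] /=; first exact: approx_cst.
  apply: approxD => //.
  rewrite (_ : (fun x => _) = fun x => 2^-1 *
    (f x * f x - abs_iter k (f x) * abs_iter k (f x))).
    by apply/approxZ/approxB; exact: approxM.
  by apply/funext => x; rewrite mulrC.
- move=> k x; have [/andP[a0 at1] _] := abs_iter_bound k (f1 x).
  by rewrite ger0_norm // (le_trans at1).
- by move=> x; exact: cvg_abs_iter.
Qed.

(** The polynomials 1 - (1 - f)^k in f tend to 1 where f > 0 and vanish where f = 0. *)
Lemma approx_unit_gt0 f : approx f -> (forall x, 0 <= f x <= 1) ->
  approx (\1_[set x | 0 < f x] : X -> R).
Proof.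
move=> Af f01; apply: (@approx_cvg (fun k x => 1 - (1 - f x) ^+ k) _ 1).
- move=> k; apply: approxB; first exact: approx_cst.
  elim: k => [|k IH]; first exact: approx_cst.
  rewrite (_ : (fun x => _) = fun x => (1 - f x) * (1 - f x) ^+ k); last first.
    by apply/funext => x; rewrite exprS.
  by apply: approxM => //; apply: approxB => //; exact: approx_cst.
- move=> k x; have /andP[f0 f1] := f01 x.
  have g01 : 0 <= (1 - f x) ^+ k <= 1.
    by rewrite exprn_ge0 ?subr_ge0 // exprn_ile1 // ?subr_ge0 // gerBl.
  by rewrite ger0_norm; lra.
- move=> x; have /andP[f0 f1] := f01 x.
  rewrite indicE; case: (ltP 0 (f x)) => [fgt0|fle0].
    rewrite mem_set //= -[X in _ --> X]subr0.
    apply: cvgB; first exact: cvg_cst.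
    by apply: cvg_expr; rewrite ger0_norm; lra.
  rewrite memNset /=; last by rewrite ltNge fle0.
  rewrite (_ : (fun k => _) = fun=> 0); first exact: cvg_cst.
  apply/funext => k; have -> : f x = 0 by apply/eqP; rewrite eq_le f0 fle0.
  by rewrite subr0 expr1n subrr.
Qed.

Lemma approx_gt0 f : approx f -> approx (\1_[set x | 0 < f x] : X -> R).
Proof.
move=> Af; have [M fM] := Af.1.2.
have M0 : 0 < `|M| + 1 by rewrite ltr_wpDl.
pose g x := (`|M| + 1)^-1 * f x.
have g1 x : `|g x| <= 1.
  rewrite normrM normfV (gtr0_norm M0) ler_pdivrMl // mulr1.
  by rewrite (le_trans (fM x)) // (le_trans (ler_norm _)) // lerDl.
(* The positive part of the rescaled function takes values in [0, 1] and is positive exactly where f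
   is. *)
pose h x := 2^-1 * (`|g x| + g x).
have Ag : approx g by exact: approxZ.
have Ah : approx h by apply/approxZ/approxD => //; exact: approx_abs.
have h01 x : 0 <= h x <= 1.
  have := g1 x; have := ler_norm (g x); have := lerNnormlW (lexx `|g x|).
  by rewrite /h => ? ? ?; apply/andP; split; lra.
rewrite (_ : [set x | 0 < f x] = [set x | 0 < h x]); first exact: approx_unit_gt0.
apply/seteqP; split => x /=; rewrite /h.
  move=> f0; have g0 : 0 < g x by rewrite mulr_gt0 // invr_gt0.
  by rewrite gtr0_norm // mulr_gt0 // addr_gt0.
have [g0 _|g0] := ltP 0 (g x); last by rewrite ler0_norm // addNr mulr0 ltxx.
by move: g0; rewrite /g pmulr_rgt0 // invr_gt0.
Qed.

Definition approx_set : set (set X) := [set A | approx (\1_A : X -> R)].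

Lemma approx_setC A : approx_set A -> approx_set (setT `\` A).
Proof.
move=> SA; rewrite /approx_set /= setTD.
rewrite (_ : \1_(~` A) = fun x => 1 - \1_A x); last first.
  apply/funext => x; rewrite !indicE; have [xA|xA] := boolP (x \in A).
    by rewrite memNset ?subrr //; move: xA; rewrite inE => xA; exact.
  by rewrite mem_set ?subr0 //; move: xA; rewrite notin_setE.
by apply: approxB => //; exact: approx_cst.
Qed.

Lemma approx_setU A B : approx_set A -> approx_set B -> approx_set (A `|` B).
Proof.
move=> SA SB; rewrite /approx_set /=.
rewrite (_ : \1_(A `|` B) = fun x => \1_A x + \1_B x - \1_A x * \1_B x).
  by apply: approxB; [exact: approxD|exact: approxM].
apply/funext => x; rewrite !indicE in_setU.
by case: (x \in A); case: (x \in B); rewrite /=; ring.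
Qed.

Lemma approx_set_bigcup (F : (set X)^nat) : (forall k, approx_set (F k)) ->
  approx_set (\bigcup_k F k).
Proof.
move=> SF; pose G k := \big[setU/set0]_(i < k) F i.
apply: (@approx_cvg (fun k => \1_(G k)) _ 1).
- elim=> [|k IH]; rewrite /G ?big_ord0 ?indic0; first exact: approx_cst.
  by rewrite big_ord_recr; exact: approx_setU.
- by move=> k x; rewrite indicE; case: (_ \in _); rewrite ?normr1 ?normr0.
- move=> x; have [[i _ Fix]|nFx] := pselect ((\bigcup_k F k) x).
    apply: cvg_near_cst.
    near=> k; rewrite !indicE !mem_set //; first by exists i.
    rewrite /G -bigcup_mkord; exists i => //=; near: k.
    exact: nbhs_infty_gt.
  rewrite (_ : (fun k => _) = fun=> \1_(\bigcup_k F k) x); first exact: cvg_cst.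
  apply/funext => k; rewrite !indicE !memNset // /G -bigcup_mkord => -[i _ Fi].
  by apply: nFx; exists i.
Unshelve. all: by end_near.
Qed.

End approximation.

(** * Density of trigonometric polynomials and determination of a measure by its character means *)

Section density.
Context (R : realType) (n : nat).
Notation X := (torus_pow R n).
Notation BX := (Borel X).
Variables (alpha : torus R) (alpha_dense : dense [set alpha *~ k | k in [set: int]]).

(* [1 - c1 (z - w)] is half the squared chordal distance of [z] and [w]. *)
Definition gap K (a x : X) : R :=
  \sum_(i < n) \sum_(k < K) (1 - c1 (x i k - a i k)).

Lemma c1_le1 (z : circle R) : c1 z <= 1.
Proof. exact: cos_le1. Qed.

(** In complex notation this is |1 - zw|^2 <= 2 |1 - z|^2 + 2 |1 - w|^2; by the parallelogram law
    the slack is |1 - 2w + zw|^2, the sum of squares used in the proof. *)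
Lemma c1_triangle (z w : circle R) :
  1 - c1 (z + w) <= 2 * (1 - c1 z) + 2 * (1 - c1 w).
Proof.
have : 0 <= (c1 z * c1 w - s1 z * s1 w - 2 * c1 w + 1) ^+ 2 +
    (s1 z * c1 w + c1 z * s1 w - 2 * s1 w) ^+ 2 by rewrite addr_ge0 ?sqr_ge0.
have -> : (c1 z * c1 w - s1 z * s1 w - 2 * c1 w + 1) ^+ 2 +
    (s1 z * c1 w + c1 z * s1 w - 2 * s1 w) ^+ 2 =
    (c1 z ^+ 2 + s1 z ^+ 2) * (c1 w ^+ 2 + s1 w ^+ 2) +
    4 * (c1 w ^+ 2 + s1 w ^+ 2) + 1 - 4 * c1 z * (c1 w ^+ 2 + s1 w ^+ 2) +
    2 * (c1 z * c1 w - s1 z * s1 w) - 4 * c1 w by ring.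
by rewrite !c1s1 c1D; lra.
Qed.

Lemma gap_triangle K a x z : gap K x z <= 2 * gap K a z + 2 * gap K a x.
Proof.
rewrite /gap !mulr_sumr -big_split; apply: ler_sum => i _ /=.
rewrite !mulr_sumr -big_split; apply: ler_sum => k _ /=.
rewrite -(c1N (x i k - a i k)) opprB.
have -> : z i k - x i k = (z i k - a i k) + (a i k - x i k).
  by rewrite addrA subrK.
exact: c1_triangle.
Qed.

Lemma trig_sum (I : Type) (s : seq I) (F : I -> X -> R) :
  (forall i, trig (F i)) -> trig (fun x => \sum_(i <- s) F i x).
Proof.
move=> tF; elim: s => [|i s IH].
  rewrite (_ : (fun x => _) = fun=> 0); first exact: trig_cst.
  by apply/funext => x; rewrite big_nil.
rewrite (_ : (fun x => _) = fun x => F i x + \sum_(i <- s) F i x).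
  exact: trigD.
by apply/funext => x; rewrite big_cons.
Qed.

(** Hence a ball for [gap] is the positivity set of a trigonometric polynomial, to which
    [approx_gt0] applies. *)
Lemma trig_gap K a : trig (gap K a).
Proof.
apply: trig_sum => i; apply: trig_sum => k.
pose c := fun j : 'I_n => if j == i then [:: (k : nat, false)] else [::].
rewrite (_ : (fun x => _) = fun x : X => 1 + (-1) * c1 (pchar c x + - a i k)).
  by apply: trigD; [exact: trig_cst|exact: trig_char].
apply/funext => x; rewrite mulN1r; congr (1 - c1 (_ - _)).
rewrite /pchar (bigD1 i) //= /c eqxx big1 ?addr0 => [|j /negPf ->].
  by rewrite /tchar big_seq1.
by rewrite /tchar big_nil.
Qed.

(** A single index M governs both the number of coordinates and the radius. If no M worked,
    counterexamples z M would converge to x in every coordinate without entering U. *)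
Lemma nbhs_gap (x : X) (U : set X) : nbhs x U ->
  exists M, forall z, gap M x z < M.+1%:R^-1 -> U z.
Proof.
move=> xU; apply: contrapT => /forallNP nU.
have /choice[z zP] : forall M, exists z : X, gap M x z < M.+1%:R^-1 /\ ~ U z.
  move=> M; have /existsNP[z /not_implyP[zx zU]] := nU M.
  by exists z.
suff : z M @[M --> \oo] --> x.
  move/(_ U xU) => [M _ /(_ M (leqnn M)) zU].
  by have [] := zP M.
apply/torus_pow_cvgP => i k; apply/circle_cvgP/cvgrPdist_lt => e e0.
near=> M; rewrite ger0_norm ?subr_ge0 ?c1_le1 //.
apply: le_lt_trans (_ : M.+1%:R^-1 < e); last first.
  by near: M; exact: near_infty_natSinv_lt (PosNum e0).
apply: le_trans (ltW (zP M).1).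
have kM : (k < M)%N by near: M; exact: nbhs_infty_gt.
rewrite /gap (bigD1 i) //= (bigD1 (Ordinal kM)) //= -addrA lerDl addr_ge0 //.
  by rewrite sumr_ge0 // => l _; rewrite subr_ge0 c1_le1.
by rewrite sumr_ge0 // => j _; rewrite sumr_ge0 // => l _; rewrite subr_ge0 c1_le1.
Unshelve. all: by end_near.
Qed.

(** These points, with all coordinates in the orbit of [alpha], form a countable dense set;
    countability allows every open set to be a countable union of [gap] balls. *)
Definition orbit_point (m : {ffun 'I_n -> int}) : X := fun i => alpha *~ m i.

Lemma dense_gap K (x : X) (e : R) : 0 < e -> exists m, gap K (orbit_point m) x < e.
Proof.
(* Each of the n coordinates is approximated separately; dividing by n + 1 makes the total strictly
   less than e and covers n = 0. *)
move=> e0; have d0 : 0 < e / n.+1%:R by rewrite divr_gt0.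
have /choice[m mP] : forall i : 'I_n, exists k : int,
    \sum_(l < K) (1 - c1 (x i l - (alpha *~ k) l)) < e / n.+1%:R.
  move=> i; pose g (w : torus R) := \sum_(l < K) (1 - c1 (x i l - w l)).
  have cg : continuous g.
    rewrite /g; apply: continuous_big => [|l _ w]; first exact: add_continuous.
    apply: cvgB; first exact: cvg_cst.
    apply: (@continuous_c1 R (torus R) (fun w => x i l - w l)) => v.
    apply: circle_cvgD; first exact: (@cst_continuous _ (circle R) (x i l)).
    by apply: circle_cvgN; exact: torus_coord_continuous.
  have oU : open (g @^-1` [set r | r < e / n.+1%:R]).
    by apply: open_comp => // w _; exact: cg.
  have [|w [wU [k _ kw]]] := alpha_dense _ oU; last by exists k; rewrite kw.
  exists (x i); rewrite /= /g big1 // => l _.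
  by rewrite subrr c10 subrr.
exists (finfun m); apply: (@le_lt_trans _ _ (\sum_(i < n) e / n.+1%:R)).
  by apply: ler_sum => i _; rewrite /orbit_point ffunE ltW.
rewrite sumr_const card_ord -[ltLHS]mulr_natr mulrAC ltr_pdivrMr //.
by rewrite ltr_pM2l // ltr_nat.
Qed.

Lemma approx_measurable (P Q : probability BX R) (A : set BX) :
  measurable A -> approx P Q (\1_A : X -> R).
Proof.
suff sub : <<s @open X >> `<=` approx_set P Q by exact: sub.
apply: smallest_sub.
  split; [|exact: approx_setC|exact: approx_set_bigcup].
  by rewrite /approx_set /= indic0; exact: approx_cst.
move=> U oU.
(* With radius one quarter of 1 / (M + 1), [gap_triangle] places a ball containing x inside the
   neighbourhood of x given by [nbhs_gap]. Only the balls contained in U are kept, and pickling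
   enumerates them. *)
pose B (t : nat * {ffun 'I_n -> int}) : set X :=
  [set x | gap t.1 (orbit_point t.2) x < (4 * t.1.+1%:R)^-1].
pose F k : set X := if unpickle k is Some t then
  (if `[< B t `<=` U >] then B t else set0) else set0.
have -> : U = \bigcup_k F k.
  apply/seteqP; split=> [x Ux|x [k _]]; last first.
    by rewrite /F; case: unpickle => // t; case: asboolP => // BU /BU.
  have [M MU] : exists M, forall z, gap M x z < M.+1%:R^-1 -> U z.
    by apply: nbhs_gap; exact: open_nbhs_nbhs.
  have [|m mx] := @dense_gap M x (4 * M.+1%:R)^-1.
    by rewrite invr_gt0 mulr_gt0.
  exists (pickle (M, m)) => //; rewrite /F pickleK; case: asboolP => //.
  move=> []; rewrite /B /= => z zm; apply: MU.
  apply: le_lt_trans (gap_triangle M (orbit_point m) x z) _.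
  have e4 : (4 * M.+1%:R)^-1 = M.+1%:R^-1 / 4 :> R by rewrite invfM mulrC.
  move: mx zm; rewrite /= e4; set r := M.+1%:R^-1 => mx zm.
  have := ltrD mx zm; lra.
apply: approx_set_bigcup => k; rewrite /approx_set /= /F.
case: unpickle => [t|]; last by rewrite indic0; exact: approx_cst.
case: asboolP => _; last by rewrite indic0; exact: approx_cst.
rewrite (_ : B t = [set x | 0 < (4 * t.1.+1%:R)^-1 - gap t.1 (orbit_point t.2) x]).
  by apply/approx_gt0/approxB; [exact: approx_cst|exact/approx_trig/trig_gap].
by apply/seteqP; split => x /=; rewrite /B /= subr_gt0.
Qed.

(** One trigonometric polynomial is close to the indicator of [A] for both measures and has the same
    mean under both. *)
Lemma eq_probability_char (P Q : probability BX R) :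
  (forall c (b : circle R), mean P (fun x : BX => c1 (pchar c x + b)) =
               mean Q (fun x : BX => c1 (pchar c x + b))) ->
  forall A : set BX, measurable A -> P A = Q A.
Proof.
move=> PQ A mA.
have eq_trig p : trig p -> mean P (p : BX -> R) = mean Q (p : BX -> R).
  elim=> [r c b|{}p q tp IHp tq IHq].
    have bc := bmf_integ _ (trig_bmf (trig_char 1 c b)).
    have bc' M : integ M (fun x : BX => c1 (pchar c x + b)).
      by have := bc M; rewrite (_ : (fun x => _) = fun x : BX => c1 (pchar c x + b)) //;
        apply/funext => x; rewrite mul1r.
    by rewrite !meanZ // PQ.
  have bp := trig_bmf tp; have bq := trig_bmf tq.
  by rewrite !meanD ?IHp ?IHq //; exact: bmf_integ.
have bA := bmf_indic R mA.
suff e : mean P (\1_A) = mean Q (\1_A).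
  rewrite !mean_indic // in e.
  have fP : P A \is a fin_num by exact: fin_num_measure.
  have fQ : Q A \is a fin_num by exact: fin_num_measure.
  by rewrite -(fineK fP) -(fineK fQ) e.
have [_ AA] := approx_measurable P Q mA.
apply/eqP; rewrite -subr_eq0 -normr_le0; apply/ler_addgt0Pr => /= e e0.
rewrite add0r.
have e4 : 0 < (e / 2) ^+ 2 by rewrite exprn_gt0 // divr_gt0.
have [p [tp pP pQ]] := AA _ e4.
have H (M : probability BX R) : sqdist M (\1_A) p < (e / 2) ^+ 2 ->
    `|mean M (\1_A) - mean M (p : BX -> R)| < e / 2.
  have bp := trig_bmf tp.
  move=> h; rewrite -meanB; try exact: bmf_integ.
  have e20 : 0 <= e / 2 by lra.
  rewrite -(ltr_pXn2r (n := 2)) ?nnegrE // real_normK ?num_real //.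
  apply: le_lt_trans h; apply: sqr_mean_le.
    exact/bmf_integ/bmfB.
  exact/bmf_integ/bmfX/bmfB.
have := H P pP; have := H Q pQ; rewrite (eq_trig p tp).
set u := mean P _; set v := mean Q (\1_A); set w := mean Q _ => h1 h2.
rewrite (_ : u - v = (u - w) - (v - w)); last by ring.
by rewrite (le_trans (ler_normB _ _)) // ltW // (splitr e) ltrD.
Qed.

(** After an affine rescaling to [0, 1], the function is a uniform limit of its truncated binary
    expansions, which are finite combinations of indicators. *)
Lemma approx_of_bmf (P Q : probability BX R) (f : X -> R) :
  @bmf R _ BX f -> approx P Q f.
Proof.
move=> bf; have [M fM] := bf.2.
have unit_case k (g : BX -> R) : bmf g -> (forall x, 0 <= g x <= 1) ->
    exists2 h, approx P Q h & forall x, 0 <= g x - h x <= 2^-1 ^+ k.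
  elim: k g => [|k IH] g bg g01.
    by exists (fun=> 0); [exact: approx_cst|move=> x; rewrite subr0 expr0].
  (* [A] carries the first binary digit of g; the remaining digits are those of 2 g minus the
     indicator of [A]. *)
  pose A : set BX := [set x | 2^-1 <= g x].
  have mA : measurable A.
    have := bg.1 measurableT _ (measurable_itv `[2^-1, +oo[).
    by rewrite setTI (_ : _ @^-1` _ = A) //; apply/seteqP; split => x /=;
      rewrite /A /= in_itv /= andbT.
  have [|x|h Ah hP] := IH (fun x => 2 * g x - \1_A x).
  - by apply: bmfB; [exact: bmfZ|exact: bmf_indic].
  - have /andP[g0 g1] := g01 x; rewrite indicE; have [gx|gx] := lerP 2^-1 (g x).
      by rewrite mem_set //=; apply/andP; split; lra.
    by rewrite memNset /=; [apply/andP; split; lra|rewrite /A /= leNgt gx].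
  exists (fun x => 2^-1 * (h x + \1_A x)).
    by apply/approxZ/approxD => //; exact: approx_measurable.
  by move=> x; have /andP[h0 h1] := hP x; rewrite exprS; apply/andP; split; lra.
pose B : R := `|M| + 1; have B0 : 0 < B by rewrite ltr_wpDl.
pose g x := (2 * B)^-1 * (f x + B).
have bg : @bmf R _ BX g by apply/bmfZ/bmfD => //; exact: bmf_cst.
have g01 x : 0 <= g x <= 1.
  have := le_trans (fM x) (ler_norm M); rewrite ler_norml => /andP[f0 f1].
  have B2 : 0 < 2 * B by rewrite mulr_gt0.
  rewrite /g ler_pdivrMl // mulr1 mulr_ge0 ?invr_ge0 ?(ltW B2) //=.
    by rewrite /B; lra.
  by rewrite /B; lra.
have Ag : approx P Q g.
  have /choice[h hP] : forall k, exists h, approx P Q h /\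
      forall x, 0 <= g x - h x <= 2^-1 ^+ k.
    by move=> k; have [h Ah hP] := unit_case k g bg g01; exists h.
  apply: (@approx_cvg _ _ P Q h g 1) => [k|k x|x]; first exact: (hP k).1.
    have /andP[g0 g1] := g01 x; have /andP[h0 h1] := (hP k).2 x.
    have : 2^-1 ^+ k <= 1 :> R by rewrite exprn_ile1 // invf_le1 // ler1n.
    by rewrite ler_norml => ?; apply/andP; split; lra.
  apply/cvgrPdist_le => e e0.
  have /cvgrPdist_le/(_ e e0) : (fun k => 2^-1 ^+ k) @ \oo --> (0 : R).
    by apply: cvg_expr; rewrite ger0_norm // invf_lt1 // ltr1n.
  apply: filterS => k; rewrite sub0r normrN => h2.
  have /andP[h0 h1] := (hP k).2 x.
  by rewrite ger0_norm // (le_trans h1) // (le_trans (ler_norm _)).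
rewrite (_ : f = fun x => (2 * B) * g x - B).
  by apply: approxB; [exact: approxZ|exact: approx_cst].
by apply/funext => x; rewrite /g mulVKf ?addrK // gt_eqF // mulr_gt0.
Qed.

End density.

(** * Haar measure and the hypotheses on the flow *)

Section preserved.
Context (R : realType) d (T : measurableType d).

Lemma eq_mean_measure (P Q : probability T R) (f : T -> R) :
  (forall A, measurable A -> P A = Q A) -> mean P f = mean Q f.
Proof.
move=> PQ; rewrite /mean /Rintegral; congr fine.
by apply: eq_measure_integral => A mA _; exact: PQ.
Qed.

Lemma integ_preserved (P : probability T R) (h : T -> T) (f : T -> R) :
  measurable_fun [set: T] h -> Defs.invariant P h -> integ P f ->
  integ P (fun x => f (h x)).
Proof.
move=> mh hP If; pose H : {mfun T >-> T} := mfun_Sub (mem_set mh).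
have mf := measurable_int P If; apply/integrableP; split.
  exact: (measurableT_comp mf mh).
have /integrableP[_] := If; apply: le_lt_trans.
rewrite le_eqVlt; apply/orP; left; apply/eqP.
have /= <- := @ge0_integral_distribution _ _ _ _ _ P H (abse \o (EFin \o f)).
- by apply: eq_measure_integral => A mA _; exact: hP.
- exact: measurableT_comp.
- by move=> x.
Qed.

Lemma mean_preserved (P : probability T R) (h : T -> T) (f : T -> R) :
  measurable_fun [set: T] h -> Defs.invariant P h -> integ P f ->
  mean P (fun x => f (h x)) = mean P f.
Proof.
move=> mh hP If; pose H : {mfun T >-> T} := mfun_Sub (mem_set mh).
have Ih := integ_preserved mh hP If.
rewrite /mean /Rintegral; congr fine.
rewrite -(@integral_distribution _ _ _ _ _ P H (EFin \o f)) //.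
  by apply: eq_measure_integral => A mA _; exact: hP.
exact: measurable_int If.
Qed.

Lemma mean_c1_increment (P : probability T R) (Th : T -> circle R) z k b0 :
  (forall w, c1 w = k * (c1 (w + b0) - c1 (w + b0 + z))) ->
  (forall b, bmf (fun x => c1 (Th x + b))) ->
  forall b, mean P (fun x => c1 (Th x + b)) =
    k * (mean P (fun x => c1 (Th x + (b + b0))) -
         mean P (fun x => c1 (Th x + (b + b0) + z))).
Proof.
move=> kE bTh b.
have bz : bmf (fun x => c1 (Th x + (b + b0) + z)).
  by have := bTh (b + b0 + z); under eq_fun do rewrite addrA.
rewrite -meanB -?meanZ; try exact: bmf_integ.
  by congr mean; apply/funext => x; rewrite kE !addrA.
by apply: bmf_integ; exact: bmfB.
Qed.

(* By [c1_increment] a mean which asymptotically ignores one nontrivial rotation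
   of the phase tends to zero for every phase. *)
Lemma cvg_mean_c1 (P : probability T R) (Th : nat -> T -> circle R) z :
  z <> 0 -> (forall N b, bmf (fun x => c1 (Th N x + b))) ->
  (forall b, mean P (fun x => c1 (Th N x + b)) -
     mean P (fun x => c1 (Th N x + b + z)) @[N --> \oo] --> (0 : R)) ->
  forall b, mean P (fun x => c1 (Th N x + b)) @[N --> \oo] --> (0 : R).
Proof.
move=> z0 bTh h b; have [k [b0 kE]] := c1_increment z0.
rewrite (_ : (fun N => _) = fun N => k * (mean P (fun x => c1 (Th N x + (b + b0))) -
     mean P (fun x => c1 (Th N x + (b + b0) + z)))).
  by rewrite -[X in _ --> X](mulr0 k); apply: cvgM; [exact: cvg_cst|exact: h].
by apply/funext => N; exact: mean_c1_increment.
Qed.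

(** Exact counterpart of [cvg_mean_c1]. *)
Lemma mean_c1_eq0 (P : probability T R) (Th : T -> circle R) z :
  z <> 0 -> (forall b, bmf (fun x => c1 (Th x + b))) ->
  (forall b, mean P (fun x => c1 (Th x + b)) =
     mean P (fun x => c1 (Th x + b + z))) ->
  forall b, mean P (fun x => c1 (Th x + b)) = 0.
Proof.
move=> z0 bTh h b; have [k [b0 kE]] := c1_increment z0.
by rewrite (mean_c1_increment P kE bTh) h subrr mulr0.
Qed.

End preserved.

Section haar.
Context (R : realType) (n : nat).
Notation X := (torus_pow R n).
Notation BX := (Borel X).
Variables (P : probability BX R) (P_inv : translation_invariant P).

Lemma haar_shift (f : X -> R) (a : X) : @bmf R _ BX f ->
  mean P (fun x : BX => f (x + a)) = mean P (f : BX -> R).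
Proof.
move=> bf.
apply: (@mean_preserved _ _ BX P (fun x => x + a) f); last exact: bmf_integ.
  exact: (@continuous_measurable_Borel X X (fun x => x + a)
    (@torus_pow_continuousD R n a)).
by move=> A mA; exact: P_inv.
Qed.

(** Orthogonality of characters in phase form: a translation that preserves the measure but rotates
    the phase by a nonzero constant forces the mean to vanish. *)
Lemma haar_mean_c1 (Th : X -> circle R) (a : X) z :
  (forall b, @bmf R _ BX (fun x => c1 (Th x + b))) -> z <> 0 ->
  (forall x, Th (x + a) = Th x + z) ->
  forall b, mean P (fun x : BX => c1 (Th x + b)) = 0.
Proof.
move=> bTh z0 Tha; apply: (mean_c1_eq0 z0 bTh) => b.
rewrite -(haar_shift a (bTh b)); congr mean; apply/funext => x.
by rewrite Tha addrAC.
Qed.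

End haar.

(** * Square-integrable functions and the differentiability hypothesis *)

Section squares.
Context (R : realType) d (T : measurableType d) (P : probability T R).

Lemma sqr_Lnorm2 (f : T -> R) :
  (Lnorm P 2%:E (EFin \o f) `^ 2 = \int[P]_x (f x ^+ 2)%:E)%E.
Proof.
rewrite poweR_Lnorm ?pnatr_eq0 //; apply: eq_integral => x _ /=.
by rewrite powR_mulrn // real_normK // num_real.
Qed.

Lemma bmf_Lfun2 (f : T -> R) : bmf f -> f \in Lfun P 2%:E.
Proof.
move=> bf; rewrite inE; apply/andP; split; rewrite inE /=; first exact: bf.1.
apply: (@lty_poweRy _ _ 2) => //; rewrite sqr_Lnorm2.
exact: (integrable_lty measurableT (bmf_integ P (bmfX 2 bf))).
Qed.

Lemma Lfun2D (f g : T -> R) : f \in Lfun P 2%:E -> g \in Lfun P 2%:E ->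
  (fun x => f x + g x) \in Lfun P 2%:E.
Proof.
have p1 : (1 <= 2%:E :> \bar R)%E by rewrite lee_fin ler1n.
exact: (Lfun_addr_closed P p1).2.
Qed.

Lemma Lfun2B (f g : T -> R) : f \in Lfun P 2%:E -> g \in Lfun P 2%:E ->
  (fun x => f x - g x) \in Lfun P 2%:E.
Proof. by move=> Lf Lg; apply: Lfun2D => //; exact: Lfun_oppr_closed. Qed.

Lemma integ_sqr (f : T -> R) : f \in Lfun P 2%:E -> integ P (fun x => f x ^+ 2).
Proof. exact: Lfun2_integrable_sqr. Qed.

Lemma integM (f g : T -> R) : f \in Lfun P 2%:E -> g \in Lfun P 2%:E ->
  integ P (fun x => f x * g x).
Proof. by move=> Lf Lg; apply/Lfun1_integrable/Lfun2_mul_Lfun1. Qed.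

Lemma sqr_Re_norm (z : R[i]) :
  complex.Re `|z| ^+ 2 = complex.Re z ^+ 2 + complex.Im z ^+ 2.
Proof. by case: z => a b; rewrite normc_def /= sqr_sqrtr ?addr_ge0 ?sqr_ge0. Qed.

Lemma Lfun_measurable (f : T -> R) p : f \in Lfun P p -> measurable_fun [set: T] f.
Proof. by rewrite inE => /andP[/[!inE]]. Qed.

(** The quotients converge in L^2 to a derivative that is merely square integrable. The Cauchy form
    eliminates it, so that later only bounded quotients occur. *)
Lemma strongly_C1_cauchy (w : R -> T -> R) :
  (forall t, bmf (w t)) -> strongly_C1 P w -> forall e : R, 0 < e ->
  exists2 de : R, 0 < de & forall h h', h != 0 -> h' != 0 ->
    `|h| < de -> `|h'| < de ->
    mean P (fun x => (h^-1 * (w h x - w 0 x) - h'^-1 * (w h' x - w 0 x)) ^+ 2) <= e.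
Proof.
move=> bw C1w e e0.
(* Strong differentiability applied to the constant vector 1 gives differentiability of the function
   itself in L^2. *)
have L2_1 : L2 P (fun=> 1).
  by split=> /=; [exact: (Lfun_cst P 1 2)|exact: (Lfun_cst P 0 2)].
have [_ [Du [L2Du cvDu _]]] := C1w _ L2_1.
pose D x : R := complex.Re (Du 0 x).
have LD : D \in Lfun P 2%:E by have [] := L2Du 0.
pose g h x := h^-1 * (w h x - w 0 x).
have Lg h : (fun x => g h x - D x) \in Lfun P 2%:E.
  have bg : bmf (g h) by apply: bmfZ; exact: bmfB.
  exact: Lfun2B (bmf_Lfun2 bg) LD.
have sq h : integ P (fun x => (g h x - D x) ^+ 2).
  exact: integ_sqr (Lg h).
have e4 : 0 < e / 4 by rewrite divr_gt0.
suff [de de0 small] : exists2 de : R, 0 < de & forall h, h != 0 -> `|h| < de ->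
    mean P (fun x => (g h x - D x) ^+ 2) <= e / 4.
  exists de => // h h' h0 h'0 hd h'd.
  apply: le_trans (_ : mean P (fun x => 2 * (g h x - D x) ^+ 2 +
      2 * (g h' x - D x) ^+ 2) <= _).
    apply: mean_le.
    - apply/bmf_integ/bmfX/bmfB; apply/bmfZ; exact: bmfB.
    - by apply: integD; exact: integZ.
    - move=> x; rewrite -/(g h x) -/(g h' x).
      have := sqr_ge0 ((g h x - D x) + (g h' x - D x)); rewrite !expr2; lra.
  rewrite meanD; try exact: integZ.
  rewrite !meanZ //.
  by have := small h h0 hd; have := small h' h'0 h'd; lra.
pose eta := Num.sqrt (e / 4); have eta0 : 0 < eta by rewrite sqrtr_gt0.
have := cvDu 0 [set y | (y < eta%:E)%E].
rewrite /nbhs /= => /(_ _)/nbhs_ballP[].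
  by apply: open_nbhs_nbhs; split; [exact: open_ereal_lt|rewrite /= lte_fin].
move=> de /= de0 sm; exists de => // h h0 hd.
have hb : ball 0 de h by rewrite /ball /= sub0r normrN.
have {sm hb} := sm h hb h0; rewrite /= /L2norm.
set F := (X in Lnorm _ _ X) => /ltW sm.
rewrite -lee_fin /mean /Rintegral fineK; last first.
  exact: (integrable_fin_num measurableT (sq h)).
(* The squared complex norm also contains the imaginary part of the derivative, which is dropped as
   a nonnegative term. *)
have FE : (Lnorm P 2%:E F `^ 2 =
    \int[P]_x ((g h x - D x) ^+ 2 + complex.Im (Du 0 x) ^+ 2)%:E)%E.
  rewrite /F sqr_Lnorm2; apply: eq_integral => x _; rewrite sqr_Re_norm add0r !mulr1.
  congr (_%:E); rewrite /g /D; case: (Du 0 x) => a b /=.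
  by rewrite !mul0r !subr0 !mulr0 addr0 add0r sqrrN.
apply: le_trans (_ : Lnorm P 2%:E F `^ 2 <= _)%E.
  rewrite FE; apply: ge0_le_integral => //.
  - by move=> x _; rewrite lee_fin sqr_ge0.
  - exact: measurable_int (sq h).
  - by apply/measurable_EFinP/measurable_funD; apply: measurable_funX;
      apply: Lfun_measurable; [exact: Lg|exact: (L2Du 0).2].
  - by move=> x _; rewrite lee_fin lerDl sqr_ge0.
apply: le_trans (_ : eta%:E `^ 2 <= _)%E.
  by apply: gt0_ler_poweR => //; rewrite in_itv /= ?leey ?Lnorm_ge0 ?lee_fin ?ltW.
by rewrite poweR_EFin powR_mulrn ?(ltW eta0) // sqr_sqrtr ?(ltW e4).
Qed.

End squares.

Lemma torus_pow_measurable (R : realType) n m (h : torus_pow R n -> torus_pow R m) :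
  continuous h -> measurable_fun [set: Borel (torus_pow R n)]
    (h : Borel (torus_pow R n) -> Borel (torus_pow R m)).
Proof. exact: (@continuous_measurable_Borel (torus_pow R n) (torus_pow R m)). Qed.

Lemma bmf_c1 (R : realType) n (Th : torus_pow R n -> circle R) b :
  continuous Th -> @bmf R _ (Borel (torus_pow R n)) (fun x => c1 (Th x + b)).
Proof.
move=> cT; apply: continuous_bmf; first exact: torus_pow_compact.
apply: (@continuous_c1 _ _ (fun x => Th x + b)).
apply: (@circle_continuousD _ _ Th (fun=> b)) => //.
exact: (@cst_continuous (torus_pow R n) (circle R) b).
Qed.

Lemma complex_cvg (R : realType) (T : Type) (F : set_system T) (f : T -> R[i])
    (z : R[i]) : Filter F ->
  complex.Re (f t) @[t --> F] --> complex.Re z ->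
  complex.Im (f t) @[t --> F] --> complex.Im z ->
  (f t : R[i]^o) @[t --> F] --> (z : R[i]^o).
Proof.
move=> FF /cvgrPdist_le cr /cvgrPdist_le ci.
apply/cvgrPdist_le => -[e e'] /=; rewrite ltcE /= => /andP[/eqP e'0 e0].
have e2 : 0 < e / 2 by rewrite divr_gt0.
rewrite e'0; apply: filterS (filterI (cr _ e2) (ci _ e2)) => t [].
case: z {cr ci} => a b; case: (f t) => a' b' /= ae be.
rewrite normc_def /= -[leRHS]/(e%:C%C) lecR.
rewrite -(ger0_norm (ltW e0)) -sqrtr_sqr ler_sqrt ?sqr_ge0 //.
rewrite -(real_normK (num_real (a - a'))) -(real_normK (num_real (b - b'))).
have := normr_ge0 (a - a'); have := normr_ge0 (b - b'); rewrite !expr2; nra.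
Qed.

(** Links the additive phases to complex characters, in terms of which the nontriviality hypothesis
    on [xi] is stated. *)
Lemma tchar_is_character (R : realType) l :
  is_character (fun z : torus R => Complex (c1 (tchar l z)) (s1 (tchar l z))).
Proof.
split=> [z|z|z w].
- apply: (@complex_cvg R) => /=.
    by apply: (@continuous_c1 R (torus R)); exact: tchar_continuous.
  exact: (cvg_comp _ _ (@tchar_continuous R l z) (@s1_continuous R (tchar l z))).
- by rewrite normc_def /= c1s1 sqrtr1.
- apply/eqP; rewrite tcharD c1D s1D eq_complex /= eqxx /=; apply/eqP; ring.
Qed.

(** * Ergodicity of the flow tested on a character *)

Section ergodic_character.
Context (R : realType).
Notation BX := (Borel (torus_pow R 1)).
Variables (P : probability BX R) (P_inv : translation_invariant P).
Variables (y : R -> torus R).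
Hypothesis y_ergodic : ergodic_flow P (fun t => translation (y t)).

(** Otherwise [lam] is constant along the flow, so each set where [c1] (lam + b) is positive is
    invariant and has measure 0 or 1. A function of mean zero and essentially constant sign has zero
    absolute mean, for the cosine and for the sine; but |cos| + |sin| is at least 1. *)
Lemma ergodic_char_neq0 (lam : torus R -> circle R) : continuous lam ->
  (forall x x', lam (x + x') = lam x + lam x') -> (exists z, lam z <> 0) ->
  exists t, lam (y t) <> 0.
Proof.
move=> clam lamD [z lamz]; apply: contrapT => /forallNP lamy0.
have {}lamy0 t : lam (y t) = 0 by apply: contrapT; exact: lamy0.
pose f b (x : BX) : R := c1 (lam (x ord0) + b).
have bf b : bmf (f b).
  apply: (@bmf_c1 R 1 (fun x => lam (x ord0))) => x.
  apply: (@continuous_comp _ _ _ (fun x : torus_pow R 1 => x ord0) lam); last exact: clam.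
  exact: torus_pow_coord_continuous.
have f0 b : mean P (f b) = 0.
  apply: (haar_mean_c1 P_inv (Th := fun x => lam (x ord0)) (a := fun=> z) _ lamz).
    exact: bf.
  by move=> x; exact: lamD.
have f1 b x : `|f b x| <= 1 by exact: normr_c1.
suff abs0 b : mean P (fun x => `|f b x|) <= 0.
  have babs b : bmf (fun x => `|f b x|).
    split; first by apply: measurableT_comp => //; exact: (bf b).1.
    by exists 1 => x; rewrite normr_id.
  have : 1 <= mean P (fun x => `|f 0 x| + `|f (- quarter R) x|).
    rewrite -{1}(mean_cst P 1); apply: mean_le; first exact/bmf_integ/bmf_cst.
      by apply/bmf_integ/bmfD.
    move=> x; rewrite /f addr0 -s1E -{1}(c1s1 (lam (x ord0))).
    rewrite -(real_normK (num_real (c1 _))) -(real_normK (num_real (s1 _))).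
    by rewrite lerD // expr2 ler_piMl ?normr_c1 ?normr_s1.
  rewrite meanD; try exact: bmf_integ.
  by have := abs0 0; have := abs0 (- quarter R); lra.
pose A : set BX := [set x | 0 < f b x].
have mA : measurable A.
  have := (bf b).1 measurableT _ (measurable_itv `]0, +oo[).
  by rewrite setTI (_ : _ @^-1` _ = A) //; apply/seteqP; split => x /=;
    rewrite /A /= in_itv /= andbT.
have babs : bmf (fun x => `|f b x|).
  split; first by apply: measurableT_comp => //; exact: (bf b).1.
  by exists 1 => x; rewrite normr_id.
(* Up to a null set [B], |f| equals s f with a constant sign s. Since |f| <= 1, twice the indicator
   of [B] corrects this to an inequality valid everywhere. *)
have key B (s : R) : measurable B -> P B = 0%E ->
    (forall x, `|f b x| <= s * f b x + 2 * \1_B x) ->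
    mean P (fun x => `|f b x|) <= 0.
  move=> mB PB fB; have bB := bmf_indic R mB.
  have <- : mean P (fun x => s * f b x + 2 * \1_B x) = 0.
    rewrite meanD; [|exact/bmf_integ/bmfZ|exact/bmf_integ/bmfZ].
    rewrite !meanZ; try exact: bmf_integ.
    by rewrite f0 mean_indic // PB /= !mulr0 addr0.
  by apply: mean_le => //; apply: bmf_integ => //; apply: bmfD; exact: bmfZ.
have [|PA|PA] := y_ergodic mA.
- move=> t; rewrite (_ : _ `+` _ = set0) ?measure0 //.
  rewrite (_ : _ @^-1` A = A); first by rewrite setYK.
  by apply/seteqP; split => x; rewrite /A /= /f /translation lamD lamy0 addr0.
- apply: (key A (-1) mA PA) => x; rewrite indicE.
  have [fx|fx] := ltP 0 (f b x).
    by rewrite mem_set //= gtr0_norm //; have := f1 b x; rewrite ler_norml => /andP[_]; lra.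
  rewrite memNset /=; last by rewrite /A /= ltNge fx.
  by rewrite ler0_norm //; lra.
- have PAC : P (~` A) = 0%E by rewrite probability_setC // PA subee.
  apply: (key (~` A) 1 (measurableC mA) PAC) => x; rewrite indicE.
  have [fx|fx] := ltP 0 (f b x).
    rewrite memNset /=; last exact.
    by rewrite gtr0_norm //; lra.
  rewrite mem_set /=; last by rewrite /A /= ltNge fx.
  by rewrite ler0_norm //; have := f1 b x; rewrite ler_norml => /andP[+ _]; lra.
Qed.

End ergodic_character.

(** * The skew product *)

Section skew.
Context (R : realType) (d : nat).
Notation X := (torus_pow R d).
Notation BX := (Borel X).
Variables (alpha : torus R) (phi : forall m, torus_pow R m -> torus R).
Arguments phi : clear implicits.
Hypothesis phi_cont : forall m, (1 <= m < d)%N -> continuous (phi m).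
Notation T := (@skew_product R d alpha phi).
Implicit Types (x y : X) (c e : 'I_d -> seq (nat * bool)).

Lemma skew_product_continuous : continuous T.
Proof.
apply/torus_pow_continuousP => i; rewrite /skew_product.
apply: (@torus_continuousD R X (fun x : X => x i)).
  exact: torus_pow_coord_continuous.
case: eqP => [_|/eqP i0]; first exact: (@cst_continuous X (torus R) alpha).
move=> x; apply: continuous_comp; first exact: first_coords_continuous.
by apply: phi_cont; rewrite lt0n i0 ltn_ord.
Qed.

Lemma iter_skew_continuous N : continuous (iter N T).
Proof.
elim: N => [|N IH]; first by move=> x; exact: cvg_id.
move=> x; apply: (@continuous_comp _ _ _ (iter N T) T); first exact: IH.
exact: skew_product_continuous.
Qed.

Lemma iter_skew_measurable N : measurable_fun [set: BX] (iter N T : BX -> BX).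
Proof. apply: torus_pow_measurable; exact: iter_skew_continuous. Qed.

Definition agree m x y := forall i : 'I_d, (i < m)%N -> x i = y i.

Lemma agree_first_coords m (le_md : (m <= d)%N) x y : agree m x y ->
  first_coords le_md x = first_coords le_md y.
Proof. by move=> xy; apply/funext => i; exact: (xy (widen_ord le_md i) (ltn_ord i)). Qed.

(** The skew product is triangular: each new coordinate involves only itself and earlier ones. *)
Lemma agree_skew m x y : agree m x y -> agree m (T x) (T y).
Proof.
move=> xy i im; rewrite /skew_product xy // (@agree_first_coords i _ x y) //.
by move=> j ji; apply: xy; exact: ltn_trans im.
Qed.

Lemma agree_iter m N x y : agree m x y -> agree m (iter N T x) (iter N T y).
Proof. by move=> xy; elim: N => [|N IH] //=; exact: agree_skew. Qed.

Lemma agree_slot (m : 'I_d) x a : agree m (x + slot m a) x.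
Proof.
move=> i im; rewrite [LHS](_ : _ = x i + slot m a i) // /slot.
by case: eqP im => [->|_ _]; rewrite ?ltnn ?addr0.
Qed.

(** The cocycle of a coordinate does not involve that coordinate, so shifting coordinate [m]
    commutes with the map until a later coordinate reads it. *)
Lemma skew_slot (m : 'I_d) x a :
  agree m.+1 (T (x + slot m a)) (T x + slot m a).
Proof.
move=> i; rewrite ltnS leq_eqVlt => /orP[/eqP/val_inj ->|im]; last first.
  rewrite (agree_skew (@agree_slot m x a) im).
  by rewrite (@agree_slot m (T x) a i im).
rewrite [RHS](_ : _ = T x m + slot m a m) // /skew_product.
rewrite (agree_first_coords _ (@agree_slot m x a)); exact: addrAC.
Qed.

Lemma agree_trans m x y z : agree m x y -> agree m y z -> agree m x z.
Proof. by move=> xy yz i im; rewrite xy ?yz. Qed.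

Lemma iter_skew_slot (m : 'I_d) N x a :
  agree m.+1 (iter N T (x + slot m a)) (iter N T x + slot m a).
Proof.
elim: N => [|N IH] //=; apply: agree_trans (agree_skew IH) _.
exact: skew_slot.
Qed.

Lemma iter_skew_coord (m : 'I_d) N x : (0 < m)%N -> iter N T x m = x m +
  \sum_(k < N) phi m (first_coords (ltnW (ltn_ord m)) (iter k T x)).
Proof.
move=> m0; elim: N => [|N IH] /=; first by rewrite big_ord0 addr0.
rewrite big_ord_recr /= addrA -IH [LHS]/skew_product.
by rewrite (gtn_eqF m0).
Qed.

Lemma iter_skew_coord0 (m : 'I_d) N x : m = 0%N :> nat ->
  iter N T x m = x m + alpha *+ N.
Proof.
move=> m0; elim: N => [|N IH] /=; first by rewrite addr0.
by rewrite [LHS]/skew_product ifT ?m0 // IH mulrSr addrA.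
Qed.

(** Triviality is required of the character and not of its list, since a nonempty list may
    cancel. *)
Definition below c m := forall i : 'I_d, (m <= i)%N ->
  forall a : torus R, tchar (c i) a = 0.

Definition top c (m : 'I_d) := below c m.+1 /\ exists a : torus R, tchar (c m) a <> 0.

Lemma pchar_below c m x y : below c m -> agree m x y -> pchar c x = pchar c y.
Proof.
move=> cm xy; apply: eq_bigr => i _; have [im|mi] := ltnP i m; first by rewrite xy.
by rewrite !cm.
Qed.

Lemma pchar_topP c : (forall x : X, pchar c x = 0) \/ exists m, top c m.
Proof.
pose nt (i : 'I_d) := `[< exists a : torus R, tchar (c i) a <> 0 >].
have [i0 nti0|nt0] := pickP nt; last first.
  left=> x; rewrite /pchar big1 // => i _; apply: contrapT => ti.
  by move/asboolPn: (negbT (nt0 i)); apply; exists (x i).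
right; have [m /asboolP ntm mmax] := arg_maxnP (fun i : 'I_d => i : nat) nti0.
exists m; split => // i mi a; apply: contrapT => ti.
have : (i <= m)%N by apply: mmax; apply/asboolP; exists a.
by rewrite leqNgt mi.
Qed.

Lemma top_slot c (m : 'I_d) x a : pchar c (x + slot m a) = pchar c x + tchar (c m) a.
Proof. by rewrite pcharD pchar_slot. Qed.

Lemma pchar_iter_slot c (m : 'I_d) N x a : below c m.+1 ->
  pchar c (iter N T (x + slot m a)) = pchar c (iter N T x) + tchar (c m) a.
Proof.
by move=> cm; rewrite (pchar_below cm (@iter_skew_slot m N x a)) top_slot.
Qed.

Lemma pchar_iter_continuous c N : continuous (fun x : X => pchar c (iter N T x)).
Proof.
move=> x; apply: (@continuous_comp _ _ _ (iter N T) (pchar c)).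
  exact: iter_skew_continuous.
exact: pchar_continuous.
Qed.

Lemma iter_invariant (nu : probability BX R) N :
  Defs.invariant nu (T : BX -> BX) -> Defs.invariant nu (iter N T : BX -> BX).
Proof.
move=> nu_inv; elim: N => [|N IH] A mA //.
rewrite -[RHS](IH A mA) -[RHS]nu_inv; last first.
  by rewrite -[X in measurable X]setTI; exact: iter_skew_measurable.
by congr (nu _); apply/funext => x /=; rewrite -iterS iterSr.
Qed.

Variables (P : probability BX R) (P_inv : translation_invariant P).
Hypothesis alpha_dense : dense [set alpha *~ k | k in [set: int]].

(** Shifting the top coordinate rotates the phase at time N by the same nonzero constant as at time
    0. *)
Lemma mean_char_iter_top c m N b : top c m ->
  mean P (fun x : BX => c1 (pchar c (iter N T x) + b)) = 0.
Proof.
move=> [cm [a ca]].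
apply: (haar_mean_c1 P_inv (a := slot m a) _ ca) => [b'|x].
  exact/bmf_c1/pchar_iter_continuous.
exact: pchar_iter_slot.
Qed.

(** The image of Haar measure integrates every nontrivial character to 0, hence has the same
    character means as Haar measure. *)
Lemma skew_invariant : Defs.invariant P (T : BX -> BX).
Proof.
have mT : measurable_fun [set: BX] (T : BX -> BX) by exact: (iter_skew_measurable 1).
pose H : {mfun BX >-> BX} := mfun_Sub (mem_set mT).
apply: (eq_probability_char alpha_dense (P := distribution P H)) => c b.
rewrite mean_pushforward; last exact/bmf_c1/pchar_continuous.
have [c0|[m cm]] := pchar_topP c.
  by congr mean; apply/funext => x; rewrite !c0.
by rewrite (mean_char_iter_top 1 b cm) (mean_char_iter_top 0 b cm).
Qed.

Lemma skew_iter_invariant N : Defs.invariant P (iter N T : BX -> BX).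
Proof. exact/iter_invariant/skew_invariant. Qed.

Lemma mean_iter N (f : X -> R) : @bmf R _ BX f ->
  mean P (fun x : BX => f (iter N T x)) = mean P (f : BX -> R).
Proof.
move=> bf; apply: (@mean_preserved _ _ BX P (iter N T) f).
- exact: iter_skew_measurable.
- exact: skew_iter_invariant.
- exact: bmf_integ.
Qed.

Lemma first_coords_distribution m (le_md : (m <= d)%N) (Q : probability (Borel (torus_pow R m)) R) :
  translation_invariant Q -> forall f, @bmf R _ (Borel (torus_pow R m)) f ->
  mean P (fun x : BX => f (first_coords le_md x)) = mean Q f.
Proof.
move=> Q_inv f bf.
have mF : measurable_fun [set: BX] (first_coords le_md : BX -> Borel (torus_pow R m)).
  apply: torus_pow_measurable; exact: first_coords_continuous.
pose H : {mfun BX >-> Borel (torus_pow R m)} := mfun_Sub (mem_set mF).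
rewrite -(mean_pushforward P H bf); apply: eq_mean_measure.
apply: (eq_probability_char alpha_dense) => c b.
have bc (b' : circle R) : @bmf R _ (Borel (torus_pow R m))
    (fun x : torus_pow R m => c1 (pchar c x + b')) by exact/bmf_c1/pchar_continuous.
rewrite mean_pushforward //.
have [c0|/existsNP[a ca]] := pselect (forall x : torus_pow R m, pchar c x = 0).
  rewrite (_ : (fun x : X => _) = fun=> c1 b); last by apply/funext => x; rewrite c0 add0r.
  rewrite (_ : (fun x : torus_pow R m => c1 (pchar c x + b)) = fun=> c1 b) ?mean_cst //.
  by apply/funext => x; rewrite c0 add0r.
rewrite (haar_mean_c1 Q_inv (a := a) bc ca); last by move=> x; exact: pcharD.
(* Extending the translation by 0 turns a translation of the smaller torus into one of the larger,
   rotating the phase by the same amount. *)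
pose a' : X := fun i => if insub (i : nat) is Some j then a j else 0.
have a'E : first_coords le_md a' = a.
  by apply/funext => j; rewrite /first_coords /a' /= insubT //= => ij; congr a; exact: val_inj.
apply: (haar_mean_c1 P_inv (Th := fun x => pchar c (first_coords le_md x)) (a := a') _ ca).
  by move=> b'; exact: (@bmf_comp _ _ _ _ _ H _ _ (bc b')).
by move=> x; rewrite -a'E -pcharD.
Qed.

(** * Birkhoff averages *)

Definition avg N (f : X -> R) (x : X) : R :=
  N%:R^-1 * \sum_(k < N) f (iter k T x).

Definition avg_cvg0 (f : X -> R) :=
  mean P (fun x : BX => avg N f x ^+ 2) @[N --> \oo] --> (0 : R).

Lemma bmf_iter N (f : X -> R) : @bmf R _ BX f -> @bmf R _ BX (fun x => f (iter N T x)).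
Proof. by move=> bf; apply: bmf_comp (iter_skew_measurable N) bf. Qed.

Lemma bmf_avg N (f : X -> R) : @bmf R _ BX f -> @bmf R _ BX (avg N f).
Proof.
move=> bf; apply/bmfZ.
by apply: (@bmf_sum R _ BX 'I_N _ (fun k x => f (iter k T x))) => k; exact: bmf_iter.
Qed.

(** The Cauchy-Schwarz inequality against the constant sequence 1. *)
Lemma sqr_sum_le N (u : nat -> R) :
  (\sum_(k < N) u k) ^+ 2 <= N%:R * \sum_(k < N) u k ^+ 2.
Proof.
elim: N => [|N IH]; first by rewrite !big_ord0 expr0n mul0r.
case: N IH => [_|N]; first by rewrite !big_ord_recr !big_ord0 /= !add0r mul1r.
rewrite !(big_ord_recr N.+1) /=; set S := \sum_(k < N.+1) u k.
set Q := \sum_(k < N.+1) u k ^+ 2; set a := u N.+1 => IH.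
have N0 : 0 < N.+1%:R :> R by [].
have : N.+1%:R * (2 * S * a) <= N.+1%:R * (Q + N.+1%:R * a ^+ 2).
  apply: le_trans (_ : S ^+ 2 + N.+1%:R ^+ 2 * a ^+ 2 <= _).
    by have := sqr_ge0 (S - N.+1%:R * a); rewrite !expr2; lra.
  by rewrite mulrDr mulrA -expr2 lerD2r.
rewrite ler_pM2l // -[N.+2%:R]natr1 => h.
have -> : (S + a) ^+ 2 = S ^+ 2 + 2 * S * a + a ^+ 2 by ring.
have -> : (N.+1%:R + 1) * (Q + a ^+ 2) =
  N.+1%:R * Q + (Q + N.+1%:R * a ^+ 2) + a ^+ 2 by ring.
by rewrite lerD2r lerD.
Qed.

(** Birkhoff averaging is a contraction of L^2, by convexity of the square and invariance of the
    measure. *)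
Lemma mean_avg_sqr_le N (f : X -> R) : @bmf R _ BX f ->
  mean P (fun x : BX => avg N f x ^+ 2) <= mean P (fun x : BX => f x ^+ 2).
Proof.
move=> bf; have b2 := bmfX 2 bf; case: N => [|N].
  rewrite (_ : (fun x => _) = fun=> 0) ?mean_cst; last first.
    by apply/funext => x; rewrite /avg big_ord0 mulr0 expr0n.
  by apply: mean_ge0 => x; exact: sqr_ge0.
have N0 : 0 < N.+1%:R :> R by [].
pose F (k : 'I_N.+1) (x : BX) := f (iter k T x) ^+ 2.
have bF k : bmf (F k) by exact: (bmf_iter k b2).
apply: le_trans (_ : mean P (fun x => N.+1%:R^-1 * \sum_(k < N.+1) F k x) <= _).
  apply: mean_le => [||x]; first exact/bmf_integ/bmfX/bmf_avg.
    by apply/bmf_integ/bmfZ/bmf_sum.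
  rewrite /avg exprMn expr2 -mulrA ler_pM2l ?invr_gt0 // ler_pdivrMl //.
  exact: (@sqr_sum_le N.+1 (fun k => f (iter k T x))).
rewrite meanZ; last exact/bmf_integ/bmf_sum.
rewrite mean_sum // (eq_bigr (fun=> mean P (fun x : BX => f x ^+ 2))); last first.
  by move=> k _; exact: (mean_iter k b2).
by rewrite sumr_const card_ord -[X in _ * X]mulr_natl mulKf // gt_eqF.
Qed.

Lemma avg_sum_rec N (f : X -> R) x : \sum_(k < N.+1) f (iter k T x) =
  f x + \sum_(k < N) f (iter k T (T x)).
Proof.
by rewrite big_ord_recl /=; congr (_ + _); apply: eq_bigr => k _; rewrite -iterSr.
Qed.

(** Expanding the square of the Birkhoff sum S (N + 1) = f + S N o T bounds the growth of its second
    moment by 1 plus twice a sum of correlations. As correlations tend to 0, the second moment is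
    o(N^2). *)
Lemma avg_cvg0_decay (f : X -> R) : @bmf R _ BX f -> (forall x, `|f x| <= 1) ->
  mean P (fun x : BX => f x * f (iter N T x)) @[N --> \oo] --> (0 : R) ->
  avg_cvg0 f.
Proof.
move=> bf f1 fN; pose r N := mean P (fun x : BX => f x * f (iter N T x)).
have r1 N : `|r N| <= 1.
  apply: normr_mean_le => [|x]; first by apply: bmfM => //; exact: bmf_iter.
  by rewrite normrM mulr_ile1.
pose S N (x : BX) : R := \sum_(k < N) f (iter k T x).
have bS N : bmf (S N).
  by apply: (@bmf_sum R _ BX 'I_N _ (fun k x => f (iter k T x))) => k; exact: bmf_iter.
pose a N := mean P (fun x => S N x ^+ 2).
have a0 : a 0%N = 0.
  rewrite /a -[RHS](mean_cst P); congr mean; apply/funext => x.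
  by rewrite /S big_ord0 expr0n.
have aS N : a N.+1 <= a N + 1 + 2 * \sum_(k < N) r k.+1.
  have bST : @bmf R _ BX (fun x => S N (T x)) by exact: (bmf_iter 1 (bS N)).
  rewrite {1}/a (_ : (fun x => _) = fun x => S N (T x) ^+ 2 +
      (f x ^+ 2 + 2 * (f x * S N (T x)))); last first.
    by apply/funext => x; rewrite /S avg_sum_rec; ring.
  have b2 : @bmf R _ BX (fun x => f x ^+ 2) by exact: bmfX.
  have bfS : @bmf R _ BX (fun x => f x * S N (T x)) by exact: bmfM.
  have I2 := bmf_integ P (bmfZ 2 bfS).
  rewrite meanD; [|exact/bmf_integ/bmfX|exact: (integD (bmf_integ P b2) I2)].
  rewrite (mean_iter 1 (bmfX 2 (bS N))) -addrA lerD2l.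
  rewrite meanD ?meanZ //; try exact: bmf_integ.
  apply: lerD.
    rewrite -[1](mean_cst P); apply: mean_le; [exact: bmf_integ|exact/bmf_integ/bmf_cst|].
    by move=> x; rewrite -real_normK ?num_real // exprn_ile1.
  rewrite (_ : (fun x => _) = fun x => \sum_(k < N) f x * f (iter k.+1 T x)).
    rewrite (@mean_sum _ _ BX P 'I_N _ (fun k x => f x * f (iter k.+1 T x))) // => k.
    by apply: bmfM => //; exact: (bmf_iter k.+1 bf).
  by apply/funext => x; rewrite /S mulr_sumr; apply: eq_bigr => k _; rewrite -iterSr.
apply/cvgrPdist_le => e e0.
have e2 : 0 < e / 2 by rewrite divr_gt0.
have /cvgrPdist_le/(_ _ e2) [N0 _ rN0] := fN.
(* The first correlations, at most N0 of them, are bounded by 1 and all later ones by e / 2. *)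
have sum_le N : \sum_(k < N) r k.+1 <= N0%:R + N%:R * (e / 2).
  elim: N => [|N IH]; first by rewrite big_ord0 mul0r addr0.
  have [NN0|N0N] := ltnP N N0.
    apply: le_trans (_ : N.+1%:R <= _); last first.
      rewrite (le_trans (_ : _ <= N0%:R)) ?ler_nat // lerDl.
      by rewrite mulr_ge0 // ltW.
    rewrite -[X in _ <= X%:R]card_ord -sumr_const ler_sum // => k _.
    exact: le_trans (ler_norm _) (r1 _).
  rewrite big_ord_recr /= -natr1 mulrDl mul1r addrA lerD //.
  have := rN0 N.+1; rewrite /= sub0r normrN => h.
  exact: le_trans (ler_norm _) (h (leqW N0N)).
(* With this constant the induction for the quadratic bound closes, leaving e / 2 to spare at each
   step. *)
pose C : R := 1 + 2 * N0%:R.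
have C0 : 0 <= C by rewrite /C addr_ge0 // mulr_ge0.
have aN N : a N <= N%:R * C + e / 2 * N%:R ^+ 2.
  elim: N => [|N IH]; first by rewrite a0 mul0r expr0n mulr0 addr0.
  apply: (le_trans (aS N)).
  have -> : N.+1%:R * C + e / 2 * N.+1%:R ^+ 2 = N%:R * C + e / 2 * N%:R ^+ 2 +
      1 + 2 * (N0%:R + N%:R * (e / 2)) + e / 2 by rewrite /C -[N.+1%:R]natr1; ring.
  rewrite ler_wpDr ?(ltW e2) // lerD //; first by rewrite lerD2r.
  by rewrite ler_wpM2l.
near=> N.
rewrite sub0r normrN ger0_norm; last by apply: mean_ge0 => x; exact: sqr_ge0.
have N_gt0 : 0 < N%:R :> R by rewrite ltr0n; near: N; exact: nbhs_infty_gt.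
rewrite (_ : mean _ _ = N%:R^-1 ^+ 2 * a N); last first.
  rewrite /a -meanZ; last exact/bmf_integ/bmfX.
  by congr mean; apply/funext => x; rewrite /avg exprMn.
apply: le_trans (_ : N%:R^-1 ^+ 2 * (N%:R * C + e / 2 * N%:R ^+ 2) <= _).
  by rewrite ler_wpM2l ?sqr_ge0.
have -> : N%:R^-1 ^+ 2 * (N%:R * C + e / 2 * N%:R ^+ 2) = N%:R^-1 * C + e / 2.
  by field; rewrite gt_eqF.
rewrite [leRHS](splitr e) lerD2r ler_pdivrMl //.
rewrite -ler_pdivrMr //; near: N; exact: nbhs_infty_ger.
Unshelve. all: by end_near.
Qed.

(** A character vanishing at [alpha] vanishes on its dense orbit, hence everywhere by continuity. *)
Lemma tchar_alpha_neq0 s : (exists a : torus R, tchar s a <> 0) -> tchar s alpha <> 0.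
Proof.
move=> [a sa] s0; apply: sa.
have sk (k : int) : tchar s (alpha *~ k) = 0.
  have sn (k' : nat) : tchar s (alpha *+ k') = 0.
    by elim: k' => [|k' IH]; rewrite ?mulr0n ?tchar0 // mulrS tcharD s0 IH addr0.
  case: (intP k) => [|k'|k']; first by rewrite mulr0z tchar0.
    by rewrite sn.
  rewrite mulrNz; apply: (@addrI _ (tchar s (alpha *+ k'.+1))).
  by rewrite -tcharD subrr tchar0 addr0 sn.
apply: c1_eq1; apply/eqP; rewrite eq_sym -subr_eq0 -normr_le0.
apply/ler_addgt0Pr => /= e e0; rewrite add0r.
have cg : continuous (fun w : torus R => c1 (tchar s w)).
  exact/continuous_c1/tchar_continuous.
have : nbhs a [set w | `|c1 (tchar s a) - c1 (tchar s w)| < e].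
  by have /cvgrPdist_lt/(_ e e0) := cg a.
rewrite nbhsE => -[U [oU Ua] Ue].
have [|w [Uw [k _ kw]]] := alpha_dense _ oU; first by exists a.
have := Ue _ Uw; rewrite /= -kw sk c10 distrC => /ltW; exact.
Qed.

(** Base case: the phase advances by a fixed nonzero amount at each step, so by [c1_increment] the
    Birkhoff sums telescope and stay bounded. *)
Lemma avg_cvg0_rotation c (m : 'I_d) b : m = 0%N :> nat -> top c m ->
  avg_cvg0 (fun x => c1 (pchar c x + b)).
Proof.
move=> m0 [cm /tchar_alpha_neq0 ca]; set z := tchar (c m) alpha in ca.
have step N x : pchar c (iter N T x) = pchar c x + z *+ N.
  have sN : tchar (c m) (alpha *+ N) = z *+ N.
    by elim: N => [|N IH]; rewrite ?mulr0n ?tchar0 // !mulrS tcharD IH.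
  rewrite -sN -top_slot; apply: (pchar_below cm) => i; rewrite m0 ltnS leqn0 => /eqP i0.
  have -> : i = m by apply: val_inj; rewrite /= i0 m0.
  by rewrite iter_skew_coord0 // [RHS](_ : _ = x m + slot m (alpha *+ N) m) // /slot eqxx.
have [k [b0 kE]] := c1_increment ca.
have bound N x : `|\sum_(l < N) c1 (pchar c (iter l T x) + b)| <= 2 * `|k|.
  have -> : \sum_(l < N) c1 (pchar c (iter l T x) + b) =
      k * (c1 (pchar c x + b + b0) - c1 (pchar c x + b + b0 + z *+ N)).
    elim: N => [|N IH]; first by rewrite big_ord0 addr0 subrr mulr0.
    rewrite big_ord_recr /= IH step (kE (pchar c x + z *+ N + b)) -mulrDr; congr (k * _).
    rewrite (_ : pchar c x + z *+ N + b + b0 = pchar c x + b + b0 + z *+ N).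
      by rewrite mulrSr addrA addrA subrK.
    by rewrite -!addrA; congr (_ + _); rewrite addrC addrA.
  rewrite normrM mulrC ler_wpM2r // (le_trans (ler_normB _ _)) //.
  by rewrite (_ : 2 = 1 + 1) // lerD // normr_c1.
have bc N : @bmf R _ BX (avg N (fun x => c1 (pchar c x + b))).
  exact/bmf_avg/bmf_c1/pchar_continuous.
apply/cvgrPdist_le => e e0; near=> N.
rewrite sub0r normrN ger0_norm; last by apply: mean_ge0 => x; exact: sqr_ge0.
rewrite -(mean_cst P e); apply: mean_le => [||x].
- exact/bmf_integ/bmfX.
- exact/bmf_integ/bmf_cst.
have N_gt0 : 0 < N%:R :> R by rewrite ltr0n; near: N; exact: nbhs_infty_gt.
rewrite -real_normK ?num_real // normrM normfV (gtr0_norm N_gt0).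
have Ni0 : 0 <= N%:R^-1 :> R by rewrite invr_ge0.
apply: le_trans (_ : (N%:R^-1 * (2 * `|k|)) ^+ 2 <= _).
  by rewrite lerXn2r ?nnegrE ?mulr_ge0 // ler_wpM2l.
apply: le_trans (_ : N%:R^-1 * (2 * `|k|) ^+ 2 <= _).
  rewrite exprMn ler_wpM2r ?sqr_ge0 // expr2 ler_piMl // invf_le1 // ler1n.
  by near: N; exact: nbhs_infty_gt.
rewrite ler_pdivrMl // -ler_pdivrMr //; near: N; exact: nbhs_infty_ger.
Unshelve. all: by end_near.
Qed.

Definition msq_cvg0 (F : nat -> X -> R) :=
  mean P (fun x : BX => F N x ^+ 2) @[N --> \oo] --> (0 : R).

Lemma sqr_mean_ge0 (f : X -> R) : 0 <= mean P (fun x : BX => f x ^+ 2).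
Proof. by apply: mean_ge0 => x; exact: sqr_ge0. Qed.

Lemma sqr_meanD_le (f g : X -> R) : @bmf R _ BX f -> @bmf R _ BX g ->
  mean P (fun x : BX => (f x + g x) ^+ 2) <=
  2 * mean P (fun x : BX => f x ^+ 2) + 2 * mean P (fun x : BX => g x ^+ 2).
Proof.
move=> bf bg; have b2 := @bmfX R _ BX _ 2 bf; have c2 := @bmfX R _ BX _ 2 bg.
rewrite -!meanZ; try exact: bmf_integ.
rewrite -meanD; try by apply/bmf_integ/bmfZ.
apply: mean_le; [exact/bmf_integ/bmfX/bmfD|by apply/bmf_integ/bmfD; exact: bmfZ|].
by move=> x; have := sqr_ge0 (f x - g x); rewrite !expr2; lra.
Qed.

Lemma msq_cvg0_le (F : nat -> X -> R) : (forall e : R, 0 < e ->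
    \forall N \near \oo, mean P (fun x : BX => F N x ^+ 2) <= e) -> msq_cvg0 F.
Proof.
move=> h; apply/cvgrPdist_le => e e0; apply: filterS (h e e0) => N.
by rewrite sub0r normrN ger0_norm // sqr_mean_ge0.
Qed.

Lemma msq_cvg0_near (F : nat -> X -> R) (e : R) : msq_cvg0 F -> 0 < e ->
  \forall N \near \oo, mean P (fun x : BX => F N x ^+ 2) <= e.
Proof.
move=> /cvgrPdist_le/[apply]; apply: filterS => N.
by rewrite sub0r normrN ger0_norm // sqr_mean_ge0.
Qed.

Lemma msq_cvg0D (F G : nat -> X -> R) :
  (forall N, @bmf R _ BX (F N)) -> (forall N, @bmf R _ BX (G N)) ->
  msq_cvg0 F -> msq_cvg0 G -> msq_cvg0 (fun N x => F N x + G N x).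
Proof.
move=> bF bG cF cG; apply: msq_cvg0_le => e e0.
have e4 : 0 < e / 4 by rewrite divr_gt0.
near=> N; apply: le_trans (sqr_meanD_le (bF N) (bG N)) _.
have : mean P (fun x : BX => F N x ^+ 2) <= e / 4.
  by near: N; exact: msq_cvg0_near.
have : mean P (fun x : BX => G N x ^+ 2) <= e / 4.
  by near: N; exact: msq_cvg0_near.
lra.
Unshelve. all: by end_near.
Qed.

Lemma msq_cvg0Z r (F : nat -> X -> R) : (forall N, @bmf R _ BX (F N)) ->
  msq_cvg0 F -> msq_cvg0 (fun N x => r * F N x).
Proof.
move=> bF cF; rewrite /msq_cvg0.
rewrite (_ : (fun N => _) = fun N => r ^+ 2 * mean P (fun x : BX => F N x ^+ 2)).
  by rewrite -[X in _ --> X](mulr0 (r ^+ 2)); apply: cvgM => //; exact: cvg_cst.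
apply/funext => N; rewrite -meanZ; last exact/bmf_integ/bmfX.
by congr mean; apply/funext => x; rewrite exprMn.
Qed.

Lemma avgD N (f g : X -> R) x : avg N (fun x => f x + g x) x = avg N f x + avg N g x.
Proof. by rewrite /avg big_split mulrDr. Qed.

Lemma avgZ N r (f : X -> R) x : avg N (fun x => r * f x) x = r * avg N f x.
Proof. by rewrite /avg -mulr_sumr mulrCA. Qed.

Lemma avg_cvg0D (f g : X -> R) : @bmf R _ BX f -> @bmf R _ BX g ->
  avg_cvg0 f -> avg_cvg0 g -> avg_cvg0 (fun x => f x + g x).
Proof.
move=> bf bg cf cg; rewrite /avg_cvg0.
have -> : (fun N => mean P (fun x : BX => avg N (fun x => f x + g x) x ^+ 2)) =
    fun N => mean P (fun x : BX => (avg N f x + avg N g x) ^+ 2).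
  by apply/funext => N; congr mean; apply/funext => x; rewrite avgD.
by apply: (@msq_cvg0D (fun N => avg N f) (fun N => avg N g)) => // N; exact: bmf_avg.
Qed.

Lemma avg_cvg0Z r (f : X -> R) : @bmf R _ BX f ->
  avg_cvg0 f -> avg_cvg0 (fun x => r * f x).
Proof.
move=> bf cf; rewrite /avg_cvg0.
have -> : (fun N => mean P (fun x : BX => avg N (fun x => r * f x) x ^+ 2)) =
    fun N => mean P (fun x : BX => (r * avg N f x) ^+ 2).
  by apply/funext => N; congr mean; apply/funext => x; rewrite avgZ.
by apply: (@msq_cvg0Z r (fun N => avg N f)) => // N; exact: bmf_avg.
Qed.

Lemma avg_cvg0_approx (f : X -> R) : (forall e : R, 0 < e -> exists g h,
    [/\ f = (fun x => g x + h x), @bmf R _ BX g, @bmf R _ BX h,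
        mean P (fun x : BX => g x ^+ 2) <= e & avg_cvg0 h]) -> avg_cvg0 f.
Proof.
move=> fgh; apply: (@msq_cvg0_le (fun N => avg N f)) => e e0.
have e4 : 0 < e / 4 by rewrite divr_gt0.
have [g [h [-> bg bh ge ch]]] := fgh _ e4.
near=> N.
have -> : mean P (fun x : BX => avg N (fun x => g x + h x) x ^+ 2) =
    mean P (fun x : BX => (avg N g x + avg N h x) ^+ 2).
  by congr mean; apply/funext => x; rewrite avgD.
apply: le_trans (sqr_meanD_le (bmf_avg N bg) (bmf_avg N bh)) _.
have := mean_avg_sqr_le N bg.
have : mean P (fun x : BX => avg N h x ^+ 2) <= e / 4.
  by near: N; exact: (@msq_cvg0_near (fun N => avg N h)).
lra.
Unshelve. all: by end_near.
Qed.

(** * Mean ergodic theorem for functions of the first coordinates *)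

Section below.
Variables (m : nat) (le_md : (m <= d)%N).
Hypothesis char_avg : forall c (i : 'I_d), (i < m)%N -> top c i ->
  forall b, avg_cvg0 (fun x => c1 (pchar c x + b)).
Variables (Q : probability (Borel (torus_pow R m)) R).
Hypothesis Q_inv : translation_invariant Q.
Notation fc := (first_coords le_md).
Notation Xm := (torus_pow R m).
Notation BXm := (Borel Xm).

Definition extend (z : Xm) : X :=
  fun i => if insub (i : nat) is Some j then z j else 0.

Definition extend_char (c : 'I_m -> seq (nat * bool)) : 'I_d -> seq (nat * bool) :=
  fun i => if insub (i : nat) is Some j then c j else [::].

Lemma below_extend_char (c : 'I_m -> _) : below (extend_char c) m.
Proof.
by move=> i mi a; rewrite /extend_char insubF ?ltnNge ?mi // /tchar big_nil.
Qed.

Lemma pchar_extend (c : 'I_m -> _) x : pchar (extend_char c) x = pchar c (fc x).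
Proof.
rewrite /pchar (bigID (fun i : 'I_d => (i < m)%N)) /= [X in _ + X]big1 ?addr0.
  rewrite (big_ord_narrow le_md); apply: eq_bigr => j _.
  rewrite /first_coords /extend_char /= insubT //= => jm.
  by congr (tchar (c _) _); exact: val_inj.
by move=> i im; apply: below_extend_char; rewrite leqNgt.
Qed.

Lemma bmf_fc (f : Xm -> R) : @bmf R _ BXm f -> @bmf R _ BX (fun x => f (fc x)).
Proof.
move=> bf; apply: (@bmf_comp R _ _ BX BXm fc f) => //.
by apply: torus_pow_measurable; exact: first_coords_continuous.
Qed.

Lemma mean_fc (f : Xm -> R) : @bmf R _ BXm f ->
  mean P (fun x : BX => f (fc x)) = mean Q (f : BXm -> R).
Proof. exact: first_coords_distribution. Qed.

Lemma avg_cvg0_trig (q : Xm -> R) : trig q ->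
  avg_cvg0 (fun x => q (fc x) - mean Q (q : BXm -> R)).
Proof.
elim=> [r c b|{}p {}q tp IHp tq IHq]; last first.
  have bp := trig_bmf tp; have bq := trig_bmf tq.
  rewrite (_ : (fun x => _) = fun x => (p (fc x) - mean Q (p : BXm -> R)) +
      (q (fc x) - mean Q (q : BXm -> R))); last first.
    by apply/funext => z; rewrite meanD; [ring|exact: bmf_integ|exact: bmf_integ].
  by apply: avg_cvg0D => //; apply: bmfB; try exact: bmf_cst; exact: bmf_fc.
have bc : @bmf R _ BXm (fun x : Xm => c1 (pchar c x + b)) by exact/bmf_c1/pchar_continuous.
rewrite meanZ; last exact: bmf_integ.
rewrite (_ : (fun x => _) = fun x => r * (c1 (pchar (extend_char c) x + b) -
    mean Q (fun x : BXm => c1 (pchar c x + b)))); last first.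
  by apply/funext => x; rewrite pchar_extend mulrBr.
have bext : @bmf R _ BX (fun x : X => c1 (pchar (extend_char c) x + b)).
  exact/bmf_c1/pchar_continuous.
apply: avg_cvg0Z; first by apply: bmfB => //; exact: bmf_cst.
rewrite -mean_fc // (_ : (fun x : BX => c1 (pchar c (fc x) + b)) =
    fun x : BX => c1 (pchar (extend_char c) (iter 0 T x) + b)); last first.
  by apply/funext => x; rewrite pchar_extend.
have [c0|[i ci]] := pchar_topP (extend_char c).
  rewrite (_ : (fun x : BX => _) = fun=> c1 b); last first.
    by apply/funext => x; rewrite c0 add0r.
  rewrite mean_cst /avg_cvg0 (_ : (fun N => _) = fun=> 0); first exact: cvg_cst.
  apply/funext => N; rewrite -[RHS](mean_cst P); congr mean; apply/funext => x.
  rewrite /avg big1 ?mulr0 ?expr0n // => k _.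
  by rewrite c0 add0r subrr.
rewrite (mean_char_iter_top 0 b ci).
rewrite (_ : (fun x : X => _) = fun x => c1 (pchar (extend_char c) x + b)); last first.
  by apply/funext => x; rewrite subr0.
apply: (char_avg _ ci); rewrite ltnNge; apply/negP => mi.
by have [_ [a]] := ci; apply; exact: below_extend_char.
Qed.

(** Approximation by a trigonometric polynomial with its mean removed: the error stays small under
    averaging, and the polynomial averages to 0 by [avg_cvg0_trig]. *)
Lemma avg_cvg0_fc (f : Xm -> R) : @bmf R _ BXm f -> mean Q (f : BXm -> R) = 0 ->
  avg_cvg0 (fun x => f (fc x)).
Proof.
move=> bf f0; apply: avg_cvg0_approx => e e0.
have e4 : 0 < e / 4 by rewrite divr_gt0.
have [_ /(_ _ e4)[q [tq fq _]]] := approx_of_bmf alpha_dense Q Q bf.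
have bq := trig_bmf tq; set r := mean Q (q : BXm -> R).
(* Since f has mean zero, the mean of q is minus that of f - q, which is small in mean square. *)
have r2 : r ^+ 2 <= e / 4.
  rewrite -[r]opprK sqrrN -[- r]add0r -f0 /r -meanB; try exact: bmf_integ.
  apply: le_trans (ltW fq); apply: sqr_mean_le; first exact/bmf_integ/bmfB.
  exact/bmf_integ/bmfX/bmfB.
exists (fun x => (f (fc x) - q (fc x)) + r), (fun x => q (fc x) - r); split.
- by apply/funext => x; ring.
- by apply: bmfD; [apply: bmfB; exact: bmf_fc|exact: bmf_cst].
- by apply: bmfB; [exact: bmf_fc|exact: bmf_cst].
- apply: le_trans (@sqr_meanD_le (fun x => f (fc x) - q (fc x)) (fun=> r) _ _) _.
  + by apply: bmfB; exact: bmf_fc.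
  + exact: bmf_cst.
  + rewrite mean_cst (@mean_fc (fun z => (f z - q z) ^+ 2)); last exact/bmfX/bmfB.
    by move: fq; rewrite /sqdist; lra.
- exact: avg_cvg0_trig.
Qed.

End below.

(** * Decay of correlations *)

Section mixing_step.
Variables (m : 'I_d) (m_gt0 : (0 < m)%N).
Hypothesis char_avg : forall c (i : 'I_d), (i < m)%N -> top c i ->
  forall b, avg_cvg0 (fun x => c1 (pchar c x + b)).
Notation Xm := (torus_pow R m).
Notation BXm := (Borel Xm).
Notation fc := (first_coords (ltnW (ltn_ord m))).
Variables (Q : probability BXm R) (Q_inv : translation_invariant Q).
Variables (y : R -> torus R) (y_subgroup : one_parameter_subgroup y).
Variables (xi eta : Xm -> torus R) (etat : Xm -> {ptws nat -> R}).
Hypothesis phiE : forall z, phi m z = xi z + eta z.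
Hypothesis xiD : forall z z', xi (z + z') = xi z + xi z'.
Hypothesis etat_cont : continuous etat.
Hypothesis eta_lift : forall z k, eta z k = modZ (etat z k).
Hypothesis etat_C1 :
  forall k, strongly_C1 Q (fun t z => etat (last_flow y t z) k).

Lemma subgroup0 : y 0 = 0.
Proof. by apply: (@addrI _ (y 0)); rewrite -y_subgroup.2 !addr0. Qed.

Lemma last_flowE t (z : Xm) : last_flow y t z = z + last_slot m (y t).
Proof.
apply/funext => i; rewrite [RHS](_ : _ = z i + last_slot m (y t) i) //.
by rewrite /last_flow /last_slot; case: eqP; rewrite ?addr0.
Qed.

Lemma last_flow0 (z : Xm) : last_flow y 0 z = z.
Proof. by apply/funext => i; rewrite /last_flow subgroup0 addr0; case: ifP. Qed.

Lemma last_flow_continuous t : continuous (last_flow y t : Xm -> Xm).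
Proof.
rewrite (_ : last_flow y t = fun z : Xm => z + last_slot m (y t)).
  exact: torus_pow_continuousD.
by apply/funext => z; exact: last_flowE.
Qed.

Lemma bmf_etat t k : @bmf R _ BXm (fun z => etat (last_flow y t z) k).
Proof.
apply: continuous_bmf; first exact: torus_pow_compact.
move=> z; apply: (@continuous_comp _ _ _ (fun z => etat (last_flow y t z))
  (fun g : {ptws nat -> R} => g k)); last exact: ptws_proj_continuous.
apply: (@continuous_comp _ _ _ (last_flow y t) etat); last exact: etat_cont.
exact: last_flow_continuous.
Qed.

Definition quotient_etat k (h : R) (z : Xm) : R :=
  h^-1 * (etat (last_flow y h z) k - etat (last_flow y 0 z) k).

Lemma bmf_quotient_etat k h : @bmf R _ BXm (quotient_etat k h).
Proof. by apply/bmfZ/bmfB; exact: bmf_etat. Qed.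

(** The two terms of the difference are translates of each other under Haar measure. *)
Lemma mean_quotient_etat k h : mean Q (quotient_etat k h : BXm -> R) = 0.
Proof.
have b0 := bmf_etat 0 k; have bh := bmf_etat h k.
rewrite /quotient_etat meanZ; last exact/bmf_integ/bmfB.
rewrite meanB; try exact: bmf_integ.
rewrite -[X in _ - X](haar_shift Q_inv (last_slot m (y h)) b0).
rewrite (_ : (fun x : BXm => etat (last_flow y 0 (x + _)) k) =
   fun x : BXm => etat (last_flow y h x) k) ?subrr ?mulr0 //.
by apply/funext => z; rewrite last_flow0 -last_flowE.
Qed.

(** Change of the real lift of the Birkhoff sum of [eta] along an orbit when the flow is applied for
    time t. *)
Definition lift_increment k t N (x : X) : R :=
  \sum_(j < N) (etat (last_flow y t (fc (iter j T x))) k - etat (fc (iter j T x)) k).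

Lemma bmf_lift_increment k t N : @bmf R _ BX (lift_increment k t N).
Proof.
have b0 := bmf_etat 0 k; have bt := bmf_etat t k.
apply: (@bmf_sum R _ BX 'I_N _ (fun j x => etat (last_flow y t (fc (iter j T x))) k -
  etat (fc (iter j T x)) k)) => j.
have := bmf_iter j (bmf_fc (ltnW (ltn_ord m)) (bmfB bt b0)).
by under eq_fun do rewrite last_flow0.
Qed.

(** At time s / N the increment is s times a Birkhoff average of difference quotients of step s / N.
    Replacing them by quotients of one fixed step h0 costs little, uniformly in N, by the Cauchy
    estimate and the contraction property; the fixed quotient has mean zero and averages to 0. *)
Lemma lift_increment_cvg0 k (s : R) : s != 0 ->
  msq_cvg0 (fun N => lift_increment k (s / N%:R) N).
Proof.
move=> s0; have s20 : 0 < s ^+ 2 by rewrite lt0r sqrf_eq0 s0 sqr_ge0.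
apply: msq_cvg0_le => e e0.
(* The two halves contribute 2 e' each, and the factor s^2 is restored at the end. *)
pose e' := e / (4 * s ^+ 2).
have e'0 : 0 < e' by rewrite divr_gt0 // mulr_gt0.
have [de de0 cauchy] := strongly_C1_cauchy (fun t => bmf_etat t k) (etat_C1 k) e'0.
pose h0 := de / 2; have h00 : h0 != 0 by rewrite gt_eqF // divr_gt0.
have h0de : `|h0| < de by rewrite gtr0_norm ?divr_gt0 // /h0; lra.
have bq := bmf_quotient_etat k.
have avg0 : avg_cvg0 (fun x => quotient_etat k h0 (fc x)).
  apply: (avg_cvg0_fc _ char_avg Q_inv (bq h0)); exact: mean_quotient_etat.
pose g2 (x : X) := quotient_etat k h0 (fc x).
have bg2 : @bmf R _ BX g2 by exact: bmf_fc (bq h0).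
near=> N.
have N_gt0 : 0 < N%:R :> R by rewrite ltr0n; near: N; exact: nbhs_infty_gt.
have sN0 : s / N%:R != 0 by rewrite mulf_neq0 // invr_eq0 gt_eqF.
have sNde : `|s / N%:R| < de.
  rewrite normrM normfV (gtr0_norm N_gt0) ltr_pdivrMr // mulrC -ltr_pdivrMr //.
  by near: N; exact: nbhs_infty_gtr.
pose g1 (x : X) := quotient_etat k (s / N%:R) (fc x) - quotient_etat k h0 (fc x).
have bg1 : @bmf R _ BX g1.
  by apply: bmfB => //; exact: bmf_fc (bq _).
rewrite (_ : (fun x : BX => _) = fun x : BX => s ^+ 2 * (avg N g1 x + avg N g2 x) ^+ 2).
  have bb : @bmf R _ BX (fun x => (avg N g1 x + avg N g2 x) ^+ 2).
    by apply/bmfX/bmfD; exact: bmf_avg.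
  rewrite (meanZ (s ^+ 2) (bmf_integ P bb)) -ler_pdivlMl //.
  apply: le_trans (sqr_meanD_le (bmf_avg N bg1) (bmf_avg N bg2)) _.
  have -> : (s ^+ 2)^-1 * e = 4 * e' by rewrite /e'; field.
  have : mean P (fun x : BX => avg N g2 x ^+ 2) <= e'.
    by near: N; exact: (@msq_cvg0_near (fun N => avg N g2)).
  have : mean P (fun x : BX => avg N g1 x ^+ 2) <= e'.
    apply: le_trans (mean_avg_sqr_le N bg1) _.
    rewrite /g1 (@mean_fc m (ltnW (ltn_ord m)) Q Q_inv (fun z =>
      (quotient_etat k (s / N%:R) z - quotient_etat k h0 z) ^+ 2)).
      exact: cauchy.
    by apply/bmfX/bmfB; exact: bq.
  lra.
apply/funext => x; rewrite -avgD -exprMn; congr (_ ^+ 2).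
rewrite /avg mulrA /lift_increment mulr_sumr; apply: eq_bigr => j _.
by rewrite /g1 /g2 subrK /quotient_etat last_flow0 mulVKf.
Unshelve. all: by end_near.
Qed.

Definition seq_increment (l : seq (nat * bool)) t N (x : X) : R :=
  \sum_(p <- l) (if p.2 then - lift_increment p.1 t N x else lift_increment p.1 t N x).

Lemma bmf_seq_increment l t N : @bmf R _ BX (seq_increment l t N).
Proof.
apply: (@bmf_sum R _ BX _ _ (fun (p : nat * bool) x => if p.2 then
  - lift_increment p.1 t N x else lift_increment p.1 t N x)) => -[k []] /=.
  exact/bmfN/bmf_lift_increment.
exact: bmf_lift_increment.
Qed.

Lemma seq_increment_cvg0 l (s : R) : s != 0 ->
  msq_cvg0 (fun N => seq_increment l (s / N%:R) N).
Proof.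
move=> s0; elim: l => [|[k b] l IH].
  rewrite /msq_cvg0 (_ : (fun N => _) = fun=> 0); first exact: cvg_cst.
  apply/funext => N; rewrite -[RHS](mean_cst P); congr mean; apply/funext => x.
  by rewrite /seq_increment big_nil expr0n.
have bk N := bmf_lift_increment k (s / N%:R) N.
rewrite (_ : (fun N => _) = fun N x => (if b then -1 else 1) *
    lift_increment k (s / N%:R) N x + seq_increment l (s / N%:R) N x).
  apply: (@msq_cvg0D (fun N x => (if b then -1 else 1) * lift_increment k (s / N%:R) N x)
    (fun N => seq_increment l (s / N%:R) N)) => //.
  - by move=> N; exact: bmfZ.
  - by move=> N; exact: bmf_seq_increment.
  - by apply: (@msq_cvg0Z _ (fun N => lift_increment k (s / N%:R) N)) => //;
      exact: lift_increment_cvg0.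
apply/funext => N; apply/funext => x; rewrite /seq_increment big_cons /=.
by case: b; rewrite ?mulN1r ?mul1r.
Qed.

Lemma modZ_sum (I : Type) (l : seq I) (F : I -> R) :
  \sum_(i <- l) modZ (F i) = modZ (\sum_(i <- l) F i).
Proof.
elim: l => [|i l IH]; first by rewrite !big_nil modZ0.
by rewrite !big_cons IH modZD.
Qed.

Lemma tcharN l (z : torus R) : tchar l (- z) = - tchar l z.
Proof. by apply: (@addrI _ (tchar l z)); rewrite -tcharD !subrr tchar0. Qed.

Lemma tchar_eta l z : tchar l (eta z) =
  modZ (\sum_(p <- l) (if p.2 then - etat z p.1 else etat z p.1)).
Proof.
rewrite -modZ_sum; apply: eq_bigr => -[k []] _ /=; last exact: eta_lift.
by rewrite modZN eta_lift.
Qed.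

(* The rotation of the phase which the homomorphism part of [phi m] contributes
   at each step when the flow has moved coordinate [prev] by [y t]. *)
Definition speed l t : circle R := tchar l (xi (last_slot m (y t))).

Lemma speedD l : {morph speed l : s t / s + t}.
Proof.
move=> s t; rewrite /speed y_subgroup.2.
rewrite (_ : last_slot m (y s + y t) = last_slot m (y s) + last_slot m (y t)) ?xiD ?tcharD //.
apply/funext => i; rewrite [RHS](_ : _ = last_slot m (y s) i + last_slot m (y t) i) //.
by rewrite /last_slot; case: ifP; rewrite ?addr0.
Qed.

Lemma speed_mulrn l t N : speed l (t *+ N) = speed l t *+ N.
Proof.
elim: N => [|N IH]; last by rewrite !mulrS speedD IH.
by apply: (@addrI _ (speed l 0)); rewrite -speedD !addr0.
Qed.

Let prev_subproof : (m.-1 < d)%N.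
Proof. by rewrite prednK // ltnW. Qed.

Definition prev : 'I_d := Ordinal prev_subproof.

Lemma prevS : prev.+1 = m :> nat.
Proof. by rewrite /= prednK. Qed.

(** [prev] is the last of the first [m] coordinates, so its shift acts on them as the flow and
    commutes there with the iterates. *)
Lemma first_coords_iter_prev j x t :
  fc (iter j T (x + slot prev (y t))) = last_flow y t (fc (iter j T x)).
Proof.
apply/funext => i; rewrite /first_coords.
rewrite (@iter_skew_slot prev j x (y t)) ?prevS //=.
set k := widen_ord _ i; rewrite [LHS](_ : _ = iter j T x k + slot prev (y t) k) //.
rewrite /slot /last_flow /= -/k.
have -> : (k == prev) = (i.+1 == m) by rewrite -val_eqE /= -eqSS prednK.
by case: ifP; rewrite ?addr0.
Qed.

(** The shift reaches the phase directly through coordinate [prev], and through coordinate [m] by N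
    cocycle increments, each split into the homomorphism part and the lifted part. *)
Lemma pchar_iter_prev c N x s : below c m.+1 -> (0 < N)%N ->
  pchar c (iter N T (x + slot prev (y (s / N%:R)))) = pchar c (iter N T x) +
    tchar (c prev) (y (s / N%:R)) + speed (c m) s +
    modZ (seq_increment (c m) (s / N%:R) N x).
Proof.
move=> cm N0; set t := s / N%:R; set a := y t.
set w := iter N T x; set w' := iter N T _.
have prev_m : (m == prev) = false.
  by rewrite -val_eqE /= -[X in (X == _)]prednK // gtn_eqF.
(* On the coordinates seen by c, the perturbed orbit differs from the original only in slots [prev]
   and [m]. *)
have ww : agree m.+1 w' (w + slot prev a + slot m (w' m - w m)).
  move=> i; rewrite ltnS leq_eqVlt => /orP[/eqP/val_inj ->|im].
    rewrite [RHS](_ : _ = w m + slot prev a m + slot m (w' m - w m) m) //.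
    by rewrite /slot eqxx prev_m addr0 addrC subrK.
  rewrite (agree_slot (m := m)) //.
  by apply: (@iter_skew_slot prev N x a); rewrite prevS.
rewrite (pchar_below cm ww) !top_slot -[RHS]addrA; congr (_ + _).
rewrite /w' /w !iter_skew_coord // -/t -/a.
have -> : (x + slot prev a) m = x m.
  by rewrite [LHS](_ : _ = x m + slot prev a m) // /slot prev_m addr0.
rewrite opprD addrACA subrr add0r -sumrB.
have tchar_sum (F : 'I_N -> torus R) :
    tchar (c m) (\sum_j F j) = \sum_j tchar (c m) (F j).
  by apply: (big_morph (tchar (c m))) => [z z'|]; [exact: tcharD|exact: tchar0].
rewrite tchar_sum.
(* As the speed is additive in time, N increments at time s / N add up exactly to the speed at s. *)
have st : t *+ N = s by rewrite /t -[LHS]mulr_natr divfK // pnatr_eq0 -lt0n.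
rewrite -st speed_mulrn.
have -> : speed (c m) t *+ N = \sum_(j < N) speed (c m) t by rewrite sumr_const card_ord.
rewrite /seq_increment /lift_increment.
have -> : \sum_(p <- c m) (if p.2
    then - \sum_(j < N) (etat (last_flow y t (fc (iter j T x))) p.1 - etat (fc (iter j T x)) p.1)
    else \sum_(j < N) (etat (last_flow y t (fc (iter j T x))) p.1 - etat (fc (iter j T x)) p.1)) =
  \sum_(j < N) \sum_(p <- c m) (if p.2
    then - (etat (last_flow y t (fc (iter j T x))) p.1 - etat (fc (iter j T x)) p.1)
    else etat (last_flow y t (fc (iter j T x))) p.1 - etat (fc (iter j T x)) p.1).
  rewrite exchange_big /=; apply: eq_bigr => -[k []] _ //=.
  by rewrite sumrN.
rewrite -modZ_sum -big_split; apply: eq_bigr => j _ /=.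
rewrite first_coords_iter_prev; set z := fc _.
rewrite tcharD tcharN !phiE last_flowE xiD !tcharD -last_flowE.
rewrite !tchar_eta -/(speed _ _).
have -> : \sum_(p <- c m) (if p.2 then - (etat (last_flow y t z) p.1 - etat z p.1)
    else etat (last_flow y t z) p.1 - etat z p.1) =
  \sum_(p <- c m) (if p.2 then - etat (last_flow y t z) p.1 else etat (last_flow y t z) p.1) -
  \sum_(p <- c m) (if p.2 then - etat z p.1 else etat z p.1).
  by rewrite -sumrB; apply: eq_bigr => -[k []] _ //=; rewrite opprB addrC opprK.
rewrite modZD modZN -/(speed (c m) t) addrA.
set u := tchar (c m) (xi z); set v := speed _ _; set e1 := modZ _; set e2 := modZ _.
by rewrite opprD addrACA (addrAC u) subrr add0r addrA.
Qed.

Lemma c1_rotate (z w : circle R) :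
  `|c1 (z + w) - c1 z| <= (1 - c1 w) + `|s1 w|.
Proof.
have -> : c1 (z + w) - c1 z = - (c1 z * (1 - c1 w)) - s1 z * s1 w by rewrite c1D; ring.
rewrite (le_trans (ler_normB _ _)) // normrN !normrM lerD //.
  by rewrite (ger0_norm (_ : 0 <= 1 - c1 w)) ?subr_ge0 ?c1_le1 // ler_piMl ?normr_c1 // subr_ge0 c1_le1.
by rewrite ler_piMl ?normr_s1.
Qed.

(* Shifting coordinate [prev] by [y (s / N)] rotates the phase after [N] steps by
   [speed (c m) s], up to [K (s / N)] and [seq_increment], which both vanish in
   the limit. *)
Lemma mixing_top c e s : below c m.+1 -> s != 0 -> speed (c m) s <> 0 ->
  forall b, mean P (fun x : BX => c1 (pchar e x + pchar c (iter N T x) + b))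
    @[N --> \oo] --> (0 : R).
Proof.
move=> cm s0 cs.
pose Th N (x : X) := pchar e x + pchar c (iter N T x).
have cTh N : continuous (Th N).
  apply: (@circle_continuousD R X (pchar e)); first exact: pchar_continuous.
  exact: pchar_iter_continuous.
have bTh N b : @bmf R _ BX (fun x => c1 (Th N x + b)) by exact: bmf_c1.
apply: (@cvg_mean_c1 R _ BX P Th _ cs) => // b.
(* [K] is the direct contribution of the shift to both phases; q t bounds its effect on [c1] through
   [c1_rotate] and is small near t = 0. *)
pose K t := tchar (e prev) (y t) + tchar (c prev) (y t).
pose q t := (1 - c1 (K t)) + `|s1 (K t)|.
have q_ge0 t : 0 <= q t by rewrite addr_ge0 // subr_ge0 c1_le1.
have q0 : q 0 = 0 by rewrite /q /K subgroup0 !tchar0 addr0 c10 s10 normr0 subrr addr0.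
have cK : continuous K.
  apply: (@circle_continuousD R R (fun t => tchar (e prev) (y t))) => t.
    by apply: (@continuous_comp _ _ _ y); [exact: y_subgroup.1|exact: tchar_continuous].
  by apply: (@continuous_comp _ _ _ y); [exact: y_subgroup.1|exact: tchar_continuous].
have cq : q t @[t --> 0] --> q 0.
  apply: cvgD.
    by apply: cvgB; [exact: cvg_cst|exact: (continuous_c1 cK)].
  apply: cvg_norm.
  exact: (cvg_comp _ _ (cK 0) (@s1_continuous R (K 0))).
apply/cvgrPdist_le => ep ep0.
have ep2 : 0 < ep / 2 by rewrite divr_gt0.
have pi_gt0 : 0 < pi :> R by exact: pi_gt0.
have [de /= de0 qde] : exists2 de : R, 0 < de & forall t, `|t| < de -> q t <= ep / 2.
  have /cvgrPdist_le/(_ _ ep2)/nbhs_ballP[de /= de0 h] := cq; exists de => // t td.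
  have := h t; rewrite /ball /= sub0r normrN => /(_ td).
  by rewrite q0 sub0r normrN; exact: le_trans (ler_norm _).
(* Chosen so that 8 pi^2 et and 2 (ep / 2)^2 are both ep^2 / 2. *)
pose et := ep ^+ 2 / (16 * pi ^+ 2); have et0 : 0 < et.
  by rewrite divr_gt0 ?exprn_gt0 // mulr_gt0 // exprn_gt0.
near=> N; rewrite sub0r normrN.
have N0 : (0 < N)%N by near: N; exact: nbhs_infty_gt.
have N_gt0 : 0 < N%:R :> R by rewrite ltr0n.
set t := s / N%:R.
have tde : `|t| < de.
  rewrite /t normrM normfV (gtr0_norm N_gt0) ltr_pdivrMr // mulrC -ltr_pdivrMr //.
  by near: N; exact: nbhs_infty_gtr.
have seqN : mean P (fun x : BX => seq_increment (c m) t N x ^+ 2) <= et.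
  rewrite /t; near: N; apply: (@msq_cvg0_near (fun N => seq_increment (c m) (s / N%:R) N)) => //.
  exact: seq_increment_cvg0.
set z := speed (c m) s in cs *.
(* Invariance under the shift lets the unrotated mean be compared with the rotated one pointwise,
   with only [K] and the increment left over. *)
rewrite -(haar_shift P_inv (slot prev (y t)) (bTh N b)).
have ThE x : Th N (x + slot prev (y t)) = Th N x + z + K t +
    modZ (seq_increment (c m) t N x).
  rewrite /Th top_slot (pchar_iter_prev x s cm N0) -/t -/z /K.
  set u := pchar e x; set u1 := tchar _ _; set v := pchar c _; set v1 := tchar _ _.
  set r := modZ _; rewrite !addrA; congr (_ + _).
  rewrite -!addrA; congr (_ + _); rewrite addrCA; congr (_ + _).
  by rewrite addrA addrC.
have bz : @bmf R _ BX (fun x => c1 (Th N x + b + z)).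
  by have := bTh N (b + z); under eq_fun do rewrite addrA.
have bsh : @bmf R _ BX (fun x => c1 (Th N (x + slot prev (y t)) + b)).
  apply: (@bmf_c1 R d (fun x => Th N (x + slot prev (y t)))) => x.
  apply: (@continuous_comp _ _ _ (fun x => x + slot prev (y t)) (Th N)).
    exact: torus_pow_continuousD.
  exact: cTh.
rewrite -meanB; try exact: bmf_integ.
rewrite -(ler_pXn2r (n := 2)) ?nnegrE ?(ltW ep0) // real_normK ?num_real //.
have bdiff := bmfB bsh bz.
have bseq := bmf_seq_increment (c m) t N.
apply: le_trans (sqr_mean_le (bmf_integ P bdiff) (bmf_integ P (bmfX 2 bdiff))) _.
apply: le_trans (_ : mean P (fun x : BX => 8 * pi ^+ 2 * seq_increment (c m) t N x ^+ 2 +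
    2 * q t ^+ 2) <= _).
  apply: mean_le; first exact/bmf_integ/bmfX.
    by apply/bmf_integ/bmfD; [exact/bmfZ/bmfX|exact: bmf_cst].
  move=> x; rewrite ThE; set r := seq_increment _ _ _ _.
  set u := Th N x + b + z.
  have -> : Th N x + z + K t + modZ r + b = u + K t + modZ r.
    by rewrite /u addrAC; congr (_ + _); rewrite addrAC; congr (_ + _); rewrite addrAC.
  have h1 := c1_shift (u + K t) r; have h2 := c1_rotate u (K t).
  rewrite -/(q t) in h2.
  have h3 : `|c1 (u + K t + modZ r) - c1 u| <= 2 * pi * `|r| + q t.
    rewrite (_ : _ - c1 u = (c1 (u + K t + modZ r) - c1 (u + K t)) +
      (c1 (u + K t) - c1 u)); last ring.
    by rewrite (le_trans (ler_normD _ _)) // lerD.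
  rewrite -(real_normK (num_real (_ - _))) -(real_normK (num_real r)).
  apply: le_trans (_ : (2 * pi * `|r| + q t) ^+ 2 <= _).
    by rewrite lerXn2r ?nnegrE // (le_trans _ h3).
  by have := sqr_ge0 (2 * pi * `|r| - q t); rewrite !expr2; lra.
rewrite meanD; [|exact/bmf_integ/bmfZ/bmfX|exact/bmf_integ/bmf_cst].
rewrite meanZ ?mean_cst; last exact/bmf_integ/bmfX.
have q2 : q t ^+ 2 <= (ep / 2) ^+ 2.
  by rewrite lerXn2r ?nnegrE ?(ltW ep2) // qde.
apply: le_trans (_ : 8 * pi ^+ 2 * et + 2 * (ep / 2) ^+ 2 <= _).
  by rewrite lerD // ?ler_wpM2l // mulr_ge0 // sqr_ge0.
rewrite le_eqVlt; apply/orP; left; apply/eqP.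
have pi_neq0 : pi != 0 :> R by rewrite gt_eqF.
by rewrite /et; move: (pi : R) pi_neq0 => p p0; field.
Unshelve. all: by end_near.
Qed.

End mixing_step.

(** * Unique ergodicity *)

(** Strong induction on the top coordinate. Mixing at [m] follows from mean ergodicity below [m];
    used with e equal to c and to its conjugate, it makes the autocorrelation of c decay. *)
Lemma char_avg_cvg0 :
  (forall m : 'I_d, (0 < m)%N ->
    (forall c (i : 'I_d), (i < m)%N -> top c i ->
       forall b, avg_cvg0 (fun x => c1 (pchar c x + b))) ->
    forall c e, top c m -> forall b,
      mean P (fun x : BX => c1 (pchar e x + pchar c (iter N T x) + b))
        @[N --> \oo] --> (0 : R)) ->
  forall c (m : 'I_d), top c m -> forall b, avg_cvg0 (fun x => c1 (pchar c x + b)).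
Proof.
move=> mix c m; have [n le_n] := ubnP (m : nat); elim: n m c le_n => // n IH m c.
rewrite ltnS => mn cm b; have [m0|m_gt0] := posnP m; first exact: avg_cvg0_rotation cm.
have avg_below c' (i : 'I_d) : (i < m)%N -> top c' i ->
    forall b, avg_cvg0 (fun x => c1 (pchar c' x + b)).
  by move=> im; apply: IH; exact: leq_trans im mn.
have bc : @bmf R _ BX (fun x => c1 (pchar c x + b)) by exact/bmf_c1/pchar_continuous.
apply: avg_cvg0_decay => // [x|]; first exact: normr_c1.
pose c' i := opp_seq (c i).
have bmix e N b' : @bmf R _ BX (fun x => c1 (pchar e x + pchar c (iter N T x) + b')).
  apply: bmf_c1; apply: (@circle_continuousD R X (pchar e)).
    exact: pchar_continuous.
  exact: pchar_iter_continuous.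
rewrite (_ : (fun N => _) = fun N =>
  2^-1 * (mean P (fun x : BX => c1 (pchar c x + pchar c (iter N T x) + (b + b))) +
          mean P (fun x : BX => c1 (pchar c' x + pchar c (iter N T x) + 0)))).
  rewrite (_ : 0 = 2^-1 * (0 + 0) :> R); last by rewrite addr0 mulr0.
  apply: cvgM; first exact: cvg_cst.
  by apply: cvgD; exact: (mix m).
apply/funext => N; rewrite -meanD; try exact: bmf_integ.
rewrite -meanZ; last by apply: bmf_integ; exact: bmfD.
congr mean; apply/funext => x; rewrite c1M mulrC; congr (_ * (_ + _)).
  by rewrite addrACA.
rewrite addr0 pchar_opp -c1N; congr c1.
by rewrite opprB opprD addrACA subrr addr0 addrC.
Qed.

Hypothesis char_avg : forall c (m : 'I_d), top c m ->
  forall b, avg_cvg0 (fun x => c1 (pchar c x + b)).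

Section unique.
Variables (nu : probability BX R) (nu_inv : Defs.invariant nu (T : BX -> BX)).

Lemma mean_nu_avg N (f : X -> R) : @bmf R _ BX f -> (0 < N)%N ->
  mean nu (avg N f : BX -> R) = mean nu (f : BX -> R).
Proof.
move=> bf N0; have bfk (k : 'I_N) := bmf_iter k bf.
rewrite /avg meanZ; last first.
  by apply: bmf_integ; exact: (@bmf_sum R _ BX 'I_N _ (fun k x => f (iter k T x))).
rewrite (@mean_sum R _ BX nu 'I_N _ (fun k x => f (iter k T x))) //.
rewrite (eq_bigr (fun=> mean nu (f : BX -> R))); last first.
  move=> k _; apply: (@mean_preserved _ _ BX nu (iter k T) f).
  - exact: iter_skew_measurable.
  - exact: iter_invariant.
  - exact: bmf_integ.
by rewrite sumr_const card_ord -[X in _ * X]mulr_natl mulKf // pnatr_eq0 -lt0n.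
Qed.

(* Squared modulus of the Birkhoff average of the character [c]; it is
   insensitive to the coordinate of top index of [c]. *)
Definition avg_modulus c b N (x : X) : R :=
  avg N (fun x => c1 (pchar c x + b)) x ^+ 2 +
  avg N (fun x => c1 (pchar c x + (b - quarter R))) x ^+ 2.

Lemma bmf_avg_modulus c b N : @bmf R _ BX (avg_modulus c b N).
Proof. by apply: bmfD; apply/bmfX/bmf_avg/bmf_c1/pchar_continuous. Qed.

(** Changing the top coordinate rotates every phase of the orbit by the same angle [th], hence
    rotates the vector of cosine and sine averages and preserves its length. *)
Lemma avg_modulus_agree c b N (m : 'I_d) x z : top c m -> agree m x z ->
  avg_modulus c b N z = avg_modulus c b N x.
Proof.
move=> [cm _] xz; set th := tchar (c m) (z m - x m).
have zE : agree m.+1 z (x + slot m (z m - x m)).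
  move=> i; rewrite ltnS leq_eqVlt => /orP[/eqP/val_inj ->|im].
    by rewrite [RHS](_ : _ = x m + slot m (z m - x m) m) // /slot eqxx addrC subrK.
  by rewrite (@agree_slot m x) // xz.
have step k : pchar c (iter k T z) = pchar c (iter k T x) + th.
  by rewrite (pchar_below cm (agree_iter k zE)) pchar_iter_slot.
rewrite /avg_modulus /avg.
set C := \sum_(k < N) c1 (pchar c (iter k T x) + b).
set S := \sum_(k < N) c1 (pchar c (iter k T x) + (b - quarter R)).
have -> : \sum_(k < N) c1 (pchar c (iter k T z) + b) = c1 th * C - s1 th * S.
  rewrite /C /S !mulr_sumr -sumrB; apply: eq_bigr => k _.
  by rewrite c1_quarter step addrAC (c1D _ th); ring.
have -> : \sum_(k < N) c1 (pchar c (iter k T z) + (b - quarter R)) =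
    c1 th * S + s1 th * C.
  rewrite /C /S !mulr_sumr -big_split; apply: eq_bigr => k _.
  by rewrite /= !c1_quarter step addrAC (s1D _ th); ring.
rewrite !exprMn -!mulrDr; congr (_ * _).
transitivity ((c1 th ^+ 2 + s1 th ^+ 2) * (C ^+ 2 + S ^+ 2)); first by ring.
by rewrite c1s1 mul1r.
Qed.

Lemma extend_continuous m (le_md : (m <= d)%N) :
  continuous (@extend m).
Proof.
apply/torus_pow_continuousP => i; rewrite /extend.
case: insubP => [j _ _|_]; first exact: torus_pow_coord_continuous.
exact: (@cst_continuous _ (torus R) 0).
Qed.

(** The function factors through the first [m] coordinates, where [nu] and [P] have the same
    marginal because they agree on its characters. *)
Lemma mean_nu_first m (le_md : (m <= d)%N) (f : X -> R) :
  (forall c, below c m -> forall b, mean nu (fun x : BX => c1 (pchar c x + b)) =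
     mean P (fun x : BX => c1 (pchar c x + b))) ->
  @bmf R _ BX f -> (forall x z, agree m x z -> f z = f x) ->
  mean nu (f : BX -> R) = mean P (f : BX -> R).
Proof.
move=> eqc bf fm; pose BXm := Borel (torus_pow R m).
have mF : measurable_fun [set: BX] (first_coords le_md : BX -> BXm).
  by apply: torus_pow_measurable; exact: first_coords_continuous.
pose H : {mfun BX >-> BXm} := mfun_Sub (mem_set mF).
pose r (z : BXm) : R := f (@extend m z).
have br : bmf r.
  apply: (@bmf_comp R _ _ BXm BX (@extend m) f) => //.
  by apply: torus_pow_measurable; exact: extend_continuous.
have fr : f = fun x => r (first_coords le_md x).
  apply/funext => x; rewrite /r; apply/esym/fm => i im.
  rewrite /extend insubT /first_coords.
  by congr (x _); exact: val_inj.
rewrite fr -(mean_pushforward nu H br) -(mean_pushforward P H br).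
apply: eq_mean_measure; apply: (eq_probability_char alpha_dense) => c b.
have bc : @bmf R _ BXm (fun x : torus_pow R m => c1 (pchar c x + b)).
  exact/bmf_c1/pchar_continuous.
rewrite !mean_pushforward //.
have := eqc _ (below_extend_char c) b.
rewrite (_ : (fun x : BX => c1 (pchar (@extend_char m c) x + b)) =
  fun x : BX => c1 (pchar c (H x) + b)) //.
by apply/funext => x; rewrite (pchar_extend le_md).
Qed.

Lemma skew_uniquely_ergodic (A : set BX) : measurable A -> nu A = P A.
Proof.
apply: (eq_probability_char alpha_dense) => c b.
(* Induction on the number of leading coordinates on which [nu] is known to be Haar. *)
have below_eq n : (n <= d)%N -> forall c, below c n -> forall b,
    mean nu (fun x : BX => c1 (pchar c x + b)) =
    mean P (fun x : BX => c1 (pchar c x + b)); last first.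
  by apply: (below_eq d) => // i di; move: (ltn_ord i); rewrite ltnNge di.
elim: n {c b} => [_|n IH nd] c cn b; have [c0|[m cm]] := pchar_topP c.
- rewrite (_ : (fun x : BX => _) = fun=> c1 b) ?mean_cst //.
  by apply/funext => x; rewrite c0 add0r.
- by have [_ [a]] := cm; rewrite cn.
- rewrite (_ : (fun x : BX => _) = fun=> c1 b) ?mean_cst //.
  by apply/funext => x; rewrite c0 add0r.
have mn : (m <= n)%N.
  by rewrite leqNgt; apply/negP => nm; have [_ [a]] := cm; apply; exact: cn.
have IHm c' : below c' m -> forall b, mean nu (fun x : BX => c1 (pchar c' x + b)) =
    mean P (fun x : BX => c1 (pchar c' x + b)).
  move=> c'm; apply: (IH (ltnW nd)) => i ni; apply: c'm; exact: leq_trans mn ni.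
rewrite (mean_char_iter_top 0 b cm).
have bf b' : @bmf R _ BX (fun x => c1 (pchar c x + b')) by exact/bmf_c1/pchar_continuous.
apply/eqP; rewrite -sqrf_eq0 eq_le sqr_ge0 andbT.
apply/ler_addgt0Pr => /= e e0; rewrite add0r.
have e2 : 0 < e / 2 by rewrite divr_gt0.
have [N [N0 h1 h2]] : exists N, [/\ (0 < N)%N,
    mean P (fun x : BX => avg N (fun x => c1 (pchar c x + b)) x ^+ 2) <= e / 2 &
    mean P (fun x : BX => avg N (fun x => c1 (pchar c x + (b - quarter R))) x ^+ 2)
      <= e / 2].
  have cvgN b' := @msq_cvg0_near (fun N => avg N (fun x => c1 (pchar c x + b'))) _
    (char_avg cm b') e2.
  have [N _ /(_ N (leqnn N))[[N0 h1] h2]] :=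
    filterI (filterI (nbhs_infty_gt 0) (cvgN b)) (cvgN (b - quarter R)).
  by exists N.
rewrite -(mean_nu_avg (bf b) N0).
have bavg b' := bmf_avg N (bf b').
apply: le_trans (sqr_mean_le (bmf_integ nu (bavg b)) (bmf_integ nu (bmfX 2 (bavg b)))) _.
apply: le_trans (_ : mean nu (avg_modulus c b N : BX -> R) <= _).
  apply: mean_le; [exact/bmf_integ/bmfX|exact/bmf_integ/bmf_avg_modulus|].
  by move=> x; rewrite /avg_modulus lerDl sqr_ge0.
(* The squared modulus ignores coordinate [m], so its mean may be computed with Haar measure, where
   both squares are small. *)
rewrite (mean_nu_first (ltnW (ltn_ord m)) IHm (bmf_avg_modulus c b N)); last first.
  by move=> x z; exact: avg_modulus_agree.
rewrite /avg_modulus meanD; [|exact/bmf_integ/bmfX|exact/bmf_integ/bmfX].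
by rewrite (splitr e) lerD.
Qed.

End unique.

(** * Strong mixing *)

Hypothesis mix : forall (m : 'I_d), (0 < m)%N -> forall c e, top c m -> forall b,
  mean P (fun x : BX => c1 (pchar e x + pchar c (iter N T x) + b))
    @[N --> \oo] --> (0 : R).

(** Here the unmoved character e reads some later coordinate while c is arbitrary. If c reads a
    later coordinate too, [mix] applies; otherwise shifting the top coordinate of e rotates the
    whole phase and the mean is exactly 0. *)
Lemma mix_pair c e : ~ below e 1 -> forall b,
  mean P (fun x : BX => c1 (pchar e x + pchar c (iter N T x) + b))
    @[N --> \oo] --> (0 : R).
Proof.
move=> e1 b.
have [e0|[i ei]] := pchar_topP e.
  exfalso; apply: e1 => i _ a; have := e0 (slot i a).
  by rewrite pchar_slot.
have [ei1 [a eia]] := ei.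
have i_gt0 : (0 < i)%N.
  rewrite lt0n; apply/eqP => i0; apply: e1 => j j1 a'; apply: ei1.
  by rewrite i0.
have [c0|[m cm]] := pchar_topP c.
  rewrite (_ : (fun N => _) = fun=> 0); first exact: cvg_cst.
  apply/funext => N; rewrite -(mean_char_iter_top 0 b ei); congr mean.
  by apply/funext => x; rewrite c0 addr0.
have [m0|m_gt0] := posnP m; last exact: (mix m_gt0).
rewrite (_ : (fun N => _) = fun=> 0); first exact: cvg_cst.
apply/funext => N.
apply: (haar_mean_c1 P_inv (Th := fun x => pchar e x + pchar c (iter N T x))
  (a := slot i a) _ eia) => [b'|x].
  apply: bmf_c1; apply: (@circle_continuousD R X (pchar e)).
    exact: pchar_continuous.
  exact: pchar_iter_continuous.
rewrite top_slot addrAC; congr (_ + _ + _).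
have [cm1 _] := cm; apply: (pchar_below cm1) => j jm.
apply: (agree_iter (m := 1)); last by rewrite m0 in jm.
by move=> k k1; rewrite (@agree_slot i x a) // (leq_trans k1).
Qed.

(** Characters of the first coordinate are eigenfunctions of the Koopman operator. *)
Lemma iter_below1 c N : below c 1 -> exists th, forall x : X,
  pchar c (iter N T x) = pchar c x + th.
Proof.
move=> cb; have [c0|[m cm]] := pchar_topP c.
  by exists 0 => x; rewrite !c0 addr0.
have m0 : m = 0%N :> nat.
  apply/eqP; rewrite -leqn0 leqNgt; apply/negP => m_gt0.
  by have [_ [a]] := cm; apply; exact: cb.
exists (tchar (c m) (alpha *+ N)) => x.
rewrite -top_slot; apply: (pchar_below cm.1) => i; rewrite m0 ltnS leqn0 => /eqP i0.
have -> : i = m by apply: val_inj; rewrite /= i0 m0.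
by rewrite iter_skew_coord0 // [RHS](_ : _ = x m + slot m (alpha *+ N) m) // /slot eqxx.
Qed.

Notation Ltwo := (Lfun P 2%:E).

Lemma Lfun2_trig (u : X -> R) (e : R) : (u : BX -> R) \in Ltwo -> 0 < e ->
  exists2 p, trig p & mean P (fun x : BX => (u x - p x) ^+ 2) <= e.
Proof.
move=> Lu e0; have mu := Lfun_measurable Lu; have Iu2 := integ_sqr Lu.
pose A M : set BX := [set x | `|u x| <= M%:R].
have mA M : measurable (A M).
  have := measurableT_comp (@normr_measurable R setT) mu measurableT
    (measurable_itv `]-oo, M%:R]).
  by rewrite setTI (_ : _ @^-1` _ = A M) //; apply/seteqP; split => x /=;
    rewrite /A /= in_itv.
(* Truncation makes u bounded; the squared error is dominated by u^2 and vanishes pointwise for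
   large M. *)
pose tu M (x : BX) := u x * \1_(A M) x.
have btu M : bmf (tu M).
  split; first by apply: measurable_funM => //; exact: measurable_indic.
  exists M%:R => x; rewrite /tu indicE; have [xM|xM] := boolP (x \in A M).
    by rewrite mulr1; move: xM; rewrite inE.
  by rewrite mulr0 normr0.
have cv : mean P (fun x => (u x - tu M x) ^+ 2) @[M --> \oo] --> (0 : R).
  rewrite -(mean_cst P 0); apply: (dominated_mean _ _ Iu2).
  - move=> M; apply/measurable_funX/measurable_funB => //.
    exact: (btu M).1.
  - exact: measurable_cst.
  - move=> M x; rewrite ger0_norm ?sqr_ge0 // /tu indicE.
    by case: (x \in A M); rewrite ?mulr1 ?subrr ?expr0n ?sqr_ge0 //= mulr0 subr0.
  - move=> x; apply: cvg_near_cst; near=> M.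
    rewrite /tu indicE mem_set ?mulr1 ?subrr ?expr0n //.
    by rewrite /A /=; near: M; exact: nbhs_infty_ger.
have e4 : 0 < e / 4 by rewrite divr_gt0.
have /cvgrPdist_le/(_ _ e4)[M _ /(_ M (leqnn M))] := cv.
rewrite /= sub0r normrN => /(le_trans (ler_norm _)) uM.
have [_ /(_ _ e4)[p [tp up _]]] := approx_of_bmf alpha_dense P P (btu M).
exists p => //; have bp := trig_bmf tp.
have Ltu := bmf_Lfun2 P (btu M).
have I1 := integ_sqr (Lfun2B Lu Ltu).
have I2 := integ_sqr (Lfun2B Ltu (bmf_Lfun2 P bp)).
apply: le_trans (_ : mean P (fun x => 2 * (u x - tu M x) ^+ 2 +
    2 * (tu M x - p x) ^+ 2) <= _).
  apply: mean_le; first exact: integ_sqr (Lfun2B Lu (bmf_Lfun2 P bp)).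
    by apply: integD; exact: integZ.
  by move=> x; have := sqr_ge0 ((u x - tu M x) - (tu M x - p x)); rewrite !expr2; lra.
rewrite meanD; try exact: integZ.
rewrite !meanZ //; move: up; rewrite /sqdist; lra.
Unshelve. all: by end_near.
Qed.

(** Young's inequality |fg| <= (D f^2 + g^2 / D) / 2, where D = W / e and eta = e / D make each of
    the two terms at most e before halving. *)
Lemma mean_product_small (V e : R) : 0 < e -> exists2 eta : R, 0 < eta &
  forall f g : BX -> R, f \in Ltwo -> g \in Ltwo ->
    mean P (fun x => f x ^+ 2) <= eta -> mean P (fun x => g x ^+ 2) <= V ->
    `|mean P (fun x => f x * g x)| <= e.
Proof.
move=> e0; pose W := `|V| + 1; have W0 : 0 < W by rewrite ltr_wpDl.
have VW : V <= W by rewrite (le_trans (ler_norm V)) // lerDl.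
pose D := W / e; have D0 : 0 < D by rewrite divr_gt0.
exists (e / D); first by rewrite divr_gt0.
move=> f g Lf Lg fe gV.
have If := integ_sqr Lf; have Ig := integ_sqr Lg.
have Ifg := integM Lf Lg.
pose B := 2^-1 * (D * mean P (fun x => f x ^+ 2) + D^-1 * mean P (fun x => g x ^+ 2)).
have I1 := integZ (2^-1) (integD (integZ D If) (integZ D^-1 Ig)).
have BE : mean P (fun x => 2^-1 * (D * f x ^+ 2 + D^-1 * g x ^+ 2)) = B.
  rewrite meanZ; last exact: integD (integZ D If) (integZ D^-1 Ig).
  by rewrite meanD ?meanZ //; exact: integZ.
have point x : `|f x * g x| <= 2^-1 * (D * f x ^+ 2 + D^-1 * g x ^+ 2).
  rewrite normrM -(real_normK (num_real (f x))) -(real_normK (num_real (g x))).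
  set a := `|f x|; set b := `|g x|.
  have -> : 2^-1 * (D * a ^+ 2 + D^-1 * b ^+ 2) =
      a * b + 2^-1 * D * (a - D^-1 * b) ^+ 2 by field; rewrite gt_eqF.
  by rewrite lerDl mulr_ge0 ?sqr_ge0 // mulr_ge0 // ltW.
have hB : `|mean P (fun x => f x * g x)| <= B.
  rewrite ler_norml -BE; apply/andP; split; last first.
    by apply: mean_le => // x; exact: le_trans (ler_norm _) (point x).
  rewrite lerNl -mulN1r -meanZ //; apply: mean_le => //; first exact: integZ.
  by move=> x; rewrite mulN1r (le_trans _ (point x)) // -normrN ler_norm.
apply: (le_trans hB); rewrite /B ler_pdivrMl // mulr2n mulrDl mul1r.
apply: lerD; first by rewrite mulrC -ler_pdivlMr.
rewrite ler_pdivrMl // /D divfK ?gt_eqF //.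
exact: le_trans gV VW.
Qed.

Definition orth_first (v : X -> R) := forall c, below c 1 -> forall b,
  mean P (fun x : BX => c1 (pchar c x + b) * v x) = 0.

Lemma Lfun2_iter N (v : X -> R) : (v : BX -> R) \in Ltwo ->
  (fun x : BX => v (iter N T x)) \in Ltwo.
Proof.
move=> Lv; have mv := Lfun_measurable Lv.
have I2 := integ_preserved (iter_skew_measurable N) (@skew_iter_invariant N) (integ_sqr Lv).
rewrite inE; apply/andP; split; rewrite inE /=.
  exact: (measurableT_comp mv (iter_skew_measurable N)).
apply: (@lty_poweRy _ _ 2) => //; rewrite sqr_Lnorm2.
exact: (integrable_lty measurableT I2).
Qed.

Lemma mean_sqr_iter N (v : X -> R) : (v : BX -> R) \in Ltwo ->
  mean P (fun x : BX => v (iter N T x) ^+ 2) = mean P (fun x : BX => v x ^+ 2).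
Proof.
move=> Lv; apply: (@mean_preserved _ _ BX P (iter N T) (fun x => v x ^+ 2)).
- exact: iter_skew_measurable.
- exact: skew_iter_invariant.
- exact: integ_sqr.
Qed.

Lemma mean_trig_iter_cvg0 c b q : ~ below c 1 -> trig q ->
  mean P (fun x : BX => c1 (pchar c x + b) * q (iter N T x)) @[N --> \oo] --> (0 : R).
Proof.
move=> cb; have bc : @bmf R _ BX (fun x => c1 (pchar c x + b)).
  exact/bmf_c1/pchar_continuous.
elim=> [r e b'|p {}q tp IHp tq IHq]; last first.
  have bp := trig_bmf tp; have bq := trig_bmf tq.
  rewrite (_ : (fun N => _) = fun N =>
      mean P (fun x : BX => c1 (pchar c x + b) * p (iter N T x)) +
      mean P (fun x : BX => c1 (pchar c x + b) * q (iter N T x))).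
    by rewrite -[X in _ --> X]addr0; exact: cvgD.
  apply/funext => N; rewrite -meanD.
  - by congr mean; apply/funext => x; rewrite mulrDr.
  - by apply/bmf_integ/bmfM => //; exact: (bmf_iter N bp).
  - by apply/bmf_integ/bmfM => //; exact: (bmf_iter N bq).
have bmixN e' N b'' : @bmf R _ BX (fun x => c1 (pchar e' x + pchar e (iter N T x) + b'')).
  apply: bmf_c1; apply: (@circle_continuousD R X (pchar e')).
    exact: pchar_continuous.
  exact: pchar_iter_continuous.
pose c' i := opp_seq (c i).
have c'b : ~ below c' 1.
  move=> c'b; apply: cb => i i1 a; have := c'b i i1 a.
  by rewrite /c' tchar_opp => /eqP; rewrite oppr_eq0 => /eqP.
rewrite (_ : (fun N => _) = fun N => (r / 2) *
  (mean P (fun x : BX => c1 (pchar c x + pchar e (iter N T x) + (b + b'))) +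
   mean P (fun x : BX => c1 (pchar c' x + pchar e (iter N T x) + (b' - b))))).
  rewrite (_ : 0 = (r / 2) * (0 + 0) :> R); last by rewrite addr0 mulr0.
  apply: cvgM; first exact: cvg_cst.
  by apply: cvgD; exact: mix_pair.
apply/funext => N; rewrite -meanD; try exact: bmf_integ.
rewrite -meanZ; last by apply: bmf_integ; exact: bmfD.
congr mean; apply/funext => x; rewrite mulrCA c1M pchar_opp.
set A := pchar c x; set B := pchar e _.
have -> : c1 (A + b - (B + b')) = c1 (- A + B + (b' - b)).
  by rewrite -c1N opprB opprD addrACA (addrC B).
by rewrite (addrACA A b); field.
Qed.

(** The function u is replaced by a trigonometric polynomial. Its characters of the first coordinate
    are killed exactly by orthogonality; for the others v is also replaced by a polynomial and
    [mix_pair] applies. *)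
Lemma mean_iter_cvg0 (u v : X -> R) : (u : BX -> R) \in Ltwo ->
  (v : BX -> R) \in Ltwo -> orth_first v ->
  mean P (fun x : BX => u x * v (iter N T x)) @[N --> \oo] --> (0 : R).
Proof.
move=> Lu Lv ov.
pose V := mean P (fun x : BX => v x ^+ 2).
have LvN N := Lfun2_iter N Lv.
have trig_case p : trig p ->
    mean P (fun x : BX => p x * v (iter N T x)) @[N --> \oo] --> (0 : R).
  elim=> [r c b|{}p q tp IHp tq IHq]; last first.
    have Lp := bmf_Lfun2 P (trig_bmf tp); have Lq := bmf_Lfun2 P (trig_bmf tq).
    rewrite (_ : (fun N => _) = fun N => mean P (fun x : BX => p x * v (iter N T x)) +
        mean P (fun x : BX => q x * v (iter N T x))).
      by rewrite -[X in _ --> X]addr0; exact: cvgD.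
    apply/funext => N; rewrite -meanD; try exact: integM.
    by congr mean; apply/funext => x; rewrite mulrDl.
  have bc b' : @bmf R _ BX (fun x => c1 (pchar c x + b')) by exact/bmf_c1/pchar_continuous.
  have Lc b' := bmf_Lfun2 P (bc b').
  have [cb|cb] := pselect (below c 1).
    rewrite (_ : (fun N => _) = fun=> 0); first exact: cvg_cst.
    apply/funext => N; have [th thE] := iter_below1 N cb.
    (* The phase b - th compensates the rotation of the eigenfunction over N steps, so invariance
       reduces the mean to an orthogonality relation. *)
    rewrite -[RHS](mulr0 r) -(ov c cb (b - th)).
    rewrite -(@mean_preserved _ _ BX P (iter N T)
      (fun x => c1 (pchar c x + (b - th)) * v x)).
    - rewrite -meanZ; last first.
        apply: (@integ_preserved _ _ BX P (iter N T)
          (fun x => c1 (pchar c x + (b - th)) * v x)).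
        - exact: iter_skew_measurable.
        - exact: skew_iter_invariant.
        - exact: integM.
      congr mean; apply/funext => x; rewrite mulrA thE.
      by rewrite addrACA subrr addr0.
    - exact: iter_skew_measurable.
    - exact: skew_iter_invariant.
    - exact: integM.
  rewrite (_ : (fun N => _) = fun N =>
      r * mean P (fun x : BX => c1 (pchar c x + b) * v (iter N T x))); last first.
    apply/funext => N; rewrite -meanZ; last exact: integM.
    by congr mean; apply/funext => x; rewrite mulrA.
  rewrite -[X in _ --> X](mulr0 r); apply: cvgM; first exact: cvg_cst.
  apply/cvgrPdist_le => e e0; have e2 : 0 < e / 2 by rewrite divr_gt0.
  have [eta eta0 small] := mean_product_small 1 e2.
  have [q tq vq] := Lfun2_trig Lv eta0.
  have Lq := bmf_Lfun2 P (trig_bmf tq).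
  near=> N; rewrite sub0r normrN.
  have LqN := Lfun2_iter N Lq.
  rewrite (_ : mean P _ =
     mean P (fun x : BX => (v (iter N T x) - q (iter N T x)) * c1 (pchar c x + b)) +
     mean P (fun x : BX => c1 (pchar c x + b) * q (iter N T x))); last first.
    rewrite -meanD; [|exact: integM (Lfun2B (LvN N) LqN) (Lc b)|exact: integM].
    by congr mean; apply/funext => x; ring.
  rewrite (le_trans (ler_normD _ _)) // (splitr e) lerD //.
    apply: small => //; first exact: Lfun2B.
      by rewrite (mean_sqr_iter N (v := fun x => v x - q x)) //; exact: Lfun2B.
    rewrite -[leRHS](mean_cst P); apply: mean_le.
    + exact: integ_sqr.
    + exact/bmf_integ/bmf_cst.
    + by move=> x; rewrite -real_normK ?num_real // exprn_ile1 // normr_c1.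
  near: N; have /cvgrPdist_le/(_ _ e2) := mean_trig_iter_cvg0 b cb tq.
  by apply: filterS => N; rewrite sub0r normrN.
apply/cvgrPdist_le => e e0; have e2 : 0 < e / 2 by rewrite divr_gt0.
have [eta eta0 small] := mean_product_small V e2.
have [p tp up] := Lfun2_trig Lu eta0.
have Lp := bmf_Lfun2 P (trig_bmf tp).
near=> N; rewrite sub0r normrN.
rewrite (_ : mean P _ = mean P (fun x : BX => (u x - p x) * v (iter N T x)) +
   mean P (fun x : BX => p x * v (iter N T x))); last first.
  rewrite -meanD; [|exact: integM (Lfun2B Lu Lp) (LvN N)|exact: integM].
  by congr mean; apply/funext => x; ring.
rewrite (le_trans (ler_normD _ _)) // (splitr e) lerD //.
  by apply: small => //; [exact: Lfun2B|rewrite mean_sqr_iter].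
near: N; have /cvgrPdist_le/(_ _ e2) := trig_case p tp.
by apply: filterS => N; rewrite sub0r normrN.
Unshelve. all: by end_near.
Qed.

Lemma iter_koopman N (g : BX -> R[i]) :
  iter N (koopman (T : BX -> BX)) g = g \o iter N T.
Proof.
elim: N => [|N IH] //; rewrite iterS IH /koopman; apply/funext => x /=.
by rewrite -iterSr.
Qed.

(** The test functions are real, so the vanishing of the complex inner product separates into its
    real and imaginary parts. *)
Lemma ominus_orth (f : X -> R[i]) : (L2_ominus P 1) f ->
  [/\ (fun x : BX => complex.Re (f x)) \in Ltwo, (fun x : BX => complex.Im (f x)) \in Ltwo,
      orth_first (fun x => complex.Re (f x)) & orth_first (fun x => complex.Im (f x))].
Proof.
move=> [[Lr Li] fo].
suff h c b : below c 1 ->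
    mean P (fun x : BX => c1 (pchar c x + b) * complex.Re (f x)) = 0 /\
    mean P (fun x : BX => c1 (pchar c x + b) * complex.Im (f x)) = 0.
  by split => // c cb b; have [] := h c b cb.
move=> cb; pose g (x : X) : R[i] := (c1 (pchar c x + b))%:C%C.
have bc : @bmf R _ BX (fun x => c1 (pchar c x + b)) by exact/bmf_c1/pchar_continuous.
have : L2inner P g f = 0.
  apply: fo; split.
    by split; [exact: (bmf_Lfun2 P bc)|exact: (Lfun_cst P 0 2)].
  move=> x z xz; rewrite /g; congr ((c1 (_ + _))%:C%C).
  exact: (pchar_below cb).
rewrite /L2inner /complex_integral => -[h1 h2]; split.
  rewrite -[RHS]h1; congr mean; apply/funext => x.
  by rewrite /g; case: (f x) => p q /=; ring.
rewrite -[RHS]h2; congr mean; apply/funext => x.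
by rewrite /g; case: (f x) => p q /=; ring.
Qed.

Lemma skew_strongly_mixing : strongly_mixing_in P (L2_ominus P 1) (T : BX -> BX).
Proof.
move=> f g /ominus_orth[Lfr Lfi ofr ofi] /ominus_orth[Lgr Lgi ogr ogi].
have Lr N := Lfun2_iter N Lgr; have Li N := Lfun2_iter N Lgi.
have rr := mean_iter_cvg0 Lfr Lgr ogr; have ii := mean_iter_cvg0 Lfi Lgi ogi.
have ri := mean_iter_cvg0 Lfr Lgi ogi; have ir := mean_iter_cvg0 Lfi Lgr ogr.
apply: (@complex_cvg R nat _ _ 0).
  rewrite (_ : (fun N => _) = fun N =>
      mean P (fun x : BX => complex.Re (f x) * complex.Re (g (iter N T x))) +
      mean P (fun x : BX => complex.Im (f x) * complex.Im (g (iter N T x)))).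
    by rewrite -[X in _ --> X]addr0; exact: cvgD rr ii.
  apply/funext => N; rewrite -meanD; try exact: integM.
  rewrite /L2inner /complex_integral /= iter_koopman; congr mean; apply/funext => x /=.
  by case: (f x) => a b; case: (g _) => a' b' /=; ring.
rewrite (_ : (fun N => _) = fun N =>
    mean P (fun x : BX => complex.Re (f x) * complex.Im (g (iter N T x))) -
    mean P (fun x : BX => complex.Im (f x) * complex.Re (g (iter N T x)))).
  by rewrite -[X in _ --> X]subr0; exact: cvgB ri ir.
apply/funext => N; rewrite -meanB; try exact: integM.
rewrite /L2inner /complex_integral /= iter_koopman; congr mean; apply/funext => x /=.
by case: (f x) => a b; case: (g _) => a' b' /=; ring.
Qed.

End skew.

(** * Combining decay of correlations, unique ergodicity and strong mixing *)

Theorem theorem3p3 (R : realType) (d : nat)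
    (mu : forall n, probability (Borel (torus_pow R n)) R)
    (alpha : torus R) (y : R -> torus R)
    (phi xi eta : forall m, torus_pow R m -> torus R)
    (d_ge2 : (2 <= d)%N)
    (mu_haar : forall n, (1 <= n)%N -> translation_invariant (mu n))
    (alpha_dense : dense [set alpha *~ n | n in [set: int]])
    (y_subgroup : one_parameter_subgroup y)
    (y_ergodic : ergodic_flow (mu 1%N) (fun t => translation (y t)))
    (y_C1 : forall n, (1 <= n)%N -> circle_pow_C1 (fun t (k : 'I_n) => y t k))
    (phi_cont : forall m, (1 <= m < d)%N -> continuous (phi m))
    (phiE : forall m, (1 <= m < d)%N -> forall x, phi m x = xi m x + eta m x)
    (xi_cont : forall m, (1 <= m < d)%N -> continuous (xi m))
    (xi_hom : forall m, (1 <= m < d)%N ->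
       forall x x', xi m (x + x') = xi m x + xi m x')
    (xi_nontrivial : forall m, (1 <= m < d)%N ->
       forall chi, is_character chi -> chi <> cst 1 ->
         (fun x => chi (xi m (last_slot m x))) <> cst 1)
    (eta_cont : forall m, (1 <= m < d)%N -> continuous (eta m))
    (eta_lift : forall m, (1 <= m < d)%N ->
       exists etat : torus_pow R m -> {ptws nat -> R},
         [/\ continuous etat,
             forall x k, eta m x k = modZ (etat x k) &
             forall k, strongly_C1 (mu m)
               (fun t x => etat (last_flow y t x) k)]) :
  strongly_mixing_in (mu d) (L2_ominus (mu d) 1) (skew_product alpha phi) /\
  uniquely_ergodic (mu d) (skew_product alpha phi).
Proof.
have Pd := mu_haar d (ltnW d_ge2).
have mix (m : 'I_d) : (0 < m)%N ->
    (forall c (i : 'I_d), (i < m)%N -> top R c i -> forall b,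
       avg_cvg0 alpha phi (mu d) (fun x => c1 (pchar c x + b))) ->
    forall c e, top R c m -> forall b,
      mean (mu d) (fun x : Borel (torus_pow R d) =>
        c1 (pchar e x + pchar c (iter N (skew_product alpha phi) x) + b))
        @[N --> \oo] --> (0 : R).
  move=> m_gt0 avg c e [cm [a ca]] b.
  have md : (1 <= m < d)%N by rewrite m_gt0 ltn_ord.
  have [etat [etat_cont etaE etat_C1]] := eta_lift m md.
  (* [lam] is the character whose value along the flow is the speed of the phase; it is nontrivial
     by the hypothesis on [xi], so ergodicity yields a time s with [lam] (y s) nonzero. *)
  pose lam z := tchar (c m) (xi m (last_slot m z)).
  have last_slotD (z z' : torus R) :
      last_slot m (z + z') = last_slot m z + last_slot m z' :> torus_pow R m.
    apply/funext => i; rewrite [RHS](_ : _ = last_slot m z i + last_slot m z' i) //.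
    by rewrite /last_slot; case: ifP; rewrite ?addr0.
  have clam : continuous lam.
    move=> z; apply: (@continuous_comp _ _ _ (fun z => xi m (last_slot m z))).
      apply: (@continuous_comp _ _ _ (last_slot m)); last exact: xi_cont.
      apply: (iffRL (@torus_pow_continuousP R m (torus R) (last_slot m)) _ z) => i.
      rewrite /last_slot; case: (i.+1 == m); first by move=> ?; exact: cvg_id.
      exact: (@cst_continuous (torus R) (torus R) 0).
    exact: tchar_continuous.
  have lamD z z' : lam (z + z') = lam z + lam z'.
    by rewrite /lam last_slotD xi_hom // tcharD.
  have lam_neq0 : exists z, lam z <> 0.
    have := xi_nontrivial m md _ (tchar_is_character R (c m)).
    move=> nt; apply: contrapT => /forallNP lam0; apply: nt.
      move=> /(congr1 (fun f => f a)) /(congr1 (@complex.Re R)) /= /c1_eq1.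
      exact: ca.
    apply/funext => z; have -> : tchar (c m) (xi m (last_slot m z)) = 0.
      by apply: contrapT; exact: lam0.
    by rewrite c10 s10.
  have [s lams] := ergodic_char_neq0 (mu_haar 1%N isT) y_ergodic clam lamD lam_neq0.
  have s0 : s != 0.
    apply/eqP => s0; apply: lams; rewrite s0.
    have y0 : y 0 = 0 by apply: (@addrI _ (y 0)); rewrite -y_subgroup.2 !addr0.
    by apply: (@addrI _ (lam (y 0))); rewrite -lamD y0 !addr0.
  exact: (mixing_top phi_cont Pd alpha_dense m_gt0 avg (mu_haar m m_gt0) y_subgroup
    (phiE m md) (xi_hom m md) etat_cont etaE etat_C1 e cm s0 lams).
have avg := char_avg_cvg0 phi_cont Pd alpha_dense mix.
(* Mean ergodicity now holds for all characters, so mixing becomes unconditional. *)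
have {}mix (m : 'I_d) : (0 < m)%N -> forall c e, top R c m -> forall b,
      mean (mu d) (fun x : Borel (torus_pow R d) =>
        c1 (pchar e x + pchar c (iter N (skew_product alpha phi) x) + b))
        @[N --> \oo] --> (0 : R).
  by move=> m_gt0; apply: mix => // c i _; exact: avg.
split; first exact: (skew_strongly_mixing phi_cont Pd alpha_dense mix).
split; first exact: (skew_invariant phi_cont Pd alpha_dense).
exact: (skew_uniquely_ergodic phi_cont Pd alpha_dense avg).
Qed.
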